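(* There exist $\nu_0,T_0>0$ and $C>0$, depending only on the shear profile $b$, such that for all $\nu\in(0,\nu_0]$, with $T=T_0\,\nu^{-\frac{N+1}{N+3}}$ and $\Omega_T=\Omega\times(0,T)$, every real-valued $f\in C^\infty(\bar\Omega\times[0,T])$ with $f=0$ on $\{y=0,1\}$ and $\int_{\mathbb T}f(x,y,t)\,dx=0$ for all $(y,t)$ satisfies $$\nu^{\frac{N+1}{N+3}}\|f\|_{L^2(\Omega_T)}^2+\nu^{\frac{N+1}{N+3}}\|f\|_{Q^{1/(N+3)}_{\partial_x}(\Omega_T)}^2\le C\left(\nu\,\|f\|_{L^2_{t,x}H^1_{0,y}(\Omega_T)}^2+\nu^{-1}\|X_0f\|_{L^2_{t,x}H^{-1}_y(\Omega_T)}^2\right),$$ where $X_0=\partial_t+b(y)\partial_x$.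
   Context: $\mathbb T=\mathbb R/\mathbb Z$, $D=(0,1)$, $\Omega=\mathbb T\times D$ (Dirichlet setting). The shear profile $b\in C^\infty(\bar D)$ is real-valued and has precisely $M\ge 0$ critical points $y_1,\dots,y_M$ in $\bar D$ (finitely many). At each critical point $y_i$ there is an integer $N_i\ge1$ with $b^{(k)}(y_i)=0$ for all $1\le k\le N_i$ and $b^{(N_i+1)}(y_i)\ne0$. Set $N=\max_{1\le i\le M}N_i$ if $M\ge1$, and $N=0$ if $M=0$. Norms: $\|f\|_{L^2_{t,x}H^1_{0,y}(\Omega_T)}=\|\partial_yf\|_{L^2(\Omega_T)}$; $\|g\|_{L^2_{t,x}H^{-1}_y(\Omega_T)}=\sup\int_{\Omega_T}g\,\varphi\,dx\,dy\,dt$, the supremum being over $\varphi\in L^2_{t,x}(H^1_0)_y(\Omega_T)$ with $\|\partial_y\varphi\|_{L^2(\Omega_T)}=1$. For $s>0$, $$\|f\|_{Q^s_{\partial_x}(\Omega_T)}=\sup_{\sigma>0}\sigma^{-1}\|f(x+\sigma^{1/s},y,t)-f(x,y,t)\|_{L^2(\Omega_T)} .$$ *)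

(* Defs.v *)
From HB Require Import structures.
From mathcomp Require Import all_boot all_order all_algebra.
From mathcomp Require Import all_classical all_reals all_analysis.

Set Implicit Arguments.
Unset Strict Implicit.
Unset Printing Implicit Defensive.

Import Order.TTheory GRing.Theory Num.Theory.
Import numFieldNormedType.Exports.

Local Open Scope classical_set_scope.
Local Open Scope ring_scope.

(* A point of space-time is a triple z = (x, y, t) : R * R * R, so that
   x = z.1.1, y = z.1.2, t = z.2.  Functions on the torus T = R/Z are
   1-periodic functions of x : R, integrated over [0, 1[. *)

Section Shear.
Variable R : realType.

(* b \in C^oo([0, 1]): [db k] is the k-th derivative of [b] on ]0, 1[, extended
   by continuity to [0, 1]; the values of [db k] on [0, 1] are determined by
   those of [b], those outside [0, 1] are irrelevant. *)
Definition smooth_profile (b : R -> R) (db : nat -> R -> R) : Prop :=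
  [/\ db 0%N = b,
      forall k, {within `[0, 1], continuous (db k)} &
      forall k (y : R), 0 < y < 1 -> is_derive y 1 (db k) (db k.+1 y)].

(* [yc] lists without repetition the critical points of [b] in [0, 1], and
   [n i] is the order of vanishing of b' at [yc i]. *)
Definition critical_points (db : nat -> R -> R) (M : nat)
    (yc : 'I_M -> R) (n : 'I_M -> nat) : Prop :=
  [/\ injective yc,
      forall y : R, (0 <= y <= 1 /\ db 1%N y = 0) <-> (exists i, yc i = y) &
      forall i, [/\ (1 <= n i)%N,
                    forall k, (1 <= k <= n i)%N -> db k (yc i) = 0 &
                    db (n i).+1 (yc i) != 0]].

(* This is 0 when M = 0. *)
Definition max_order (M : nat) (n : 'I_M -> nat) : nat := (\max_(i < M) n i)%N.

Definition OmegaT (T : R) : set (R * R * R) :=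
  [set z | [/\ 0 <= z.1.1 < 1, 0 < z.1.2 < 1 & 0 < z.2 < T]].

(* The preimages in R * R * R of T x [0, 1] x [0, T] and T x ]0, 1[ x ]0, T[. *)
Definition closedCyl (T : R) : set (R * R * R) :=
  [set z | 0 <= z.1.2 <= 1 /\ 0 <= z.2 <= T].

Definition openCyl (T : R) : set (R * R * R) :=
  [set z | 0 < z.1.2 < 1 /\ 0 < z.2 < T].

Definition ex : R * R * R := (1, 0, 0).
Definition ey : R * R * R := (0, 1, 0).
Definition et : R * R * R := (0, 0, 1).

Definition periodic_x (T : R) (f : R * R * R -> R) : Prop :=
  forall x y t : R, closedCyl T (x, y, t) -> f (x + 1, y, t) = f (x, y, t).

(* Smoothness up to the boundary: all partial derivatives
   [F i j k] = d_x^i d_y^j d_t^k f exist in the open cylinder and extend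
   continuously to the closed one. *)
Definition smooth_closedCyl (T : R) (f : R * R * R -> R) : Prop :=
  exists F : nat -> nat -> nat -> R * R * R -> R,
  [/\ F 0%N 0%N 0%N = f,
      forall i j k, {within closedCyl T, continuous (F i j k)} &
      forall i j k (z : R * R * R), openCyl T z ->
        [/\ is_derive z ex (F i j k) (F i.+1 j k z),
            is_derive z ey (F i j k) (F i j.+1 k z) &
            is_derive z et (F i j k) (F i j k.+1 z)]].

Definition X0 (b : R -> R) (f : R * R * R -> R) (z : R * R * R) : R :=
  'D_et f z + b z.1.2 * 'D_ex f z.

Section L2.
Context d (X : measurableType d) (mu : {measure set X -> \bar R}).

Definition L2norm (D : set X) (f : X -> R) : \bar R :=
  'N[mu]_2%:E [EFin \o (f \_ D)]%E.

Definition in_L2 (D : set X) (f : X -> R) : Prop :=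
  measurable_fun D f /\ (L2norm D f < +oo)%E.
End L2.

Local Notation leb1 := (@lebesgue_measure R).

Definition leb2 := (leb1 \x leb1)%E.
HB.instance Definition _ := Measure.on leb2.

(* On [_ \x _] itself, canonical inference of sigma-finiteness only finds the
   instance for subprobability measures. *)
Lemma leb2_sigma_finite : sigma_finite setT leb2.
Proof.
have /sigma_finiteP[F [TF ndF Foo]] := sigma_finiteT leb1.
exists (fun k => F k `*` F k).
  rewrite -setXTT TF predeqE => -[x y]; split.
    move=> [/= [k _ Fkx] [l _ Fly]]; exists (maxn k l) => //; split.
    - by move: x Fkx; exact/subsetPset/ndF/leq_maxl.
    - by move: y Fly; exact/subsetPset/ndF/leq_maxr.
  by move=> [k _ []/= ? ?]; split; exists k.
move=> k; have [mF Fk] := Foo k.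
split; first exact: measurableX.
by rewrite /leb2 product_measure1E// lte_mul_pinfty// ge0_fin_numE.
Qed.

HB.instance Definition _ :=
  Measure_isSigmaFinite.Build _ _ _ leb2 leb2_sigma_finite.

Definition leb3 := (leb2 \x leb1)%E.
HB.instance Definition _ := Measure.on leb3.

Definition L2normOT (T : R) (f : R * R * R -> R) : \bar R :=
  L2norm leb3 (OmegaT T) f.

Definition test_function (u : R -> R) : Prop :=
  (forall k (y : R), derivable (derive1n k u) y 1) /\
  (exists a c : R, [/\ 0 < a, c < 1 & forall y, u y != 0 -> a <= y <= c]).

(* u \in H^1_0(0, 1), the closure of C_c^oo(0, 1) in H^1(0, 1), with weak
   derivative [du]. *)
Definition in_H10 (u du : R -> R) : Prop :=
  [/\ in_L2 leb1 `]0, 1[ u,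
      in_L2 leb1 `]0, 1[ du &
      exists w : nat -> R -> R,
      [/\ forall m, test_function (w m),
          (fun m => L2norm leb1 `]0, 1[ (w m \- u)) @ \oo --> 0%E &
          (fun m => L2norm leb1 `]0, 1[ (derive1 (w m) \- du)) @ \oo --> 0%E]].

(* phi \in L^2_{t,x} (H^1_0)_y (Omega_T), with weak y-derivative [dphi]. *)
Definition in_L2H10 (T : R) (phi dphi : R * R * R -> R) : Prop :=
  [/\ in_L2 leb3 (OmegaT T) phi,
      in_L2 leb3 (OmegaT T) dphi &
      {ae leb2, forall p : R * R, 0 <= p.1 < 1 -> 0 < p.2 < T ->
        in_H10 (fun y => phi (p.1, y, p.2)) (fun y => dphi (p.1, y, p.2))}].

(* For f smooth up to the boundary and vanishing on {y = 0, 1}, the weak and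
   classical y-derivatives coincide. *)
Definition norm_L2H10 (T : R) (f : R * R * R -> R) : \bar R :=
  L2normOT T ('D_ey f).

Definition norm_L2Hm1 (T : R) (g : R * R * R -> R) : \bar R :=
  ereal_sup [set r | exists phi dphi : R * R * R -> R,
    [/\ in_L2H10 T phi dphi, L2normOT T dphi = 1%E &
        r = (\int[leb3]_(z in OmegaT T) (g z * phi z)%:E)%E]].

Definition norm_Q (s T : R) (f : R * R * R -> R) : \bar R :=
  ereal_sup [set r | exists2 sigma : R, 0 < sigma &
    r = ((sigma^-1)%:E *
         L2normOT T (fun z => (f (z.1.1 + sigma `^ s^-1, z.1.2, z.2) - f z)%R))%E].

End Shear.

(* Main.v *)
(* Put [w(h) = f(x + h) - f] with [h = sigma^(N+3)], [mu = nu^(1/(N+3))] and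
   [delta = mu sigma].  Away from the [O(delta)]-neighbourhoods of the critical points,
   [X0 f] is tested against [kap(y) w(x + theta, y + delta, t)] with [kap = chi / b'],
   which compares the transports at the heights [y] and [y + delta]: since
   [kap (b(y + delta) - b(y))] is about [delta chi], this controls
   [delta <w, d_x w(x + theta)>] up to an [x]-derivative and boundary terms at
   [t = 0, T], and the latter are bounded by the energy identity with the weight
   [2t/T - 1].  Integrating in [theta] over [[0, h]] gives a bound on the second
   difference [w(x + h) - w] in terms of
   [K = mu ||d_y f|| + mu^-(N+2) ||X0 f||_(H^-1)] and of the Hoelder seminorm [M] of
   [f] itself: its square is at most
   [C sigma^2 (K M + K^2 + M^2 / T0)].  The neighbourhoods of the critical points are
   reached by a shift in [y], which costs [delta ||d_y f||].  As [h] becomes [2 h],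
   [sigma] is multiplied by [2^(1/(N+3)) < 2], so second differences control first
   ones and [M <= C K] for [T0] large.  Averaging over [h], the vanishing mean in [x]
   gives [||f|| <= M]. *)

(* The exponents come from the size of the weight: where [chi] lives, [|b'|] is at least of order
   [delta^N], so [kap] costs [delta^-N] and its derivative [delta^-(N+1)]; with [nu = mu^(N+3)] all
   powers of [mu] then cancel. The obstacle is that the resulting bound for [||w(x + h) - w||^2]
   contains a term of order [sigma ||X0 w||_(H^-1) ||w||], one power of [sigma] short: with [w = f]
   it would give only half of the Hoelder exponent. Taking for [w] a difference of [f], of norm at
   most [sigma M], supplies the missing factor, at the price of controlling second differences in
   terms of the unknown [M]. Smoothness of [f] makes [M] finite, and this qualitative fact is what
   allows [M] to be absorbed. Nothing is known of [f] at [t = 0] and [t = T]; the length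
   [T = T0 mu^-(N+1)] is the one for which the boundary terms reduce to [M^2 / T0], with a factor
   independent of [nu]. *)
Require Import Defs.
From HB Require Import structures.
From mathcomp Require Import all_boot all_order all_algebra.
From mathcomp Require Import all_classical all_reals all_analysis.
From mathcomp Require Import measurable_realfun ring lra.

Import Order.TTheory GRing.Theory Num.Theory.
Import numFieldNormedType.Exports.

Local Open Scope classical_set_scope.
Local Open Scope ring_scope.

(** * Integrals of continuous functions over the space-time cylinder *)

Section Integral3.
Context {R : realType}.
Implicit Types (F G : R * R * R -> R) (T : R).

(** The measurable sets of the product are generated by rectangles, so [U] is written as the
    countable union of the boxes inside it with rational centre and radius [1 / (n + 1)]. *)
Lemma open_measurable3 (U : set (R * R * R)) : open U -> measurable U.
Proof.
move=> oU.
pose B (q : rat * rat * rat * nat) : set (R * R * R) :=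
  (ball (ratr q.1.1.1 : R) (q.2.+1%:R^-1) `*` ball (ratr q.1.1.2 : R) (q.2.+1%:R^-1))
    `*` ball (ratr q.1.2 : R) (q.2.+1%:R^-1).
have mB q : measurable (B q).
  by apply: measurableX; [apply: measurableX|]; apply: open_measurable;
    apply: ball_open; rewrite invr_gt0.
have -> : U = \bigcup_(q in [set q | B q `<=` U]) B q.
  apply/seteqP; split; last by move=> z [q /= BU]; exact: BU.
  move=> [[x y] t] Uz.
  have /nbhs_ballP[e /= e0 eU] : nbhs (x, y, t) U by rewrite openE in oU; exact: oU.
  have [n hn] : exists n : nat, n.+1%:R^-1 < e / 2.
    have [n] := near_infty_natSinv_lt (PosNum (divr_gt0 e0 (ltr0n _ 2))).
    by move=> _ /(_ n (leqnn n)) /=; exists n.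
  have n0 : 0 < (n.+1%:R^-1 : R) by rewrite invr_gt0.
  have [r rE] : exists r : R, r = n.+1%:R^-1 by exists n.+1%:R^-1.
  rewrite -rE in hn n0.
  have rn (u : R) : exists q : rat, `|ratr q - u| < r.
    have /rat_in_itvoo[q] : u - r < u + r by lra.
    rewrite in_itv /= => /andP[q1 q2]; exists q; rewrite ltr_norml; apply/andP; split; lra.
  have [qx hx] := rn x; have [qy hy] := rn y; have [qt ht] := rn t.
  exists (qx, qy, qt, n); last by rewrite /B /= -rE; split; [split|].
  move=> z; rewrite /B /= -rE => -[[/= Bx By] Bt]; apply: eU; split; [split|] => /=.
  - rewrite /ball /= in Bx *; rewrite (le_lt_trans (ler_distD (ratr qx) _ _))//.
    by rewrite (distrC x); lra.
  - rewrite /ball /= in By *; rewrite (le_lt_trans (ler_distD (ratr qy) _ _))//.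
    by rewrite (distrC y); lra.
  - rewrite /ball /= in Bt *; rewrite (le_lt_trans (ler_distD (ratr qt) _ _))//.
    by rewrite (distrC t); lra.
rewrite bigcup_mkcond.
apply: countable_bigcupT_measurable => [|q]; first exact: countableP.
by case: ifPn.
Qed.

Lemma continuous_measurable_fun3 F : continuous F -> measurable_fun setT F.
Proof.
move=> /continuousP cf; apply: (measurability _ (RGenOpens.measurableE R)).
move=> _ [_ [a [b ->] <-]]; rewrite setTI; apply: open_measurable3.
exact/cf/interval_open.
Qed.

Lemma OmegaTE T : OmegaT T = ((`[0, 1[ `*` `]0, 1[) `*` `]0, T[)%classic :> set (R * R * R).
Proof.
apply/seteqP; split => [[[x y] t]|[[x y] t]] /=; rewrite /OmegaT /= !in_itv /=.
  by move=> [-> -> ->].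
by move=> [[-> ->] ->].
Qed.

Lemma measurable_OmegaT T : measurable (OmegaT T : set (R * R * R)).
Proof. by rewrite OmegaTE; apply: measurableX; [apply: measurableX|]. Qed.

Lemma OmegaT_finite T : (@leb3 R (OmegaT T) < +oo)%E.
Proof.
rewrite OmegaTE.
have -> : @leb3 R (`[0, 1[ `*` `]0, 1[ `*` `]0, T[) =
    (@leb2 R (`[0%R, 1%R[ `*` `]0%R, 1%R[) * lebesgue_measure `]0%R, T[)%E.
  by apply: product_measure1E => //; apply: measurableX.
have -> : @leb2 R (`[0, 1[ `*` `]0, 1[) =
    (lebesgue_measure `[0%R, 1%R[ * lebesgue_measure `]0%R, 1%R[)%E.
  exact: product_measure1E.
rewrite !lebesgue_measure_itv/= !lte_fin.
rewrite ltr01 !sube0 mul1e.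
case: ifPn => _; by rewrite ?mule0 ?mul1e ltry.
Qed.

Lemma continuous_bounded3 F T : continuous F -> [bounded F z | z in OmegaT T].
Proof.
move=> cF.
have : compact ((`[0, 1] `*` `[0, 1]) `*` `[0, T] : set (R * R * R)).
  by apply: compact_setX; [apply: compact_setX|]; exact: segment_compact.
move/(@continuous_compact _ _ F) => /(_ (continuous_subspaceT cF)) /compact_bounded.
move=> [M [Mr hM]]; exists M; split => // N MN z Oz; apply: (hM N MN).
exists z => //; move: Oz; rewrite /OmegaT; case: z => -[x y] t /= [h1 h2 h3].
rewrite !in_itv /=; split; [split|]; lra.
Qed.

Lemma continuous_integrable3 F T : continuous F ->
  (@leb3 R).-integrable (OmegaT T) (EFin \o F).
Proof.
move=> cF; apply: measurable_bounded_integrable.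
- exact: measurable_OmegaT.
- exact: OmegaT_finite.
- by apply: measurable_funS (continuous_measurable_fun3 _ cF).
- exact: continuous_bounded3.
Qed.

(** Real-valued, since the integrands to come are continuous, hence bounded on [OmegaT T]: linearity
    and monotonicity then need continuity only, which [cont] discharges. *)
Definition I3 T F : R := Rintegral (@leb3 R) (OmegaT T) F.

Lemma I3E T F : continuous F ->
  (\int[@leb3 R]_(z in OmegaT T) (F z)%:E)%E = (I3 T F)%:E.
Proof.
move=> cF; rewrite /I3 /Rintegral fineK//.
by apply: integrable_fin_num; [exact: measurable_OmegaT|exact: continuous_integrable3].
Qed.

Lemma I3D T F G : continuous F -> continuous G ->
  I3 T (fun z => F z + G z) = I3 T F + I3 T G.
Proof.
by move=> cF cG; apply: RintegralD;
  [exact: measurable_OmegaT|exact: continuous_integrable3..].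
Qed.

Lemma I3B T F G : continuous F -> continuous G ->
  I3 T (fun z => F z - G z) = I3 T F - I3 T G.
Proof.
by move=> cF cG; apply: RintegralB;
  [exact: measurable_OmegaT|exact: continuous_integrable3..].
Qed.

Lemma I3Z T c F : continuous F -> I3 T (fun z => c * F z) = c * I3 T F.
Proof.
by move=> cF; apply: RintegralZl;
  [exact: measurable_OmegaT|exact: continuous_integrable3..].
Qed.

Lemma I3_le T F G : continuous F -> continuous G ->
  (forall x y t, 0 <= x < 1 -> 0 < y < 1 -> 0 < t < T -> F (x, y, t) <= G (x, y, t)) ->
  I3 T F <= I3 T G.
Proof.
move=> cF cG FG; apply: le_Rintegral;
  [exact: measurable_OmegaT|exact: continuous_integrable3..|].
by move=> [[x y] t] [] /=; exact: FG.
Qed.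

Lemma I3_eq T F G :
  (forall x y t, 0 <= x < 1 -> 0 < y < 1 -> 0 < t < T -> F (x, y, t) = G (x, y, t)) ->
  I3 T F = I3 T G.
Proof.
by move=> FG; apply: eq_Rintegral => -[[x y] t]; rewrite inE => -[] /=; exact: FG.
Qed.

Lemma I3_ge0 T F : (forall z, 0 <= F z) -> 0 <= I3 T F.
Proof. by move=> F0; apply: Rintegral_ge0. Qed.

End Integral3.

(** * Fubini's theorem and slices of continuous functions *)

Section Slices.
Context {R : realType}.
Implicit Types (F G : R * R * R -> R) (T : R).
Local Notation leb1 := (@lebesgue_measure R).

Lemma patch_OmegaT F T x y t :
  ((EFin \o F) \_ (OmegaT T)) (x, y, t) =
  if [&& 0 <= x, x < 1, 0 < y, y < 1, 0 < t & t < T] then (F (x, y, t))%:E else 0%E.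
Proof.
rewrite /patch; case: ifPn; case: ifPn => //.
- move=> h; rewrite inE => -[/= h1 h2 h3]; exfalso; move/negP: h; apply; lra.
- move=> h; rewrite notin_setE => -[]; split => /=; lra.
Qed.

Lemma I3_patch F T : continuous F ->
  (\int[@leb3 R]_z ((EFin \o F) \_ (OmegaT T)) z)%E = (I3 T F)%:E.
Proof. by move=> cF; rewrite -integral_mkcond; exact: I3E. Qed.

Lemma patch_integrable3 F T : continuous F ->
  (@leb3 R).-integrable setT ((EFin \o F) \_ (OmegaT T)).
Proof.
move=> cF; rewrite -integrable_mkcond; last exact: measurable_OmegaT.
exact: continuous_integrable3.
Qed.

(** Fubini yields integrable slices for almost every [t] only; continuity gives them for every [t],
    so that Fubini can be applied again inside each slice. *)
Lemma patch_integrable2 F T t : continuous F ->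
  (@leb2 R).-integrable setT (fun p => ((EFin \o F) \_ (OmegaT T)) (p, t)).
Proof.
move=> cF.
pose B : set (R * R) := `[0, 1[ `*` `]0, 1[.
have mB : measurable B by apply: measurableX.
have [tT|tT] := boolP ((0 < t) && (t < T)); last first.
  rewrite (_ : (fun p => _) = cst 0%E); first exact: integrable0.
  apply/funext => -[x y]; rewrite patch_OmegaT; case: ifPn => // h.
  by exfalso; move/negP: tT; apply; lra.
rewrite (_ : (fun p => _) = (EFin \o (fun p => F (p, t))) \_ B); last first.
  apply/funext => -[x y]; rewrite patch_OmegaT /patch; case: ifPn; case: ifPn => //.
    by rewrite notin_setE /B /= !in_itv /= => h1 h2; exfalso; apply: h1; lra.
  by rewrite inE /B /= !in_itv /= => h1 h2; exfalso; move/negP: h2; apply; lra.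
rewrite -integrable_mkcond//; apply: measurable_bounded_integrable => //.
- have leb2B : @leb2 R B = (leb1 `[0%R, 1%R[ * leb1 `]0%R, 1%R[)%E.
    exact: product_measure1E.
  suff : (@leb2 R B < +oo)%E by []; rewrite leb2B.
  rewrite !lebesgue_measure_itv/= !lte_fin ltr01 !sube0 mul1e; exact: ltry.
- apply: (@measurable_funS _ _ _ _ setT) => //.
  apply: (@measurableT_comp _ _ _ _ _ _ F); first exact: continuous_measurable_fun3.
  exact: measurable_fun_pair.
- have [M [Mr hM]] := @continuous_bounded3 R F T cF; exists M; split => // N MN.
  move=> -[x y] /=; rewrite /B /= !in_itv /= => -[h1 h2]; apply: (hM N MN).
  by split.
Qed.

Lemma Rintegral_patch1 (f : R -> R) (D : set R) : leb1.-integrable D (EFin \o f) ->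
  measurable D ->
  (\int[leb1]_x ((EFin \o f) \_ D) x)%E = (\int[leb1]_(x in D) f x)%:E.
Proof.
move=> fi mD; rewrite -integral_mkcond /Rintegral fineK//.
exact: integrable_fin_num.
Qed.

Lemma continuous_integrable1 (f : R -> R) (i : interval R) (a b : R) :
  continuous f -> [set` i] `<=` `[a, b] -> leb1.-integrable [set` i] (EFin \o f).
Proof.
move=> cf iab.
have : leb1.-integrable `[a, b] (EFin \o f).
  apply: continuous_compact_integrable; first exact: segment_compact.
  exact: continuous_subspaceT.
by apply: integrableS => //; exact: measurable_itv.
Qed.

Lemma continuous_pair (S U V : topologicalType) (f : S -> U) (g : S -> V) :
  continuous f -> continuous g -> continuous (fun x => (f x, g x)).
Proof. by move=> cf cg x; apply: (cvg_pair (cf x) (cg x)). Qed.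

Lemma slice_continuous1 F y t : continuous F -> continuous (fun x => F (x, y, t)).
Proof.
move=> cF; have c : continuous (fun x : R => (x, y, t)).
  apply: (@continuous_pair R (R * R)%type R (fun x => (x, y)) (fun=> t)) => [|?]; last exact: cvg_cst.
  by apply: (@continuous_pair R R R id (fun=> y)) => ?; [exact: cvg_id|exact: cvg_cst].
by move=> x; apply: (@continuous_comp _ _ _ _ F); [exact: c|exact: cF].
Qed.

Lemma slice_continuous2 F x t : continuous F -> continuous (fun y => F (x, y, t)).
Proof.
move=> cF; have c : continuous (fun y : R => (x, y, t)).
  apply: (@continuous_pair R (R * R)%type R (fun y => (x, y)) (fun=> t)) => [|?]; last exact: cvg_cst.
  by apply: (@continuous_pair R R R (fun=> x) id) => ?; [exact: cvg_cst|exact: cvg_id].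
by move=> y; apply: (@continuous_comp _ _ _ _ F); [exact: c|exact: cF].
Qed.

Lemma slice_continuous3 F x y : continuous F -> continuous (fun t => F (x, y, t)).
Proof.
move=> cF; have c : continuous (fun t : R => (x, y, t)).
  by apply: (@continuous_pair R (R * R)%type R (fun=> (x, y)) id) => ?; [exact: cvg_cst|exact: cvg_id].
by move=> t; apply: (@continuous_comp _ _ _ _ F); [exact: c|exact: cF].
Qed.

(** Fubini enters only through the sign of an inner integral. Comparisons and equalities of
    integrals over the cylinder are then obtained by subtraction, without studying the inner
    integral as a function of the remaining variables. *)
Lemma I3_ge0_x F T : continuous F ->
  (forall y t, 0 < y < 1 -> 0 < t < T -> 0 <= \int[leb1]_(x in `[0, 1[) F (x, y, t)) ->
  0 <= I3 T F.
Proof.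
move=> cF h; rewrite -lee_fin -I3_patch// -(fubini2 (patch_integrable3 _ T cF)).
apply: integral_ge0 => t _; rewrite /fubini_G.
rewrite -(fubini2 (patch_integrable2 _ T t cF)).
apply: integral_ge0 => y _; rewrite /fubini_G.
have [yt|yt] := boolP [&& 0 < y, y < 1, 0 < t & t < T]; last first.
  under eq_integral => x _.
    rewrite patch_OmegaT ifF; last by apply/negP => ?; move/negP: yt; apply; lra.
    over.
  by rewrite integral0.
rewrite (_ : (fun x => _) = (EFin \o (fun x => F (x, y, t))) \_ `[0, 1[); last first.
  apply/funext => x; rewrite patch_OmegaT /patch; case: ifPn; case: ifPn => //.
    by rewrite notin_setE /= !in_itv /= => h1 h2; exfalso; apply: h1; lra.
  by rewrite inE /= !in_itv /= => h1 h2; exfalso; move/negP: h2; apply; lra.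
rewrite Rintegral_patch1//; first by rewrite lee_fin; apply: h; lra.
apply: (continuous_integrable1 _ _ 0 1); first exact: slice_continuous1.
by move=> x /=; rewrite !in_itv/=; lra.
Qed.

Lemma I3_ge0_y F T : continuous F ->
  (forall x t, 0 <= x < 1 -> 0 < t < T -> 0 <= \int[leb1]_(y in `]0, 1[) F (x, y, t)) ->
  0 <= I3 T F.
Proof.
move=> cF h; rewrite -lee_fin -I3_patch// -(fubini2 (patch_integrable3 _ T cF)).
apply: integral_ge0 => t _; rewrite /fubini_G.
rewrite -(fubini1 (patch_integrable2 _ T t cF)).
apply: integral_ge0 => x _; rewrite /fubini_F.
have [yt|yt] := boolP [&& 0 <= x, x < 1, 0 < t & t < T]; last first.
  under eq_integral => y _.
    rewrite patch_OmegaT ifF; last by apply/negP => ?; move/negP: yt; apply; lra.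
    over.
  by rewrite integral0.
rewrite (_ : (fun x => _) = (EFin \o (fun y => F (x, y, t))) \_ `]0, 1[); last first.
  apply/funext => y; rewrite patch_OmegaT /patch; case: ifPn; case: ifPn => //.
    by rewrite notin_setE /= !in_itv /= => h1 h2; exfalso; apply: h1; lra.
  by rewrite inE /= !in_itv /= => h1 h2; exfalso; move/negP: h2; apply; lra.
rewrite Rintegral_patch1//; first by rewrite lee_fin; apply: h; lra.
apply: (continuous_integrable1 _ _ 0 1); first exact: slice_continuous2.
by move=> y /=; rewrite !in_itv/=; lra.
Qed.

Lemma I3_ge0_t F T : continuous F ->
  (forall x y, 0 <= x < 1 -> 0 < y < 1 -> 0 <= \int[leb1]_(t in `]0, T[) F (x, y, t)) ->
  0 <= I3 T F.
Proof.
move=> cF h; rewrite -lee_fin -I3_patch// -(fubini1 (patch_integrable3 _ T cF)).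
apply: integral_ge0 => -[x y] _; rewrite /fubini_F.
have [yt|yt] := boolP [&& 0 <= x, x < 1, 0 < y & y < 1]; last first.
  under eq_integral => t _.
    rewrite patch_OmegaT ifF; last by apply/negP => ?; move/negP: yt; apply; lra.
    over.
  by rewrite integral0.
rewrite (_ : (fun x => _) = (EFin \o (fun t => F (x, y, t))) \_ `]0, T[); last first.
  apply/funext => t; rewrite patch_OmegaT /patch; case: ifPn; case: ifPn => //.
    by rewrite notin_setE /= !in_itv /= => h1 h2; exfalso; apply: h1; lra.
  by rewrite inE /= !in_itv /= => h1 h2; exfalso; move/negP: h2; apply; lra.
rewrite Rintegral_patch1//; first by rewrite lee_fin; apply: h; lra.
apply: (continuous_integrable1 _ _ 0 T); first exact: slice_continuous3.
by move=> t /=; rewrite !in_itv/=; lra.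
Qed.

End Slices.

(** * One-variable calculus: antiderivatives, translations and increments *)

Section OneDim.
Context {R : realType}.
Local Notation leb1 := (@lebesgue_measure R).
Implicit Types (f g u v : R -> R) (a b c p q y : R).

Lemma is_derive_continuous f (x d : R) : is_derive x 1 f d -> {for x, continuous f}.
Proof. by move=> [fd _]; apply: differentiable_continuous; apply/derivable1_diffP. Qed.

Lemma continuous_sqr (S : topologicalType) (f : S -> R) :
  continuous f -> continuous (fun x => f x ^+ 2).
Proof.
move=> cf; rewrite (_ : (fun x => _) = (fun x => f x * f x)).
  by move=> x; apply: cvgM; exact: cf.
by apply/funext => x; rewrite expr2.
Qed.

Lemma RintFTC f F a b : a < b -> continuous f -> continuous F ->
  (forall x, a < x < b -> is_derive x 1 F (f x)) ->
  \int[leb1]_(x in `[a, b]) f x = F b - F a.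
Proof.
move=> ab cf cF dF; rewrite /Rintegral (continuous_FTC2 (F := F))//.
- exact: continuous_subspaceT.
- split.
  + by move=> x; rewrite in_itv /= => /dF[].
  + exact/cvg_at_right_filter/cF.
  + exact/cvg_at_left_filter/cF.
- by move=> x; rewrite in_itv /= derive1E => /dF[].
Qed.

Lemma Rint_oo f a b : continuous f ->
  \int[leb1]_(x in `]a, b[) f x = \int[leb1]_(x in `[a, b]) f x.
Proof.
move=> cf.
have sub (i : interval R) : [set` i] `<=` `[a, b] -> leb1.-integrable [set` i] (EFin \o f).
  exact: continuous_integrable1.
by rewrite Rintegral_itv_bndo_bndc ?Rintegral_itv_obnd_cbnd//; apply: sub => x /=;
  rewrite !in_itv /= => /andP[? ?]; lra.
Qed.

Lemma Rint_co f a b : continuous f ->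
  \int[leb1]_(x in `[a, b[) f x = \int[leb1]_(x in `[a, b]) f x.
Proof.
move=> cf; rewrite Rintegral_itv_bndo_bndc//; apply: (continuous_integrable1 _ _ a b cf).
by move=> x /=; rewrite !in_itv /= => /andP[? ?]; lra.
Qed.

Lemma antiderivative_gt f c : continuous f -> exists U : R -> R,
  forall x, c < x -> is_derive x 1 U (f x).
Proof.
move=> cf; exists (fun x => \int[leb1]_(t in `[c, x]) f t) => x cx.
have fi : leb1.-integrable `[c, x + 1] (EFin \o f).
  apply: continuous_compact_integrable; first exact: segment_compact.
  exact: continuous_subspaceT.
have xx1 : x < x + 1 by lra.
have [] := continuous_FTC1 (a := BLeft c) xx1 fi _ (cf x); first by [].
by move=> dU <-; rewrite derive1E; exact: DeriveDef.
Qed.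

Lemma is_derive_comp_opp f (x d : R) : is_derive (- x) 1 f d ->
  is_derive x 1 (fun z => f (- z)) (- d).
Proof.
move=> df; have -> : - d = d * -1 by rewrite mulrN1.
exact: (@is_derive1_comp R f -%R).
Qed.

(** [antiderivative_gt] only reaches to the right of its base point. A second antiderivative,
    obtained by reflection, covers the left; both are normalised at 0, agree on []-1, 0[] by the
    mean value theorem, and are glued at [-1/2]. Having [U] on the whole line turns integrals into
    increments, and integral inequalities into monotonicity statements. *)
Lemma antiderivative f : continuous f -> exists U : R -> R,
  forall x : R, is_derive x 1 U (f x).
Proof.
move=> cf; have [A dA] := antiderivative_gt f (-1) cf.
have [|B dB] := antiderivative_gt (fun x => f (- x)) (-1).
  by move=> x; apply: (@continuous_comp _ _ _ -%R f); [exact: opp_continuous|exact: cf].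
have dBN (x : R) : x < 1 -> is_derive x 1 (fun z => B (- z)) (- f x).
  move=> x1; rewrite -{2}[x]opprK; apply: is_derive_comp_opp.
  by apply: dB; lra.
have AB y : -1 < y -> y < 0 -> A y - A 0 = B 0 - B (- y).
  move=> y1 y0.
  have [||z _] := @MVT R (fun z => A z + B (- z)) (cst 0) y 0 y0.
  - move=> z; rewrite in_itv /= => /andP[? ?].
    have ? := dA z ltac:(lra); have ? := dBN z ltac:(lra).
    by apply: is_derive_eq; rewrite subrr.
  - apply: continuous_in_subspaceT => z; rewrite inE /= in_itv /= => /andP[? ?].
    have ? := dA z ltac:(lra); have ? := dBN z ltac:(lra).
    apply: cvgD; [exact: (is_derive_continuous A z (f z))|].
    exact: (is_derive_continuous (fun z => B (- z)) z (- f z)).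
  by rewrite oppr0 mul0r => E; lra.
exists (fun x => if -2^-1 < x then A x - A 0 else B 0 - B (- x)) => x.
case: (ltP (-2^-1) x) => x2.
- apply: (@near_eq_is_derive _ _ _ (fun z => A z - A 0)).
    near=> z; rewrite ifT//; near: z; exact: lt_nbhsr.
  have ? := dA x ltac:(lra); by apply: is_derive_eq; rewrite subr0.
- apply: (@near_eq_is_derive _ _ _ (fun z => B 0 - B (- z))).
    near=> z; case: ifPn => // z2; rewrite AB//; first lra.
    by near: z; apply: lt_nbhsl; lra.
  have e := is_deriveB (is_derive_cst (B 0) x 1) (dBN x ltac:(lra)).
  by rewrite sub0r opprK in e.
Unshelve. all: by end_near. Qed.

Lemma MVT_between f df a b : (forall x : R, is_derive x 1 f (df x)) ->
  exists x, [/\ Num.min a b <= x, x <= Num.max a b & f b - f a = df x * (b - a)].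
Proof.
move=> dfE.
have cf : continuous f by move=> x; exact: is_derive_continuous (dfE x).
case: (leP a b) => ab.
- have [x xab E] := @MVT_segment R f df a b ab (fun x _ => dfE x) (continuous_subspaceT cf).
  by exists x; move: xab; rewrite in_itv /= => /andP[? ?]; split.
- have [x xab E] := @MVT_segment R f df b a (ltW ab) (fun x _ => dfE x) (continuous_subspaceT cf).
  exists x; move: xab; rewrite in_itv /= => /andP[? ?]; split => //.
  by rewrite -opprB E; ring.
Qed.

Lemma Rint_antiderivative f U a b : a <= b -> continuous f ->
  (forall x : R, is_derive x 1 U (f x)) -> \int[leb1]_(x in `[a, b]) f x = U b - U a.
Proof.
rewrite le_eqVlt => /predU1P[<-|ab] cf dU.
  by rewrite set_itv1 Rintegral_set1 subrr.
apply: RintFTC => // x; exact: is_derive_continuous (dU x).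
Qed.

Lemma nondecreasing_is_derive f df a b : continuous f ->
  (forall x, a < x < b -> is_derive x 1 f (df x)) ->
  (forall x, a < x < b -> 0 <= df x) ->
  forall x y, a <= x -> x <= y -> y <= b -> f x <= f y.
Proof.
move=> cf dfE df0 x y ax xy yb.
have [->//|neq] := eqVneq x y.
have lt_xy : x < y by rewrite lt_neqAle neq.
have [|w wxy E] := @MVT R f df x y lt_xy _ (continuous_subspaceT cf).
  by move=> w; rewrite in_itv /= => /andP[? ?]; apply: dfE; lra.
move: wxy; rewrite in_itv /= => /andP[xw wy].
rewrite -subr_ge0 E mulr_ge0//; last by lra.
by apply: df0; lra.
Qed.

(* Expanding [(v' - l)^2 >= 0] and optimising in [l] replaces Cauchy-Schwarz. *)
Lemma sqr_increment_le v v' U p q : continuous v -> continuous U ->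
  (forall y, 0 < y < 1 -> is_derive y 1 v (v' y)) ->
  (forall y, 0 < y < 1 -> is_derive y 1 U (v' y ^+ 2)) ->
  0 <= p <= 1 -> 0 <= q <= 1 ->
  (v q - v p) ^+ 2 <= (q - p) * (U q - U p).
Proof.
move=> cv cU dv dU.
wlog : p q / p <= q => [hw p01 q01|pq p01 q01].
  case: (leP p q) => pq; first exact: hw.
  have := hw _ _ (ltW pq) q01 p01.
  by rewrite -[(v p - v q) ^+ 2]sqrrN -mulrNN !opprB.
have [->|neq] := eqVneq p q; first by rewrite !subrr expr0n mul0r.
have lt_pq : 0 < q - p by rewrite subr_gt0 lt_neqAle neq.
pose l := (v q - v p) / (q - p).
pose h := fun z => U z - (2 * l) * v z + l ^+ 2 * z.
have ch : continuous h.
  move=> z; apply: cvgD; last by apply: cvgM; [exact: cvg_cst|exact: cvg_id].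
  by apply: cvgB; [exact: cU|apply: cvgM; [exact: cvg_cst|exact: cv]].
have := nondecreasing_is_derive h (fun z => (v' z - l) ^+ 2) 0 1 ch.
move=> /(_ _ _ p q); have -> : h p <= h q =
  ((2 * l) * (v q - v p) - l ^+ 2 * (q - p) <= U q - U p).
  by rewrite /h -subr_ge0 -[RHS]subr_ge0; congr (_ <= _); ring.
move=> H.
have : 2 * l * (v q - v p) - l ^+ 2 * (q - p) <= U q - U p.
  apply: H; [| |lra..].
  - move=> z z01; have := dv z z01; have := dU z z01 => ? ?.
    by apply: is_derive_eq; rewrite /GRing.scale /=; ring.
  - by move=> z _; rewrite sqr_ge0.
have -> : 2 * l * (v q - v p) - l ^+ 2 * (q - p) = (v q - v p) ^+ 2 / (q - p).
  by rewrite /l; field; rewrite gt_eqF.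
by rewrite ler_pdivrMr// mulrC.
Qed.

Lemma Rint_le f g a b : continuous f -> continuous g ->
  (forall x, a <= x <= b -> f x <= g x) ->
  \int[leb1]_(x in `[a, b]) f x <= \int[leb1]_(x in `[a, b]) g x.
Proof.
move=> cf cg fg; apply: le_Rintegral => //.
- by apply: continuous_compact_integrable; [exact: segment_compact|exact: continuous_subspaceT].
- by apply: continuous_compact_integrable; [exact: segment_compact|exact: continuous_subspaceT].
Qed.

Lemma is_derive_comp_shift f (h x d : R) : is_derive (x + h) 1 f d ->
  is_derive x 1 (fun z => f (z + h)) d.
Proof.
move=> df; rewrite -[d]mulr1; apply: (@is_derive1_comp R f (fun z => z + h)) => //.
by apply: is_derive_eq; rewrite addr0.
Qed.

Lemma continuous_comp_shift f (h : R) : continuous f -> continuous (fun x => f (x + h)).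
Proof.
move=> cf x; apply: (@continuous_comp _ _ _ (fun z => z + h) f); last exact: cf.
by apply: cvgD; [exact: cvg_id|exact: cvg_cst].
Qed.

(** For an antiderivative [U], the function [U (z + 1) - U z] has derivative 0, so it takes the same
    value at 0 and at [h]. *)
Lemma Rint_periodic_shift f h : continuous f -> (forall x, f (x + 1) = f x) ->
  \int[leb1]_(x in `[0, 1]) f (x + h) = \int[leb1]_(x in `[0, 1]) f x.
Proof.
move=> cf pf; have [U dU] := antiderivative f cf.
have dUh (x : R) : is_derive x 1 (fun z => U (z + h)) (f (x + h)).
  by apply: is_derive_comp_shift.
rewrite (Rint_antiderivative _ _ _ _ _ _ dU)//.
rewrite (Rint_antiderivative _ _ _ _ _ _ dUh)//; last exact: continuous_comp_shift.
have [|z [_ _]] := MVT_between (fun z => U (z + 1) - U z) (cst 0) 0 h.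
  move=> z; have ? := dU z; have ? := is_derive_comp_shift U 1 z (f (z + 1)) (dU _).
  by apply: is_derive_eq; rewrite pf subrr.
by rewrite mul0r !add0r (addrC h) => E; lra.
Qed.

(** Both [[p, q]] and its translate by [a] lie in [[0, 1]], so only values of [H] there are met. No
    change of variables is made: with [U] and [V] antiderivatives of [H] and of the left integrand,
    [c * U (y + a) - V y] is nondecreasing on [[p, q]], and [V] does not grow outside. *)
Lemma Rint_weighted_shift_le (m H : R -> R) a c p q : continuous m -> continuous H ->
  0 <= p -> p <= q -> q <= 1 -> 0 <= p + a -> q + a <= 1 ->
  (forall y, 0 <= m y <= c) -> (forall y, 0 <= y <= 1 -> ~~ (p <= y <= q) -> m y = 0) ->
  (forall y, 0 <= H y) ->
  \int[leb1]_(y in `[0, 1]) (m y * H (y + a)) <= c * \int[leb1]_(y in `[0, 1]) H y.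
Proof.
move=> cm cH p0 pq q1 pa qa mc mz H0.
have cG : continuous (fun y => m y * H (y + a)).
  by move=> y; apply: cvgM; [exact: cm|exact: continuous_comp_shift].
have [U dU] := antiderivative H cH; have [V dV] := antiderivative _ cG.
rewrite !(Rint_antiderivative _ _ _ _ _ _ dU)// (Rint_antiderivative _ _ _ _ _ _ dV)//.
have cU : continuous U by move=> x; exact: is_derive_continuous (dU x).
have cV : continuous V by move=> x; exact: is_derive_continuous (dV x).
have c0 : 0 <= c by have /andP[? ?] := mc 0; lra.
have Vconst x y : x <= y -> (forall z, x < z < y -> m z = 0) -> V y <= V x.
  move=> xy mxy; rewrite -lerN2.
  apply: (nondecreasing_is_derive (fun z => - V z) (fun z => - (m z * H (z + a))) x y) => //.
  - by move=> z; apply: cvgN; exact: cV.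
  - by move=> z /mxy ->; rewrite mul0r oppr0.
have V1 : V 1 <= V q by apply: Vconst => // z zq; apply: mz; lra.
have V0 : V p <= V 0 by apply: Vconst => // z zq; apply: mz; lra.
have Umono x y : 0 <= x -> x <= y -> U x <= U y.
  by move=> x0 xy; apply: (nondecreasing_is_derive U H x y).
have : c * U (p + a) - V p <= c * U (q + a) - V q.
  apply: (nondecreasing_is_derive (fun y => c * U (y + a) - V y)
    (fun y => c * H (y + a) - m y * H (y + a)) p q) => //.
  - move=> y; apply: cvgB; last exact: cV.
    by apply: cvgM; [exact: cvg_cst|exact: continuous_comp_shift].
  - move=> y _; have ? := dV y; have ? := is_derive_comp_shift U a y (H (y + a)) (dU _).
    by apply: is_derive_eq.
  - by move=> y _; rewrite -mulrBl mulr_ge0// subr_ge0; case/andP: (mc y).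
have : c * U (q + a) <= c * U 1 by rewrite ler_wpM2l// Umono//; lra.
have : c * U 0 <= c * U (p + a) by rewrite ler_wpM2l// Umono//.
lra.
Qed.

(** Pointwise, the squared increment is at most [a * (U (y + a) - U y)], where [U' = v' ^ 2]. A
    second antiderivative [W] of [U] replaces the exchange of two integrals: its increments over
    steps of length [a] equal [a] times values of [U] between [U 0] and [U 1]. This produces the
    factor [a ^ 2] for either sign of [a]. *)
Lemma Rint_increment_le (m v v' : R -> R) a c p q : continuous m -> continuous v -> continuous v' ->
  (forall y, 0 < y < 1 -> is_derive y 1 v (v' y)) ->
  0 <= p -> p <= q -> q <= 1 -> 0 <= p + a -> q + a <= 1 ->
  (forall y, 0 <= m y <= c) -> (forall y, 0 <= y <= 1 -> ~~ (p <= y <= q) -> m y = 0) ->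
  \int[leb1]_(y in `[0, 1]) (m y * (v (y + a) - v y) ^+ 2) <=
  c * a ^+ 2 * \int[leb1]_(y in `[0, 1]) (v' y ^+ 2).
Proof.
move=> cm cv cv' dv p0 pq q1 pa qa mc mz.
have cv2 : continuous (fun y => v' y ^+ 2).
  exact: continuous_sqr.
have cva : continuous (fun y => v (y + a) - v y).
  by move=> y; apply: cvgB; [exact: continuous_comp_shift|exact: cv].
have cG : continuous (fun y => m y * (v (y + a) - v y) ^+ 2).
  move=> y; apply: cvgM; first exact: cm.
  exact: (continuous_sqr _ _ cva).
have [U dU] := antiderivative _ cv2; have [V dV] := antiderivative _ cG.
have cU : continuous U by move=> x; exact: is_derive_continuous (dU x).
have cV : continuous V by move=> x; exact: is_derive_continuous (dV x).
have [W dW] := antiderivative _ cU.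
have cW : continuous W by move=> x; exact: is_derive_continuous (dW x).
rewrite !(Rint_antiderivative _ _ _ _ _ _ dU)// (Rint_antiderivative _ _ _ _ _ _ dV)//.
have c0 : 0 <= c by have /andP[? ?] := mc 0; lra.
have Vconst x y : x <= y -> (forall z, x < z < y -> m z = 0) -> V y <= V x.
  move=> xy mxy; rewrite -lerN2.
  apply: (nondecreasing_is_derive (fun z => - V z) (fun z => - (m z * (v (z + a) - v z) ^+ 2)) x y) => //.
  - by move=> z; apply: cvgN; exact: cV.
  - by move=> z /mxy ->; rewrite mul0r oppr0.
have V1 : V 1 <= V q by apply: Vconst => // z zq; apply: mz; lra.
have V0 : V p <= V 0 by apply: Vconst => // z zq; apply: mz; lra.
have Umono x y : x <= y -> U x <= U y.
  by move=> xy; apply: (nondecreasing_is_derive U _ x y) => // *; exact: sqr_ge0.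
have : c * a * (W (p + a) - W p) - V p <= c * a * (W (q + a) - W q) - V q.
  apply: (nondecreasing_is_derive (fun y => c * a * (W (y + a) - W y) - V y)
    (fun y => c * a * (U (y + a) - U y) - m y * (v (y + a) - v y) ^+ 2) p q) => //.
  - move=> y; apply: cvgB; last exact: cV.
    apply: cvgM; first exact: cvg_cst.
    by apply: cvgB; [exact: continuous_comp_shift|exact: cW].
  - move=> y _; have ? := dV y; have ? := dW y.
    have ? := is_derive_comp_shift W a y (U (y + a)) (dW _).
    by apply: is_derive_eq.
  - move=> y pyq; rewrite subr_ge0 -mulrA.
    have inc : (v (y + a) - v y) ^+ 2 <= a * (U (y + a) - U y).
      have := sqr_increment_le v v' U y (y + a) cv cU dv (fun y _ => dU y).
      by rewrite addrAC subrr add0r; apply; lra.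
    have /andP[m0 m1] := mc y.
    apply: le_trans (_ : c * (v (y + a) - v y) ^+ 2 <= _).
      by rewrite ler_wpM2r// sqr_ge0.
    by rewrite ler_wpM2l.
have [x [x1 x2 Ex]] := MVT_between W U q (q + a) dW.
have [z [z1 z2 Ez]] := MVT_between W U p (p + a) dW.
have hx : U 0 <= U x <= U 1.
  by rewrite !Umono//; move: x1 x2; case: (leP q (q + a)); lra.
have hz : U 0 <= U z <= U 1.
  by rewrite !Umono//; move: z1 z2; case: (leP p (p + a)); lra.
have shiftK r : r + a - r = a by ring.
rewrite Ex Ez !shiftK => key.
apply: le_trans (_ : c * a * (U x * a) - c * a * (U z * a) <= _); first lra.
have -> : c * a * (U x * a) - c * a * (U z * a) = c * a ^+ 2 * (U x - U z) by ring.
apply: ler_wpM2l; first by rewrite mulr_ge0// sqr_ge0.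
by case/andP: hx => ? ?; case/andP: hz => ? ?; lra.
Qed.

Lemma sqr_le_Rint_derive (v v' : R -> R) y : continuous v -> continuous v' ->
  (forall y, 0 < y < 1 -> is_derive y 1 v (v' y)) -> v 0 = 0 -> 0 <= y <= 1 ->
  v y ^+ 2 <= \int[leb1]_(y in `[0, 1]) (v' y ^+ 2).
Proof.
move=> cv cv' dv v0 y01.
have cv2 : continuous (fun y => v' y ^+ 2).
  exact: continuous_sqr.
have [U dU] := antiderivative _ cv2.
have cU : continuous U by move=> x; exact: is_derive_continuous (dU x).
rewrite (Rint_antiderivative _ _ _ _ _ _ dU)//.
have := sqr_increment_le v v' U 0 y cv cU dv (fun y _ => dU y).
rewrite v0 !subr0 => /(_ _ y01) h; apply: (le_trans (h _)); first lra.
have Umono x z : x <= z -> U x <= U z.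
  by move=> xz; apply: (nondecreasing_is_derive U _ x z) => // *; exact: sqr_ge0.
have /andP[y0 y1] := y01.
have := Umono 0 y y0; have := Umono y 1 y1 => h1 h2.
apply: le_trans (_ : U y - U 0 <= _); last by rewrite lerB.
by rewrite -[leRHS]mul1r ler_wpM2r// subr_ge0.
Qed.

End OneDim.

(** * Continuity rules and the tactic [cont] *)

Section Calculus3.
Context {R : realType}.
Local Notation leb1 := (@lebesgue_measure R).
Implicit Types (F G X Z dF dX dZ : R * R * R -> R) (T : R).

Lemma continuousD3 (S : topologicalType) (F G : S -> R) :
  continuous F -> continuous G -> continuous (fun z => F z + G z).
Proof. by move=> cF cG z; apply: cvgD; [exact: cF|exact: cG]. Qed.

Lemma continuousB3 (S : topologicalType) (F G : S -> R) :
  continuous F -> continuous G -> continuous (fun z => F z - G z).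
Proof. by move=> cF cG z; apply: cvgB; [exact: cF|exact: cG]. Qed.

Lemma continuousM3 (S : topologicalType) (F G : S -> R) :
  continuous F -> continuous G -> continuous (fun z => F z * G z).
Proof. by move=> cF cG z; apply: cvgM; [exact: cF|exact: cG]. Qed.

Lemma continuousN3 (S : topologicalType) (F : S -> R) :
  continuous F -> continuous (fun z => - F z).
Proof. by move=> cF z; apply: cvgN; exact: cF. Qed.

Lemma continuous_cst3 (S : topologicalType) (c : R) : continuous (fun _ : S => c).
Proof. by move=> z; exact: cvg_cst. Qed.

Lemma continuous_id1 : continuous (fun x : R => x).
Proof. by move=> x; exact: cvg_id. Qed.

Lemma continuous_comp1 (S : topologicalType) (k : R -> R) (F : S -> R) :
  continuous k -> continuous F -> continuous (fun z => k (F z)).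
Proof. by move=> ck cF z; apply: (@continuous_comp _ _ _ F k); [exact: cF|exact: ck]. Qed.

Lemma continuous_x : continuous (fun z : R * R * R => z.1.1).
Proof.
by move=> z; apply: (@continuous_comp _ _ _ fst fst); [exact: cvg_fst|exact: cvg_fst].
Qed.

Lemma continuous_y : continuous (fun z : R * R * R => z.1.2).
Proof.
by move=> z; apply: (@continuous_comp _ _ _ fst snd); [exact: cvg_fst|exact: cvg_snd].
Qed.

Lemma continuous_t : continuous (fun z : R * R * R => z.2).
Proof. by move=> z; exact: cvg_snd. Qed.

Lemma continuous_comp3 (S : topologicalType) F (f g h : S -> R) : continuous F ->
  continuous f -> continuous g -> continuous h ->
  continuous (fun z => F (f z, g z, h z)).
Proof.
move=> cF cf cg ch z; apply: (@continuous_comp _ _ _ (fun z => (f z, g z, h z)) F).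
  apply: (@continuous_pair S (R * R)%type R (fun z => (f z, g z)) h) => //.
  exact: (@continuous_pair S R R f g).
exact: cF.
Qed.

End Calculus3.

(** The rules are selected by second-order patterns on the body of the function. The rule for
    [F (u, v, w)] precedes unary composition because such a body matches both; a goal to which no
    rule applies is left to the caller. *)
Ltac cont :=
  cbv beta;
  try match goal with
  | H : forall x, @continuous_at _ _ x ?f |- forall x, @continuous_at _ _ x ?f => exact H
  | |- forall x, @continuous_at _ _ x (fun z => z.1.1) => exact continuous_x
  | |- forall x, @continuous_at _ _ x (fun z => z.1.2) => exact continuous_y
  | |- forall x, @continuous_at _ _ x (fun z => z.2) => exact continuous_t
  | |- forall x, @continuous_at _ _ x (fun z => z) => exact continuous_id1
  | |- forall x, @continuous_at _ _ x (fun z => ?c) => exact (continuous_cst3 _ c)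
  | |- forall x, @continuous_at _ _ x (fun z => @GRing.add _ (@?u z) (@?v z)) =>
      refine (continuousD3 _ u v _ _); cont
  | |- forall x, @continuous_at _ _ x (fun z => @GRing.opp _ (@?u z)) =>
      refine (continuousN3 _ u _); cont
  | |- forall x, @continuous_at _ _ x (fun z => @GRing.mul _ (@?u z) (@?v z)) =>
      refine (continuousM3 _ u v _ _); cont
  | |- forall x, @continuous_at _ _ x (fun z => @GRing.exp _ (@?u z) 2%N) =>
      refine (continuous_sqr _ u _); cont
  | |- forall x, @continuous_at _ _ x (fun z => ?F (@?u z, @?v z, @?w z)) =>
      refine (continuous_comp3 _ F u v w _ _ _ _); cont
  | |- forall x, @continuous_at _ _ x (fun z => ?k (@?u z)) =>
      refine (continuous_comp1 _ k u _ _); cont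
  | H : forall x, @continuous_at _ _ x ?f |- _ => exact H
  end.

(** * Integral inequalities on the cylinder obtained slice by slice *)

Section Calculus3bis.
Context {R : realType}.
Local Notation leb1 := (@lebesgue_measure R).
Implicit Types (F G X Z dF dX dZ : R * R * R -> R) (T : R).

Lemma Rint_ge0B (f g : R -> R) (a b : R) : continuous f -> continuous g ->
  \int[leb1]_(x in `[a, b]) f x <= \int[leb1]_(x in `[a, b]) g x ->
  0 <= \int[leb1]_(x in `[a, b]) (g x - f x).
Proof.
move=> cf cg fg; rewrite RintegralB ?subr_ge0//.
  by apply: continuous_compact_integrable; [exact: segment_compact|exact: continuous_subspaceT].
by apply: continuous_compact_integrable; [exact: segment_compact|exact: continuous_subspaceT].
Qed.

Lemma I3_le_x F G T : continuous F -> continuous G ->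
  (forall y t, 0 < y < 1 -> 0 < t < T ->
    \int[leb1]_(x in `[0, 1]) F (x, y, t) <= \int[leb1]_(x in `[0, 1]) G (x, y, t)) ->
  I3 T F <= I3 T G.
Proof.
move=> cF cG h; rewrite -subr_ge0 -I3B//; apply: I3_ge0_x; first by cont.
move=> y t y01 tT; rewrite Rint_co; last by apply: continuousB3; exact: slice_continuous1.
by apply: Rint_ge0B; [exact: slice_continuous1..|exact: h].
Qed.

Lemma I3_le_y F G T : continuous F -> continuous G ->
  (forall x t, 0 < t < T ->
    \int[leb1]_(y in `[0, 1]) F (x, y, t) <= \int[leb1]_(y in `[0, 1]) G (x, y, t)) ->
  I3 T F <= I3 T G.
Proof.
move=> cF cG h; rewrite -subr_ge0 -I3B//; apply: I3_ge0_y; first by cont.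
move=> x t x01 tT; rewrite Rint_oo; last by apply: continuousB3; exact: slice_continuous2.
by apply: Rint_ge0B; [exact: slice_continuous2..|exact: h].
Qed.

Lemma I3_eq_x F G T : continuous F -> continuous G ->
  (forall y t, 0 < y < 1 -> 0 < t < T ->
    \int[leb1]_(x in `[0, 1]) F (x, y, t) = \int[leb1]_(x in `[0, 1]) G (x, y, t)) ->
  I3 T F = I3 T G.
Proof.
by move=> cF cG h; apply/eqP; rewrite eq_le !I3_le_x// => y t y01 tT; rewrite h.
Qed.

Lemma I3_shift_x F T h : continuous F ->
  (forall x y t : R, 0 < y < 1 -> 0 < t < T -> F (x + 1, y, t) = F (x, y, t)) ->
  I3 T (fun z => F (z.1.1 + h, z.1.2, z.2)) = I3 T F.
Proof.
move=> cF pF; apply: I3_eq_x => //; first by cont.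
move=> y t y01 tT /=; apply: (Rint_periodic_shift (fun x => F (x, y, t)) h).
  exact: slice_continuous1.
by move=> x; exact: pF.
Qed.

Lemma I3_dx F dF T : continuous F -> continuous dF ->
  (forall x y t : R, 0 < y < 1 -> 0 < t < T -> F (x + 1, y, t) = F (x, y, t)) ->
  (forall x y t : R, 0 < y < 1 -> 0 < t < T ->
    is_derive x 1 (fun x => F (x, y, t)) (dF (x, y, t))) ->
  I3 T dF = 0.
Proof.
move=> cF cdF pF dFE; transitivity (I3 T (fun _ => 0)); last first.
  by rewrite /I3 Rintegral_cst ?mul0r//; exact: measurable_OmegaT.
apply: I3_eq_x => //; first by cont.
move=> y t y01 tT.
have -> := RintFTC (fun x => dF (x, y, t)) (fun x => F (x, y, t)) 0 1 ltr01
  (slice_continuous1 _ y t cdF) (slice_continuous1 _ y t cF)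
  (fun x _ => dFE x y t y01 tT).
by rewrite -{1}[1]add0r pF// subrr Rintegral_cst// mul0r.
Qed.

Lemma I3_weighted_shift_le (m : R -> R) (H : R * R * R -> R) T (a c p q : R) : continuous m -> continuous H ->
  0 <= p -> p <= q -> q <= 1 -> 0 <= p + a -> q + a <= 1 ->
  (forall y, 0 <= m y <= c) -> (forall y, 0 <= y <= 1 -> ~~ (p <= y <= q) -> m y = 0) ->
  (forall z, 0 <= H z) ->
  I3 T (fun z => m z.1.2 * H (z.1.1, z.1.2 + a, z.2)) <= c * I3 T H.
Proof.
move=> cm cH p0 pq q1 pa qa mc mz H0; rewrite -I3Z//.
apply: I3_le_y; [by cont..|move=> x t tT /=].
rewrite RintegralZl//; last first.
  apply: continuous_compact_integrable; first exact: segment_compact.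
  by apply: continuous_subspaceT; exact: slice_continuous2.
apply: (Rint_weighted_shift_le m (fun y => H (x, y, t)) a c p q) => //.
exact: slice_continuous2.
Qed.

(** The conditions [a <= p] and [q <= 1 + a] say that the translated support [[p - a, q - a]] still
    lies in [[0, 1]]; an antiderivative is constant off the support. *)
Lemma Rint_compact_shift (f : R -> R) (a p q : R) : continuous f ->
  0 <= p -> p <= q -> q <= 1 -> a <= p -> q <= 1 + a ->
  (forall y, ~~ (p <= y <= q) -> f y = 0) ->
  \int[leb1]_(y in `[0, 1]) f (y + a) = \int[leb1]_(y in `[0, 1]) f y.
Proof.
move=> cf p0 pq q1 ap qa fz; have [U dU] := antiderivative f cf.
have dUa (x : R) : is_derive x (1 : R) (fun z => U (z + a)) (f (x + a)).
  by apply: is_derive_comp_shift.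
rewrite (Rint_antiderivative _ _ _ _ _ _ dU)// (Rint_antiderivative _ _ _ _ _ _ dUa)//;
  last exact: continuous_comp_shift.
have cU : continuous U by move=> x; exact: is_derive_continuous (dU x).
have Uc x y : x <= y -> (forall z, x < z < y -> f z = 0) -> U x = U y.
  rewrite le_eqVlt => /predU1P[->//|xy] fxy.
  have [z zxy] := @MVT R U f x y xy (fun x _ => dU x) (continuous_subspaceT cU).
  by rewrite fxy ?mul0r; [lra|move: zxy; rewrite in_itv].
have -> : U (1 + a) = U 1.
  by rewrite -(Uc q (1 + a))// -?(Uc q 1)// => z zq; apply: fz; lra.
have -> // : U (0 + a) = U 0.
  by rewrite add0r (Uc a p)// ?(Uc 0 p)// => z zq; apply: fz; lra.
Qed.

Lemma I3_shift_y F T (a p q : R) : continuous F ->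
  0 <= p -> p <= q -> q <= 1 -> a <= p -> q <= 1 + a ->
  (forall x y t : R, ~~ (p <= y <= q) -> F (x, y, t) = 0) ->
  I3 T (fun z => F (z.1.1, z.1.2 + a, z.2)) = I3 T F.
Proof.
move=> cF p0 pq q1 ap qa Fz; have cFa : continuous (fun z => F (z.1.1, z.1.2 + a, z.2)) by cont.
have E x t : \int[leb1]_(y in `[0, 1]) F (x, y + a, t) = \int[leb1]_(y in `[0, 1]) F (x, y, t).
  apply: (Rint_compact_shift (fun y => F (x, y, t)) a p q) => //; first exact: slice_continuous2.
  by move=> y; exact: Fz.
by apply/eqP; rewrite eq_le !I3_le_y// => x t tT; rewrite /= E.
Qed.

Lemma I3_increment_le (m : R -> R) F dF T (a c p q : R) :
  continuous m -> continuous F -> continuous dF ->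
  (forall x y t : R, 0 < y < 1 -> 0 < t < T ->
    is_derive y 1 (fun y => F (x, y, t)) (dF (x, y, t))) ->
  0 <= p -> p <= q -> q <= 1 -> 0 <= p + a -> q + a <= 1 ->
  (forall y, 0 <= m y <= c) -> (forall y, 0 <= y <= 1 -> ~~ (p <= y <= q) -> m y = 0) ->
  I3 T (fun z => m z.1.2 * (F (z.1.1, z.1.2 + a, z.2) - F (z.1.1, z.1.2, z.2)) ^+ 2) <=
  c * a ^+ 2 * I3 T (fun z => dF z ^+ 2).
Proof.
move=> cm cF cdF dFE p0 pq q1 pa qa mc mz.
have cdF2 : continuous (fun z => dF z ^+ 2) by cont.
rewrite -I3Z//; apply: I3_le_y; [by cont..|move=> x t tT /=].
rewrite RintegralZl//; last first.
  apply: continuous_compact_integrable; first exact: segment_compact.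
  by apply: continuous_subspaceT; exact: (slice_continuous2 _ x t cdF2).
apply: (Rint_increment_le m (fun y => F (x, y, t)) (fun y => dF (x, y, t)) a c p q) => //.
- exact: slice_continuous2.
- exact: slice_continuous2.
- by move=> y y01; exact: dFE.
Qed.

Lemma I3_poincare F dF T : continuous F -> continuous dF ->
  (forall x y t : R, 0 < y < 1 -> 0 < t < T ->
    is_derive y 1 (fun y => F (x, y, t)) (dF (x, y, t))) ->
  (forall x t, F (x, 0, t) = 0) ->
  I3 T (fun z => F z ^+ 2) <= I3 T (fun z => dF z ^+ 2).
Proof.
move=> cF cdF dFE F0.
have cdF2 : continuous (fun z => dF z ^+ 2) by cont.
apply: I3_le_y; [by cont..|move=> x t tT /=].
set d := \int[leb1]_(y in _) (dF _ ^+ 2).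
apply: (@le_trans _ _ (\int[leb1]_(y in `[0, 1]) d)).
  apply: Rint_le; [apply: continuous_sqr; exact: slice_continuous2|by cont|move=> y y01].
  apply: (sqr_le_Rint_derive (fun y => F (x, y, t)) (fun y => dF (x, y, t))) => //.
  - exact: slice_continuous2.
  - exact: slice_continuous2.
  - by move=> z z01; exact: dFE.
rewrite Rintegral_cst//= lebesgue_measure_itv/= lte_fin ltr01 /= ?subr0 ?oppr0 ?addr0 mulr1.
exact: lexx.
Qed.

Lemma I3_le_dt X dX Z dZ T : 0 < T -> continuous X -> continuous dX ->
  continuous Z -> continuous dZ ->
  (forall x y t : R, 0 < y < 1 -> 0 < t < T ->
    is_derive t 1 (fun t => X (x, y, t)) (dX (x, y, t))) ->
  (forall x y t : R, 0 < y < 1 -> 0 < t < T ->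
    is_derive t 1 (fun t => Z (x, y, t)) (dZ (x, y, t))) ->
  (forall x y, 0 < y < 1 -> X (x, y, T) - X (x, y, 0) <= Z (x, y, T) - Z (x, y, 0)) ->
  I3 T dX <= I3 T dZ.
Proof.
move=> T0 cX cdX cZ cdZ dXE dZE XZ; rewrite -subr_ge0 -I3B//.
apply: I3_ge0_t; first by cont.
move=> x y x01 y01; rewrite Rint_oo; last by apply: continuousB3; exact: slice_continuous3.
apply: Rint_ge0B; [exact: slice_continuous3..|].
have -> := RintFTC (fun t => dX (x, y, t)) (fun t => X (x, y, t)) 0 T T0
  (slice_continuous3 _ x y cdX) (slice_continuous3 _ x y cX)
  (fun t tT => dXE x y t y01 tT).
have -> := RintFTC (fun t => dZ (x, y, t)) (fun t => Z (x, y, t)) 0 T T0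
  (slice_continuous3 _ x y cdZ) (slice_continuous3 _ x y cZ)
  (fun t tT => dZE x y t y01 tT).
exact: XZ.
Qed.

End Calculus3bis.

(** * Smoothness of real functions on open sets *)

Section Smooth.
Context {R : realType}.
Implicit Types (u v f g : R -> R) (O V : set R) (n k m : nat).

(** Relative to a set because the weights are proved smooth on two overlapping open sets, one where
    a formula holds and one where the function vanishes, and are then glued by [nderivableU]. *)
Fixpoint nderivable n O u : Prop :=
  if n is m.+1 then (forall y, O y -> derivable u y 1) /\ nderivable m O (derive1 u)
  else True.

Definition smooth O u := forall n, nderivable n O u.

Lemma nderivable_subset n O V u : O `<=` V -> nderivable n V u -> nderivable n O u.
Proof.
move=> OV; elim: n u => //= n IH u [du du']; split; last exact: IH.
by move=> y /OV; exact: du.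
Qed.

Lemma nderivableU n O V u : nderivable n O u -> nderivable n V u ->
  nderivable n (O `|` V) u.
Proof.
elim: n u => //= n IH u [d1 d1'] [d2 d2']; split; last exact: IH.
by move=> y [/d1|/d2].
Qed.

Lemma eq_derive1_open O u v : open O -> (forall y, O y -> u y = v y) ->
  forall y, O y -> (derive1 u) y = (derive1 v) y.
Proof.
move=> oO uv y Oy; rewrite !derive1E; apply: near_eq_derive.
by apply: filterS (open_nbhs_nbhs (conj oO Oy)) => z; exact: uv.
Qed.

Lemma eq_nderivable n O u v : open O -> (forall y, O y -> u y = v y) ->
  nderivable n O u -> nderivable n O v.
Proof.
move=> oO; elim: n u v => //= n IH u v uv [du du']; split.
  move=> y Oy; apply: (@near_eq_derivable _ _ _ u); last exact: du.
  by apply: filterS (open_nbhs_nbhs (conj oO Oy)) => z; exact: uv.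
by apply: IH du'; exact: eq_derive1_open.
Qed.

Lemma nderivableW n O u : nderivable n.+1 O u -> nderivable n O u.
Proof. by elim: n u => // n IH u [du /IH du']; split. Qed.

Lemma nderivable_chain n O (G : nat -> R -> R) k : open O ->
  (forall k y, O y -> is_derive y 1 (G k) (G k.+1 y)) -> nderivable n O (G k).
Proof.
move=> oO dG; elim: n k => //= n IH k; split; first by move=> y /(dG k)[].
apply: eq_nderivable (IH k.+1) => // y Oy.
by rewrite derive1E (@derive_val _ _ _ _ _ _ _ (dG k y Oy)).
Qed.

Lemma nderivableS n O u u' : open O -> (forall y, O y -> is_derive y 1 u (u' y)) ->
  nderivable n O u' -> nderivable n.+1 O u.
Proof.
move=> oO du du'; split; first by move=> y /du[].
apply: eq_nderivable du' => // y Oy.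
by rewrite derive1E (@derive_val _ _ _ _ _ _ _ (du y Oy)).
Qed.

Lemma nderivable_is_derive n O u y : nderivable n.+1 O u -> O y ->
  is_derive y 1 u ((derive1 u) y).
Proof. by move=> [du _] /du dy; rewrite derive1E; exact: DeriveDef. Qed.

Lemma nderivable_cst n O c : open O -> nderivable n O (fun=> c).
Proof.
move=> oO; apply: (nderivable_chain n O (fun k => if k is 0 then fun=> c else fun=> 0) 0) => //.
by case=> [|k] y Oy; exact: is_derive_cst.
Qed.

Lemma nderivable_id n O : open O -> nderivable n O (fun x => x).
Proof.
move=> oO; case: n => // n; apply: (nderivableS _ _ _ (fun=> 1)) => //.
exact: nderivable_cst.
Qed.

Lemma nderivableD n O u v : open O -> nderivable n O u -> nderivable n O v ->
  nderivable n O (fun x => u x + v x).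
Proof.
move=> oO; elim: n u v => // n IH u v hu hv.
apply: (nderivableS _ _ _ (fun x => (derive1 u) x + (derive1 v) x)) => //.
  move=> y Oy; exact: is_deriveD (nderivable_is_derive _ _ _ _ hu Oy) (nderivable_is_derive _ _ _ _ hv Oy).
by apply: IH; [case: hu|case: hv].
Qed.

Lemma nderivableM n O u v : open O -> nderivable n O u -> nderivable n O v ->
  nderivable n O (fun x => u x * v x).
Proof.
move=> oO; elim: n u v => // n IH u v hu hv.
apply: (nderivableS _ _ _ (fun x => u x * (derive1 v) x + v x * (derive1 u) x)) => //.
  move=> y Oy; exact: is_deriveM (nderivable_is_derive _ _ _ _ hu Oy) (nderivable_is_derive _ _ _ _ hv Oy).
by apply: nderivableD => //; apply: IH; [exact: nderivableW|by case: hv|exact: nderivableW|by case: hu].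
Qed.

Lemma nderivable_comp n O V f g : open O -> (forall y, O y -> V (g y)) ->
  nderivable n V f -> nderivable n O g -> nderivable n O (fun x => f (g x)).
Proof.
move=> oO gOV; elim: n f => // n IH f hf hg.
apply: (nderivableS n O _ (fun x => (derive1 f) (g x) * (derive1 g) x) oO).
  move=> y Oy; apply: (@is_derive1_comp R f g).
  - exact: nderivable_is_derive hf (gOV _ Oy).
  - exact: nderivable_is_derive hg Oy.
apply: nderivableM => //; last by case: hg.
by apply: IH; [case: hf|exact: nderivableW].
Qed.

Lemma nderivable_inv n : nderivable n [set x : R | x != 0] (fun x => x^-1).
Proof.
elim: n => // n IH; apply: (nderivableS _ _ _ (fun x => -1 * (x^-1 * x^-1))).
- exact: open_neq.
- move=> y /= y0; have := is_deriveV y0 (is_derive_id y 1).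
  by rewrite /GRing.scale /= mulr1 mulN1r expr2 invfM.
apply: nderivableM; [exact: open_neq|apply: nderivable_cst; exact: open_neq|].
by apply: nderivableM => //; exact: open_neq.
Qed.

Lemma smoothM O u v : open O -> smooth O u -> smooth O v -> smooth O (fun x => u x * v x).
Proof. by move=> oO su sv n; exact: nderivableM. Qed.

Lemma smoothV O u : open O -> smooth O u -> (forall y, O y -> u y != 0) ->
  smooth O (fun x => (u x)^-1).
Proof.
move=> oO su u0 n.
exact: (nderivable_comp n O _ (fun x => x^-1) u oO u0 (nderivable_inv n)).
Qed.

Lemma smooth_affine O (a b : R) : open O -> smooth O (fun x => a * x + b).
Proof.
move=> oO n; apply: nderivableD => //; last exact: nderivable_cst.
by apply: nderivableM => //; [exact: nderivable_cst|exact: nderivable_id].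
Qed.

Lemma smooth_is_derive u (y : R) : smooth setT u -> is_derive y 1 u ((derive1 u) y).
Proof. by move=> su; exact: nderivable_is_derive (su 1%N) I. Qed.

Lemma smooth_continuous u : smooth setT u -> continuous u.
Proof. by move=> su y; exact: is_derive_continuous (smooth_is_derive u y su). Qed.

Lemma smooth_derive1 u : smooth setT u -> smooth setT (derive1 u).
Proof. by move=> su n; case: (su n.+1). Qed.

Lemma smooth_test_function u p q : smooth setT u -> 0 < p -> q < 1 ->
  (forall y, ~~ (p <= y <= q) -> u y = 0) -> test_function u.
Proof.
move=> su p0 q1 uz; split.
  move=> k y; elim: k u su {uz} => [|k IH] u su.
    by rewrite /=; have [] := smooth_is_derive u y su.
  rewrite (_ : derive1n k.+1 u = derive1n k (derive1 u)); last first.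
    by rewrite /derive1n iterSr.
  by apply: IH; exact: smooth_derive1.
by exists p, q; split => // y; apply: contra_neqT; exact: uz.
Qed.

End Smooth.

(** * A smooth step function built from [exp (-1/r)] *)

Section SmoothStep.
Context {R : realType}.
Implicit Types (r x y : R) (k m n : nat).

Lemma is_derive0_quadratic (u : R -> R) (C : R) : (forall r, `|u r| <= C * r ^+ 2) ->
  is_derive (0 : R) 1 u 0.
Proof.
move=> uC; have u0 : u 0 = 0.
  by apply/eqP; rewrite -normr_le0; have := uC 0; rewrite expr0n mulr0.
have C0 : 0 <= C by have := uC 1; rewrite expr1n mulr1; exact: le_trans.
have key : (fun h => h^-1 *: (u (h *: 1 + 0) - u 0)) @ 0^' --> (0 : R).
  apply/cvgr0Pnorm_lt => e e0; near=> h.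
  rewrite u0 subr0 addr0 /GRing.scale /= mulr1 normrM normfV.
  have h0 : h != 0 by near: h; exact: nbhs_dnbhs_neq.
  rewrite ltr_pdivrMl ?normr_gt0//.
  apply: (le_lt_trans (uC h)).
  have : `|h| * (C + 1) < e.
    rewrite -ltr_pdivlMr; last by lra.
    near: h; apply: dnbhs0_lt; apply: divr_gt0 => //; lra.
  rewrite -real_normK ?num_real// expr2 mulrCA ltr_pM2l ?normr_gt0//.
  by apply: le_lt_trans; rewrite mulrC ler_wpM2l//; lra.
apply: DeriveDef; first by apply/cvg_ex; exists 0.
exact: cvg_lim key.
Unshelve. all: by end_near. Qed.

(** The powers of [1/r] make the family stable under differentiation up to linear combinations, so
    that smoothness of [exp (-1/r)] extended by 0 is a plain induction. *)
Definition flat k r : R := if 0 < r then r^-1 ^+ k * expR (- r^-1) else 0.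

Lemma expR_ge_pow x m : 0 <= x -> (x / m.+1%:R) ^+ m.+1 <= expR x.
Proof.
move=> x0; have -> : expR x = expR (x / m.+1%:R) ^+ m.+1.
  by rewrite -expRM_natl mulrC divfK// pnatr_eq0.
apply: lerXn2r; rewrite ?nnegrE ?expR_ge0 ?divr_ge0//.
by apply: le_trans (expR_ge1Dx _); rewrite lerDr.
Qed.

(** From [exp x >= (x / (k + 2)) ^ (k + 2)] at [x = 1/r]. The exponent exceeds [k] by 2, since a
    quadratic bound is what gives derivative 0 at the origin. *)
Lemma flat_bound k r : `|flat k r| <= k.+2%:R ^+ k.+2 * r ^+ 2.
Proof.
rewrite /flat; case: ltP => r0; last by rewrite normr0 mulr_ge0 ?sqr_ge0 ?exprn_ge0.
have rV : 0 < r^-1 by rewrite invr_gt0.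
rewrite ger0_norm; last by rewrite mulr_ge0 ?expR_ge0// exprn_ge0// ltW.
rewrite expRN ler_pdivrMr ?expR_gt0//.
have := expR_ge_pow r^-1 k.+1 (ltW rV).
rewrite expr_div_n ler_pdivrMr ?exprn_gt0// => h.
apply: (@le_trans _ _ (r ^+ 2 * (r^-1 ^+ k.+2))).
  rewrite [r^-1 ^+ k.+2]exprS [r^-1 ^+ k.+1]exprS !mulrA expr2.
  by rewrite mulfK ?gt_eqF// divff ?gt_eqF// mul1r.
rewrite (_ : k.+2%:R ^+ k.+2 * r ^+ 2 * expR r^-1 = r ^+ 2 * (expR r^-1 * k.+2%:R ^+ k.+2)).
  by rewrite ler_wpM2l ?sqr_ge0.
by ring.
Qed.

Lemma is_derive_flat k r :
  is_derive r 1 (flat k) (- k%:R * flat k.+1 r + flat k.+2 r).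
Proof.
have [r0|r0|->] := ltgtP r 0.
- apply: (@near_eq_is_derive _ _ _ (cst 0)).
    near=> z; rewrite /flat ifF//; apply/negbTE; rewrite -leNgt.
    by apply: ltW; near: z; exact: lt_nbhsl.
  rewrite /flat !ifF; last 2 first.
  + by apply/negbTE; rewrite -leNgt ltW.
  + by apply/negbTE; rewrite -leNgt ltW.
  by rewrite mulr0 addr0; exact: is_derive_cst.
- apply: (@near_eq_is_derive _ _ _ (fun z : R => z^-1 ^+ k * expR (- z^-1))).
    by near=> z; rewrite /flat ifT//; near: z; exact: lt_nbhsr.
  have rn0 : r != 0 by rewrite gt_eqF.
  have dV : is_derive r 1 (fun z : R => z^-1) (- r^-1 ^+ 2).
    by have := is_deriveV rn0 (is_derive_id r 1); rewrite /GRing.scale /= mulr1 exprVn.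
  have dE : is_derive r 1 (fun z : R => expR (- z^-1)) (expR (- r^-1) * r^-1 ^+ 2).
    apply: (@is_derive1_comp R expR (fun z => - z^-1)).
    by have := is_deriveN dV; rewrite opprK.
  have dX : is_derive r 1 (fun z : R => z^-1 ^+ k) (- k%:R * r^-1 ^+ k.+1).
    case: k => [|k].
      rewrite (_ : (fun z => _) = cst 1) ?oppr0 ?mul0r; first exact: is_derive_cst.
      by apply/funext => z; rewrite expr0.
    have := @is_deriveX _ _ (fun z : R => z^-1) k.+1 r 1 _ dV.
    rewrite /GRing.scale /= exprfctE => h.
    apply: (@is_derive_eq _ _ _ _ _ _ _ _ h).
    by rewrite !exprS; ring.
  have := is_deriveM dX dE; rewrite /GRing.scale /= => h.
  apply: (@is_derive_eq _ _ _ _ _ _ _ _ h).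
  rewrite /flat r0 !exprS; ring.
- apply: (@is_derive_eq _ _ _ _ _ _ _ 0); last by rewrite /flat ltxx mulr0 addr0.
  exact: is_derive0_quadratic (flat_bound k).
Unshelve. all: by end_near. Qed.

Lemma smooth_flat k : smooth setT (flat k).
Proof.
move=> n; elim: n k => // n IH k.
apply: (nderivableS _ _ _ (fun r => - k%:R * flat k.+1 r + flat k.+2 r)).
- exact: openT.
- by move=> y _; exact: is_derive_flat.
apply: nderivableD => //; first exact: openT.
by apply: nderivableM => //; [exact: openT|apply: nderivable_cst; exact: openT].
Qed.

Lemma flat_ge0 k r : 0 <= flat k r.
Proof.
by rewrite /flat; case: ltP => // r0; rewrite mulr_ge0 ?expR_ge0// exprn_ge0// invr_ge0 ltW.
Qed.

Lemma flat_gt0 r : 0 < r -> 0 < flat 0 r.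
Proof. by move=> r0; rewrite /flat r0 expr0 mul1r expR_gt0. Qed.

Lemma flat_eq0 k r : r <= 0 -> flat k r = 0.
Proof. by move=> r0; rewrite /flat ltNge r0. Qed.

(** The transition takes place on [[1, 2]] rather than at 0, so that [step] of a square vanishes in
    a neighbourhood of the centre: the distance to a point can be cut off smoothly without absolute
    values. *)
Definition step r : R := flat 0 (r - 1) / (flat 0 (r - 1) + flat 0 (2 - r)).

Lemma step_den_gt0 r : 0 < flat 0 (r - 1) + flat 0 (2 - r).
Proof.
case: (ltP 1 r) => r1.
  by apply: ltr_wpDr; [exact: flat_ge0|apply: flat_gt0; lra].
by apply: ltr_wpDl; [exact: flat_ge0|apply: flat_gt0; lra].
Qed.

Lemma smooth_step : smooth setT step.
Proof.
have oT := @openT R.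
have aff (a b : R) : smooth setT (fun r => flat 0 (a * r + b)).
  move=> n; apply: (nderivable_comp n setT setT (flat 0) (fun r => a * r + b)) => //.
    exact: smooth_flat.
  exact: smooth_affine.
have e1 : (fun r => flat 0 (r - 1)) = (fun r => flat 0 (1 * r + -1)).
  by apply/funext => r; rewrite mul1r.
have e2 : (fun r => flat 0 (2 - r)) = (fun r => flat 0 (-1 * r + 2)).
  by apply/funext => r; rewrite mulN1r addrC.
have s1 : smooth setT (fun r => flat 0 (r - 1)) by rewrite e1.
have s2 : smooth setT (fun r => flat 0 (2 - r)) by rewrite e2.
apply: smoothM => //; apply: smoothV => //.
  by move=> n; exact: nderivableD.
by move=> y _; rewrite gt_eqF// step_den_gt0.
Qed.

Lemma step_itv r : 0 <= step r <= 1.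
Proof.
apply/andP; split; first by apply: divr_ge0; [exact: flat_ge0|exact/ltW/step_den_gt0].
by rewrite /step ler_pdivrMr ?step_den_gt0// mul1r lerDl flat_ge0.
Qed.

Lemma step_eq0 r : r <= 1 -> step r = 0.
Proof. by move=> r1; rewrite /step flat_eq0 ?mul0r//; lra. Qed.

Lemma step_eq1 r : 2 <= r -> step r = 1.
Proof.
move=> r2; rewrite /step [flat 0 (2 - r)]flat_eq0; last lra.
by rewrite addr0 divff// gt_eqF// flat_gt0//; lra.
Qed.

Lemma derive1_locally_cst (u : R -> R) (c r : R) :
  (\forall z \near r, u z = c) -> derive1 u r = 0.
Proof.
move=> h; rewrite derive1E (@near_eq_derive _ _ _ u (cst c))//.
exact: derive_cst.
Qed.

(** The bound on [r * derive1 step r] serves the cut-offs [step (((y - c) / e) ^ 2)], whose chain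
    rule brings the unbounded factor [(y - c) / e]. The derivative vanishes off [[0, 3]], whence the
    factor 3 in the witness. *)
Lemma step_derive_bound : exists2 C : R, 0 < C &
  forall r, `|derive1 step r| <= C /\ `|r * derive1 step r| <= C.
Proof.
have cd : continuous (derive1 step) by apply: smooth_continuous; apply: smooth_derive1; exact: smooth_step.
have /compact_bounded[M [Mr hM]] : compact (derive1 step @` `[0, 3]).
  apply: continuous_compact; last exact: segment_compact.
  exact: continuous_subspaceT.
exists (3 * (`|M| + 1)); first by have := normr_ge0 M; lra.
move=> r; have M1 : M < `|M| + 1 by have := ler_norm M; lra.
have M0 := normr_ge0 M.
have [r03|r03] := boolP (0 <= r <= 3).
  have h : `|derive1 step r| <= `|M| + 1.
    by apply: (hM _ M1); exists r => //=; rewrite in_itv.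
  split; first by apply: (le_trans h); lra.
  rewrite normrM ler_pM//; rewrite ler_norml; lra.
rewrite (_ : derive1 step r = 0) ?mulr0 ?normr0; first by split; lra.
case: (ltP r 0) => r0.
  apply: (@derive1_locally_cst _ 0); near=> z; apply: step_eq0; apply: ltW.
  by near: z; apply: lt_nbhsl; lra.
apply: (@derive1_locally_cst _ 1); near=> z; apply: step_eq1; apply: ltW.
by near: z; apply: lt_nbhsr; lra.
Unshelve. all: by end_near. Qed.

End SmoothStep.

(** * Functions on the cylinder, their extension, translates and differences *)

Section Cylinder.
Context {R : realType}.
Implicit Types (T x y t h c : R) (F G : R * R * R -> R)
  (W V : nat -> nat -> nat -> R * R * R -> R) (i j k : nat).

(* For [0 <= c], the retraction of [R] onto [[0, c]]. *)
Definition clamp c r : R := (`|r| - `|r - c| + c) / 2.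

Lemma clamp_id c r : 0 <= r <= c -> clamp c r = r.
Proof.
by move=> /andP[r0 rc]; rewrite /clamp ger0_norm// ler0_norm; [field|lra].
Qed.

Lemma clamp_itv c r : 0 <= c -> 0 <= clamp c r <= c.
Proof.
rewrite /clamp => c0; case: (ger0P r) => r0; case: (ger0P (r - c)) => rc; lra.
Qed.

Lemma continuous_clamp c : continuous (clamp c).
Proof.
have cn : continuous (fun r : R => `|r|) by move=> r; exact: norm_continuous.
rewrite /clamp; cont.
Qed.

(** Composition with this retraction makes all partial derivatives of [f] continuous on the whole
    space, so that continuity never has to be tracked on a subset. *)
Definition clampCyl T (z : R * R * R) : R * R * R := (z.1.1, clamp 1 z.1.2, clamp T z.2).

Lemma continuous_clampCyl T : continuous (clampCyl T).
Proof.
have cy : continuous (fun z : R * R * R => clamp 1 z.1.2).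
  by apply: continuous_comp1; [exact: continuous_clamp|exact: continuous_y].
have ct : continuous (fun z : R * R * R => clamp T z.2).
  by apply: continuous_comp1; [exact: continuous_clamp|exact: continuous_t].
apply: (@continuous_pair (R * R * R)%type (R * R)%type R (fun z => (z.1.1, clamp 1 z.1.2))) => //.
by apply: (@continuous_pair (R * R * R)%type R R (fun z => z.1.1)) => //; exact: continuous_x.
Qed.

Lemma clampCyl_closed T z : 0 <= T -> closedCyl T (clampCyl T z).
Proof. by move=> T0; split; apply: clamp_itv. Qed.

Lemma clampCyl_id T z : closedCyl T z -> clampCyl T z = z.
Proof. by case: z => -[x y] t [/= y01 tT]; rewrite /clampCyl /= !clamp_id. Qed.

Lemma continuous_comp_clamp T F : 0 <= T -> {within closedCyl T, continuous F} ->
  continuous (F \o clampCyl T).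
Proof.
move=> T0 /subspace_continuousP cF z.
move=> A nA.
have hA : nbhs (clampCyl T z) (fun w => closedCyl T w -> A (F w)).
  exact: (cF (clampCyl T z) (clampCyl_closed T z T0) A nA).
have hz : nbhs z (fun u => closedCyl T (clampCyl T u) -> A (F (clampCyl T u))).
  exact: (continuous_clampCyl T z _ hA).
apply: (@filterS _ (nbhs z) _ _ _ _ hz) => u; apply; exact: clampCyl_closed.
Qed.

Lemma is_derive_slice F (z v : R * R * R) d (g : R -> R) (r : R) :
  is_derive z v F d -> (forall h, g (h *: 1 + r) = F (h *: v + z)) ->
  is_derive r 1 g d.
Proof.
move=> [Fd Fv] gE.
have E : (fun h : R => h^-1 *: ((g \o shift r) (h *: (1 : R)) - g r)) =
         (fun h : R => h^-1 *: ((F \o shift z) (h *: v) - F z)).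
  apply/funext => h /=; rewrite gE; congr (_ *: (_ - _)).
  by have := gE 0; rewrite !scale0r !add0r.
apply: DeriveDef; first by move: Fd; rewrite /derivable E.
by rewrite -Fv /derive E.
Qed.

(** [W i j k] plays the role of [d_x^i d_y^j d_t^k] of a function. Continuity is global, whereas
    periodicity and the derivative relations are claimed only over the open cylinder: the extension
    by [clampCyl] is not differentiable across its boundary. *)
Definition cyl T W : Prop :=
  [/\ forall i j k, continuous (W i j k),
      forall i j k x y t, 0 < y < 1 -> 0 < t < T ->
        W i j k (x + 1, y, t) = W i j k (x, y, t),
      forall i j k x y t, 0 < y < 1 -> 0 < t < T ->
        is_derive x 1 (fun x => W i j k (x, y, t)) (W i.+1 j k (x, y, t)),
      forall i j k x y t, 0 < y < 1 -> 0 < t < T ->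
        is_derive y 1 (fun y => W i j k (x, y, t)) (W i j.+1 k (x, y, t)) &
      forall i j k x y t, 0 < y < 1 -> 0 < t < T ->
        is_derive t 1 (fun t => W i j k (x, y, t)) (W i j k.+1 (x, y, t))].

Lemma near_itv (a b r : R) (P : R -> Prop) : a < r < b ->
  (forall s, a < s < b -> P s) -> \forall s \near r, P s.
Proof.
move=> /andP[ar rb] hP; near=> s; apply: hP; apply/andP; split.
  by near: s; exact: lt_nbhsr.
by near: s; exact: lt_nbhsl.
Unshelve. all: by end_near. Qed.

Lemma is_derive_unique (g : R -> R) (r d d' : R) :
  is_derive r 1 g d -> is_derive r 1 g d' -> d = d'.
Proof. by move=> [_ <-] [_ <-]. Qed.

Lemma cyl_of_smooth T f : 0 < T -> smooth_closedCyl T f -> periodic_x T f ->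
  exists W, [/\ cyl T W, forall z, closedCyl T z -> W 0%N 0%N 0%N z = f z &
    forall z, openCyl T z -> [/\ 'D_(ex R) f z = W 1%N 0%N 0%N z,
      'D_(ey R) f z = W 0%N 1%N 0%N z & 'D_(et R) f z = W 0%N 0%N 1%N z]].
Proof.
move=> T0 [F [F0 cF dF]] pf.
pose W i j k := F i j k \o clampCyl T.
have WF i j k x y t : 0 < y < 1 -> 0 < t < T -> W i j k (x, y, t) = F i j k (x, y, t).
  move=> y01 tT; rewrite /W /= clampCyl_id//; split => /=; lra.
have dx i j k x y t : 0 < y < 1 -> 0 < t < T ->
    is_derive x 1 (fun x => W i j k (x, y, t)) (W i.+1 j k (x, y, t)).
  move=> y01 tT; rewrite WF//.
  apply: (@near_eq_is_derive _ _ _ (fun x => F i j k (x, y, t))).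
    by near=> s; rewrite WF.
  have [d _ _] := dF i j k (x, y, t) (conj y01 tT).
  apply: is_derive_slice d _ => h; congr (F i j k (_, _, _)) => //=.
  - by rewrite scaler0 add0r.
  - by rewrite scaler0 add0r.
have dy i j k x y t : 0 < y < 1 -> 0 < t < T ->
    is_derive y 1 (fun y => W i j k (x, y, t)) (W i j.+1 k (x, y, t)).
  move=> y01 tT; rewrite WF//.
  apply: (@near_eq_is_derive _ _ _ (fun y => F i j k (x, y, t))).
    by apply: (near_itv 0 1) => // s s01; rewrite WF.
  have [_ d _] := dF i j k (x, y, t) (conj y01 tT).
  apply: is_derive_slice d _ => h; congr (F i j k (_, _, _)) => //=.
  - by rewrite scaler0 add0r.
  - by rewrite scaler0 add0r.
have dt i j k x y t : 0 < y < 1 -> 0 < t < T ->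
    is_derive t 1 (fun t => W i j k (x, y, t)) (W i j k.+1 (x, y, t)).
  move=> y01 tT; rewrite WF//.
  apply: (@near_eq_is_derive _ _ _ (fun t => F i j k (x, y, t))).
    by apply: (near_itv 0 T) => // s s01; rewrite WF.
  have [_ _ d] := dF i j k (x, y, t) (conj y01 tT).
  apply: is_derive_slice d _ => h; congr (F i j k (_, _, _)) => //=.
  - by rewrite scaler0 add0r.
  - by rewrite scaler0 add0r.
exists W; split.
- split => //.
  + by move=> i j k; apply: continuous_comp_clamp => //; exact: ltW.
  (* Periodicity is given for [f] alone and passes to its derivatives by uniqueness of the
     derivative, one index at a time: first [i], then [j], then [k]. *)
  + have p0 x y t : 0 < y < 1 -> 0 < t < T -> W 0%N 0%N 0%N (x + 1, y, t) = W 0%N 0%N 0%N (x, y, t).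
      by move=> y01 tT; rewrite !WF// F0; apply: pf; split => /=; lra.
    have px i x y t : 0 < y < 1 -> 0 < t < T -> W i 0%N 0%N (x + 1, y, t) = W i 0%N 0%N (x, y, t).
      elim: i x => [|i IH] x y01 tT; first exact: p0.
      apply: (@is_derive_unique (fun x => W i 0%N 0%N (x, y, t)) x _ _ _ (dx _ _ _ _ _ _ y01 tT)).
      rewrite (_ : (fun x => _) = (fun x => W i 0%N 0%N (x + 1, y, t))); last first.
        by apply/funext => s; rewrite IH.
      exact: (is_derive_comp_shift (fun x => W i 0%N 0%N (x, y, t)) 1 x _ (dx _ _ _ _ _ _ y01 tT)).
    have py i j x y t : 0 < y < 1 -> 0 < t < T -> W i j 0%N (x + 1, y, t) = W i j 0%N (x, y, t).
      elim: j y => [|j IH] y y01 tT; first exact: px.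
      apply: (@is_derive_unique (fun y => W i j 0%N (x, y, t)) y _ _ _ (dy _ _ _ _ _ _ y01 tT)).
      apply: (@near_eq_is_derive _ _ _ (fun y => W i j 0%N (x + 1, y, t))).
        by apply: (near_itv 0 1) => // s s01; rewrite IH.
      exact: dy.
    move=> i j k x y t y01; elim: k t => [|k IH] t tT; first exact: py.
    apply: (@is_derive_unique (fun t => W i j k (x, y, t)) t _ _ _ (dt _ _ _ _ _ _ y01 tT)).
    apply: (@near_eq_is_derive _ _ _ (fun t => W i j k (x + 1, y, t))).
      by apply: (near_itv 0 T) => // s s01; rewrite IH.
    exact: dt.
- by move=> z cz; rewrite /W /= clampCyl_id// F0.
- move=> [[x y] t] [/= y01 tT]; rewrite !WF// -F0.
  by have [[_ ->] [_ ->] [_ ->]] := dF 0%N 0%N 0%N (x, y, t) (conj y01 tT).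
Unshelve. all: by end_near. Qed.

Definition shiftx h W : nat -> nat -> nat -> R * R * R -> R :=
  fun i j k z => W i j k (z.1.1 + h, z.1.2, z.2).

Definition diffx h W : nat -> nat -> nat -> R * R * R -> R :=
  fun i j k z => W i j k (z.1.1 + h, z.1.2, z.2) - W i j k z.

Lemma cyl_shiftx T h W : cyl T W -> cyl T (shiftx h W).
Proof.
move=> [cW pW dx dy dt]; split; rewrite /shiftx /=.
- by move=> i j k; cont; exact: cW.
- by move=> i j k x y t y01 tT; rewrite addrAC pW.
- move=> i j k x y t y01 tT.
  exact: (is_derive_comp_shift (fun x => W i j k (x, y, t)) h x _ (dx _ _ _ _ _ _ y01 tT)).
- by move=> i j k x y t y01 tT; exact: dy.
- by move=> i j k x y t y01 tT; exact: dt.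
Qed.

Lemma cyl_diffx T h W : cyl T W -> cyl T (diffx h W).
Proof.
move=> cW; have [cW' pW' dx' dy' dt'] := cyl_shiftx T h W cW.
have [{}cW pW dx dy dt] := cW; split; rewrite /diffx /=.
- by move=> i j k; apply: continuousB3; [exact: (cW' i j k)|exact: cW].
- by move=> i j k x y t y01 tT; rewrite pW// addrAC pW.
- move=> i j k x y t y01 tT.
  exact: is_deriveB (dx' i j k x y t y01 tT) (dx i j k x y t y01 tT).
- move=> i j k x y t y01 tT.
  exact: is_deriveB (dy' i j k x y t y01 tT) (dy i j k x y t y01 tT).
- move=> i j k x y t y01 tT.
  exact: is_deriveB (dt' i j k x y t y01 tT) (dt i j k x y t y01 tT).
Qed.

End Cylinder.

(** * [L^2] norms as square roots of real integrals *)

Section L2norms.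
Context {R : realType}.

Lemma L2norm_EFin d (X : measurableType d) (mu : {measure set X -> \bar R})
  (D : set X) (f : X -> R) (r : R) :
  (\int[mu]_(x in D) (f x ^+ 2)%:E)%E = r%:E -> L2norm mu D f = (Num.sqrt r)%:E.
Proof.
move=> fr; rewrite /L2norm unlock /=.
have -> : (fun x => `|(EFin \o f \_ D) x| `^ 2)%E = ((fun x => (f x ^+ 2)%:E) \_ D)%E.
  apply/funext => x /=; rewrite /patch; case: ifPn => _ /=.
    by rewrite powR_mulrn// real_normK// num_real.
  by rewrite normr0 powR0.
rewrite -integral_mkcond fr poweR12_sqrt// -fr; apply: integral_ge0 => x _.
by rewrite lee_fin sqr_ge0.
Qed.

Lemma L2normOT_I3 T (F : R * R * R -> R) : continuous F ->
  L2normOT T F = (Num.sqrt (I3 T (fun z => F z ^+ 2)))%:E.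
Proof.
by move=> cF; apply: (@L2norm_EFin _ _ (@leb3 R)); rewrite -I3E//; exact: continuous_sqr.
Qed.

Lemma eq_L2normOT T (F G : R * R * R -> R) : (forall z, OmegaT T z -> F z = G z) ->
  L2normOT T F = L2normOT T G.
Proof.
move=> FG; rewrite /L2normOT /L2norm; congr Lnorm.
by apply/funext => z /=; rewrite /patch; case: ifPn => //; rewrite inE => /FG ->.
Qed.

Lemma in_L2_continuous3 T (F : R * R * R -> R) : continuous F ->
  in_L2 (@leb3 R) (OmegaT T) F.
Proof.
move=> cF; split; last first.
  have := L2normOT_I3 T F cF; rewrite /L2normOT => ->; exact: ltry.
by apply: measurable_funS (continuous_measurable_fun3 _ cF) => //; exact: measurable_OmegaT.
Qed.

Lemma in_L2_continuous1 (u : R -> R) : continuous u ->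
  in_L2 (@lebesgue_measure R) `]0, 1[ u.
Proof.
move=> cu; split.
  by apply: measurable_funS (continuous_measurable_fun cu) => //.
have cu2 : continuous (fun x => u x ^+ 2) by exact: continuous_sqr.
rewrite (@L2norm_EFin _ _ _ _ _ (\int[lebesgue_measure]_(x in `]0, 1[) (u x ^+ 2))) ?ltry//.
rewrite /Rintegral fineK//; apply: integrable_fin_num => //.
apply: (continuous_integrable1 _ _ 0 1) => // x /=.
by rewrite !in_itv /= => /andP[? ?]; lra.
Qed.

(** A test function is its own approximating sequence. *)
Lemma in_H10_test (u : R -> R) : test_function u -> continuous u -> continuous (derive1 u) ->
  in_H10 u (derive1 u).
Proof.
move=> tu cu cdu; split; [exact: in_L2_continuous1|exact: in_L2_continuous1|].
have L0 (v : R -> R) : L2norm (@lebesgue_measure R) `]0, 1[ (v \- v) = 0%E.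
  rewrite (@L2norm_EFin _ _ _ _ _ 0) ?sqrtr0//.
  by under eq_integral => x _ do rewrite /= subrr expr0n /=; rewrite integral0.
exists (fun=> u); split => //.
- by rewrite (_ : (fun _ => _) = cst 0%E); [exact: cvg_cst|apply/funext => m; exact: L0].
- by rewrite (_ : (fun _ => _) = cst 0%E); [exact: cvg_cst|apply/funext => m; exact: L0].
Qed.

End L2norms.

(** * Pairing with the dual norm: the admissible test functions *)

Section Pairing.
Context {R : realType}.
Variables (T B : R) (g0 : R * R * R -> R) (g : R * R * R -> R).
Hypothesis g0g : forall z, OmegaT T z -> g0 z = g z.
Hypothesis cg : continuous g.
Hypothesis g0B : forall phi dphi, in_L2H10 T phi dphi -> L2normOT T dphi = 1%E ->
  (\int[@leb3 R]_(z in OmegaT T) (g0 z * phi z)%:E <= B%:E)%E.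
Variables (W : nat -> nat -> nat -> R * R * R -> R) (tau kap : R -> R) (a p q : R).
Hypotheses (T0 : 0 < T) (cW : cyl T W) (ctau : continuous tau) (skap : smooth setT kap).
Hypotheses (p0 : 0 < p) (pq : p <= q) (q1 : q < 1) (pa : 0 < p + a) (qa : q + a < 1).
Hypothesis kap0 : forall y, ~~ (p <= y <= q) -> kap y = 0.

Definition phi_test (z : R * R * R) : R :=
  tau z.2 * (kap z.1.2 * W 0%N 0%N 0%N (z.1.1, z.1.2 + a, z.2)).
Definition dphi_test (z : R * R * R) : R :=
  tau z.2 * (derive1 kap z.1.2 * W 0%N 0%N 0%N (z.1.1, z.1.2 + a, z.2) +
             kap z.1.2 * W 0%N 1%N 0%N (z.1.1, z.1.2 + a, z.2)).

Let ckap : continuous kap. Proof. exact: smooth_continuous. Qed.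
Let cdkap : continuous (derive1 kap).
Proof. by apply: smooth_continuous; exact: smooth_derive1. Qed.

Lemma derive1_kap0 y : ~~ (p <= y <= q) -> derive1 kap y = 0.
Proof.
move=> hy; apply: (@derive1_locally_cst _ _ 0).
have [yp|py] := ltP y p.
  by near=> s; apply: kap0; rewrite negb_and -ltNge; apply/orP; left; near: s; exact: lt_nbhsl.
have qy : q < y by move: hy; rewrite py /= -ltNge.
by near=> s; apply: kap0; rewrite negb_and -!ltNge; apply/orP; right; near: s; exact: lt_nbhsr.
Unshelve. all: by end_near. Qed.

Lemma continuous_phi_test : continuous phi_test.
Proof. by have [cW' _ _ _ _] := cW; rewrite /phi_test; cont; exact: cW'. Qed.

Lemma continuous_dphi_test : continuous dphi_test.
Proof. by have [cW' _ _ _ _] := cW; rewrite /dphi_test; cont; exact: cW'. Qed.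

(** On [O1] the translate of [W] is differentiable, on [O2] the weight [kap] vanishes. The two cover
    the line because the translated support [[p + a, q + a]] stays in []0, 1[]. *)
Let O1 : set R := [set y | 0 < y + a < 1].
Let O2 : set R := [set y | y < p] `|` [set y | q < y].

Let oO1 : open O1.
Proof.
have -> : O1 = [set y | - a < y] `&` [set y | y < 1 - a].
  apply/seteqP; split => y /=; rewrite /O1 /=; first by move=> /andP[? ?]; split; lra.
  by move=> [? ?]; apply/andP; split; lra.
by apply: openI; [exact: open_gt|exact: open_lt].
Qed.

Let oO2 : open O2. Proof. by apply: openU; [exact: open_lt|exact: open_gt]. Qed.

Let OT : setT = O1 `|` O2.
Proof.
apply/seteqP; split=> y // _; rewrite /O1 /O2 /=.
case: (ltP y p) => yp; first by right; left.
case: (ltP q y) => yq; first by right; right.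
left; apply/andP; split.
  by apply: (lt_le_trans pa); rewrite lerD2r.
by apply: le_lt_trans qa; rewrite lerD2r.
Qed.

Lemma slice_test_smooth x t : 0 < t < T -> smooth setT (fun y => phi_test (x, y, t)).
Proof.
move=> tT n; rewrite OT; apply: nderivableU.
  apply: (nderivableM _ _ (fun=> tau t) (fun y => kap y * W 0%N 0%N 0%N (x, y + a, t))).
  - exact: oO1.
  - by apply: nderivable_cst; exact: oO1.
  apply: (nderivableM _ _ kap (fun y => W 0%N 0%N 0%N (x, y + a, t))); [exact: oO1| |].
    by apply: (nderivable_subset _ _ setT) => //; exact: skap.
  apply: (nderivable_chain _ _ (fun k y => W 0%N k 0%N (x, y + a, t)) 0%N oO1) => k y Oy.
  have [_ _ _ dy _] := cW.
  exact: (is_derive_comp_shift (fun y => W 0%N k 0%N (x, y, t)) a y _ (dy _ _ _ x _ _ Oy tT)).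
apply: (eq_nderivable _ _ (fun=> 0)) => //; last exact: nderivable_cst.
move=> y Oy; rewrite /phi_test /= kap0 ?mul0r ?mulr0//.
by case: Oy => /= h; rewrite negb_and -!ltNge h ?orbT.
Qed.

Lemma slice_test_derive (x y t : R) : 0 < t < T ->
  is_derive y 1 (fun y => phi_test (x, y, t)) (dphi_test (x, y, t)).
Proof.
move=> tT; have : (O1 `|` O2) y by rewrite -OT.
case=> Oy.
  have [_ _ _ dy _] := cW.
  have d1 := is_derive_comp_shift (fun y => W 0%N 0%N 0%N (x, y, t)) a y _ (dy _ _ _ x _ _ Oy tT).
  have d2 := is_deriveM (smooth_is_derive kap y skap) d1.
  have := is_deriveZ (tau t) d2; rewrite /GRing.scale /= => h.
  apply: (is_derive_eq h); rewrite /dphi_test /=; ring.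
have ky : ~~ (p <= y <= q) by case: Oy => /= h; rewrite negb_and -!ltNge h ?orbT.
rewrite /dphi_test /= (kap0 y ky) (derive1_kap0 y ky) !mul0r addr0 mulr0.
have dc : is_derive y 1 (fun=> 0 : R) (0 : R) by exact: is_derive_cst.
apply: (@near_eq_is_derive _ _ _ _ _ _ _ _ _ dc).
apply: filterS (open_nbhs_nbhs (conj oO2 Oy)) => s Os.
rewrite /phi_test /= kap0 ?mul0r ?mulr0//.
by case: Os => /= h; rewrite negb_and -!ltNge h ?orbT.
Qed.

Lemma test_in_L2H10 (c : R) : in_L2H10 T (fun z => c * phi_test z) (fun z => c * dphi_test z).
Proof.
have cphi := continuous_phi_test; have cdphi := continuous_dphi_test.
split; [by apply: in_L2_continuous3; cont|by apply: in_L2_continuous3; cont|].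
apply: aeW => -[x t] /= _ tT.
have s := slice_test_smooth x t tT.
pose u := fun y => c * phi_test (x, y, t).
have su : smooth setT u.
  by move=> n; apply: nderivableM; [exact: openT|apply: nderivable_cst; exact: openT|exact: s].
have -> : (fun y => c * dphi_test (x, y, t)) = derive1 u.
  apply/funext => y; apply: (@is_derive_unique R u y).
    have := is_deriveZ c (slice_test_derive x y t tT); exact.
  exact: smooth_is_derive.
apply: in_H10_test.
- apply: (smooth_test_function u p q) => // y hy.
  by rewrite /u /phi_test /= kap0// mul0r !mulr0.
- exact: smooth_continuous.
- by apply: smooth_continuous; exact: smooth_derive1.
Qed.

Lemma pairing_le :
  I3 T (fun z => g z * phi_test z) <= B * Num.sqrt (I3 T (fun z => dphi_test z ^+ 2)).
Proof.
have cphi := continuous_phi_test; have cdphi := continuous_dphi_test.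
set n := Num.sqrt _.
(* The test function cannot be normalised when [n = 0]. In that case Poincare's inequality makes
   [phi_test] vanish in [L^2], and Young's inequality with a small weight [l] on [g ^ 2] bounds the
   pairing by any [e > 0]. *)
have [n0|n0] := eqVneq n 0.
  have d0 : I3 T (fun z => dphi_test z ^+ 2) = 0.
    apply/eqP; move/eqP: n0; rewrite sqrtr_eq0 eq_le => ->.
    by apply: I3_ge0 => z; exact: sqr_ge0.
  have phi0 : I3 T (fun z => phi_test z ^+ 2) <= 0.
    rewrite -d0; apply: I3_poincare => //.
    - by move=> x y t _ tT; exact: slice_test_derive.
    - by move=> x t; rewrite /phi_test /= kap0 ?mul0r ?mulr0// negb_and -!ltNge p0.
  rewrite n0 mulr0; apply/ler_addgt0Pl => e e0; rewrite addr0.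
  have cg2 : continuous (fun z => g z ^+ 2) by exact: continuous_sqr.
  have cp2 : continuous (fun z => phi_test z ^+ 2) by exact: continuous_sqr.
  pose G := I3 T (fun z => g z ^+ 2).
  have G0 : 0 <= G by apply: I3_ge0 => z; exact: sqr_ge0.
  have G1 : 0 < G + 1 by lra.
  pose l := e / (G + 1); have l0 : 0 < l by rewrite divr_gt0.
  apply: (@le_trans _ _ (I3 T (fun z => l * g z ^+ 2 + l^-1 * phi_test z ^+ 2))).
    apply: I3_le; [by cont..|move=> x y t _ _ _].
    set u := g _; set v := phi_test _.
    have : 0 <= l^-1 * (l * u - v / 2) ^+ 2 + l^-1 * (3 / 4) * v ^+ 2.
      have lV : 0 <= l^-1 by rewrite invr_ge0 ltW.
      apply: addr_ge0; first by apply: mulr_ge0 => //; exact: sqr_ge0.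
      by apply: mulr_ge0; [apply: mulr_ge0 => //; lra|exact: sqr_ge0].
    suff -> : l^-1 * (l * u - v / 2) ^+ 2 + l^-1 * (3 / 4) * v ^+ 2 =
      l * u ^+ 2 + l^-1 * v ^+ 2 - u * v by lra.
    by field; rewrite gt_eqF.
  rewrite I3D; [|by cont..]; rewrite !I3Z// -/G.
  have : l^-1 * I3 T (fun z => phi_test z ^+ 2) <= 0.
    by rewrite mulr_ge0_le0// invr_ge0 ltW.
  have : l * G <= e.
    rewrite /l mulrAC ler_pdivrMr// ler_pM2l//; lra.
  lra.
have npos : 0 < n by rewrite lt_neqAle eq_sym n0 sqrtr_ge0.
have := g0B _ _ (test_in_L2H10 n^-1).
rewrite L2normOT_I3; last by cont.
have -> : I3 T (fun z => (n^-1 * dphi_test z) ^+ 2) = 1.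
  rewrite (_ : (fun z => _) = (fun z => n^-1 ^+ 2 * dphi_test z ^+ 2)); last first.
    by apply/funext => z; rewrite exprMn.
  rewrite I3Z; last exact: continuous_sqr.
  have -> : I3 T (fun z => dphi_test z ^+ 2) = n ^+ 2.
    by rewrite sqr_sqrtr// I3_ge0// => z; exact: sqr_ge0.
  by rewrite -exprMn mulVf// expr1n.
rewrite sqrtr1 => /(_ erefl).
have -> : (\int[@leb3 R]_(z in OmegaT T) (g0 z * (n^-1 * phi_test z))%:E)%E =
    (n^-1 * I3 T (fun z => g z * phi_test z))%:E.
  rewrite -I3Z; last by cont.
  rewrite -I3E; last by cont.
  by apply: eq_integral => z; rewrite inE => /g0g ->; rewrite mulrCA.
by rewrite lee_fin ler_pdivrMl// mulrC.
Qed.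

End Pairing.

(** * The [H^-1] bound in the form used by the estimates *)

Section PairBound.
Context {R : realType}.
Implicit Types (T B x y t h : R) (F G : R * R * R -> R)
  (W : nat -> nat -> nat -> R * R * R -> R).

Definition nrm T F : R := Num.sqrt (I3 T (fun z => F z ^+ 2)).

Lemma nrm_ge0 T F : 0 <= nrm T F. Proof. exact: sqrtr_ge0. Qed.

Lemma sqr_nrm T F : nrm T F ^+ 2 = I3 T (fun z => F z ^+ 2).
Proof. by rewrite sqr_sqrtr// I3_ge0// => z; exact: sqr_ge0. Qed.

Lemma nrm_le T F (c : R) : 0 <= c -> I3 T (fun z => F z ^+ 2) <= c ^+ 2 -> nrm T F <= c.
Proof. by move=> c0; rewrite -sqr_nrm ler_sqr ?nnegrE ?nrm_ge0. Qed.

Lemma I3N T F : continuous F -> I3 T (fun z => - F z) = - I3 T F.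
Proof.
move=> cF; rewrite -[RHS]mulN1r -I3Z//; congr I3.
by apply/funext => z; rewrite mulN1r.
Qed.

(** Young's inequality with weights [v / u] and [u / v], where [u] and [v] are the two norms raised
    by a small [r > 0] to allow division even when a norm vanishes; [r] is such that the product
    grows by at most [e]. *)
Lemma I3_cauchy_schwarz T F G : continuous F -> continuous G ->
  I3 T (fun z => F z * G z) <= nrm T F * nrm T G.
Proof.
move=> cF cG; have hF := nrm_ge0 T F; have hG := nrm_ge0 T G.
apply/ler_addgt0Pl => e e0.
pose u := nrm T F + Num.min 1 (e / (nrm T F + nrm T G + 1)).
pose v := nrm T G + Num.min 1 (e / (nrm T F + nrm T G + 1)).
pose r := Num.min 1 (e / (nrm T F + nrm T G + 1)).
have r0 : 0 < r by rewrite lt_min ltr01 divr_gt0//; lra.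
have r1 : r <= 1 by rewrite ge_min lexx.
have re : r * (nrm T F + nrm T G + 1) <= e.
  by rewrite -ler_pdivlMr ?ge_min ?lexx ?orbT//; lra.
have u0 : 0 < u by rewrite /u -/r; lra.
have v0 : 0 < v by rewrite /v -/r; lra.
have uv : u * v <= e + nrm T F * nrm T G.
  rewrite /u /v -/r.
  have -> : (nrm T F + r) * (nrm T G + r) =
    nrm T F * nrm T G + r * (nrm T F + nrm T G + r) by ring.
  have : r * (nrm T F + nrm T G + r) <= r * (nrm T F + nrm T G + 1).
    by apply: ler_wpM2l; lra.
  lra.
apply: le_trans uv.
have key : I3 T (fun z => F z * G z) <=
    I3 T (fun z => (v / u / 2) * F z ^+ 2 + (u / v / 2) * G z ^+ 2).
  apply: I3_le; [by cont..|move=> x y t _ _ _].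
  set a := F _; set b := G _.
  have : 0 <= (v * a - u * b) ^+ 2 / (u * v) / 2.
    by apply: divr_ge0 => //; apply: divr_ge0; [exact: sqr_ge0|exact/ltW/mulr_gt0].
  suff -> : (v * a - u * b) ^+ 2 / (u * v) / 2 =
    v / u / 2 * a ^+ 2 + u / v / 2 * b ^+ 2 - a * b by lra.
  by field; rewrite !gt_eqF.
apply: (le_trans key).
have cF2 : continuous (fun z => F z ^+ 2) by exact: continuous_sqr.
have cG2 : continuous (fun z => G z ^+ 2) by exact: continuous_sqr.
rewrite I3D; [|by cont..]; rewrite !I3Z// -!sqr_nrm.
have h1 : v / u / 2 * nrm T F ^+ 2 <= v / u / 2 * u ^+ 2.
  apply: ler_wpM2l; first by rewrite !divr_ge0// ltW.
  by rewrite ler_sqr ?nnegrE ?(ltW u0)// /u -/r; lra.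
have h2 : u / v / 2 * nrm T G ^+ 2 <= u / v / 2 * v ^+ 2.
  apply: ler_wpM2l; first by rewrite !divr_ge0// ltW.
  by rewrite ler_sqr ?nnegrE ?(ltW v0)// /v -/r; lra.
have e1 : v / u / 2 * u ^+ 2 = u * v / 2 by field; rewrite gt_eqF.
have e2 : u / v / 2 * v ^+ 2 = u * v / 2 by field; rewrite gt_eqF.
lra.
Qed.

Lemma nrmB_le T F G : continuous F -> continuous G ->
  nrm T (fun z => F z - G z) <= nrm T F + nrm T G.
Proof.
move=> cF cG; apply: nrm_le; first by rewrite addr_ge0 ?nrm_ge0.
have cF2 : continuous (fun z => F z ^+ 2) by exact: continuous_sqr.
have cG2 : continuous (fun z => G z ^+ 2) by exact: continuous_sqr.
have cN : continuous (fun z => - F z) by exact: continuousN3.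
have := I3_cauchy_schwarz T _ _ cN cG.
have -> : nrm T (fun z => - F z) = nrm T F.
  by rewrite /nrm; congr (Num.sqrt (I3 _ _)); apply/funext => z; rewrite sqrrN.
have -> : I3 T (fun z => (F z - G z) ^+ 2) =
    I3 T (fun z => F z ^+ 2 + 2 * (- F z * G z) + G z ^+ 2).
  by congr I3; apply/funext => z; ring.
rewrite I3D; [|by cont..]; rewrite I3D; [|by cont..].
rewrite I3Z; last by cont.
by rewrite -!sqr_nrm sqrrD -mulr_natl; lra.
Qed.

Lemma nrm_shiftx T W h i j k : cyl T W -> nrm T (shiftx h W i j k) = nrm T (W i j k).
Proof.
move=> [cW pW _ _ _]; rewrite /nrm; congr Num.sqrt.
apply: (I3_shift_x (fun z => W i j k z ^+ 2)); first by apply: continuous_sqr; exact: cW.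
by move=> x y t y01 tT; rewrite pW.
Qed.

(* [W] need not vanish on [{y = 0, 1}], since [kap] is supported in [[p, q]];
   this admits translates in [y] and differences in [x] of the solution. *)
Definition pair_bound T (g : R * R * R -> R) B : Prop :=
  forall W (tau kap : R -> R) (a p q k0 k1 : R), cyl T W -> continuous tau ->
    (forall t, 0 < t < T -> `|tau t| <= 1) -> smooth setT kap ->
    0 < p -> p <= q -> q < 1 -> 0 < p + a -> q + a < 1 ->
    (forall y, ~~ (p <= y <= q) -> kap y = 0) ->
    (forall y, `|kap y| <= k0) -> (forall y, `|derive1 kap y| <= k1) ->
    `|I3 T (fun z => g z * (tau z.2 * (kap z.1.2 * W 0%N 0%N 0%N (z.1.1, z.1.2 + a, z.2))))|
      <= B * (k1 * nrm T (W 0%N 0%N 0%N) + k0 * nrm T (W 0%N 1%N 0%N)).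

Lemma dphi_test_bound T W (tau kap : R -> R) (a p q k0 k1 : R) : cyl T W -> continuous tau ->
    (forall t, 0 < t < T -> `|tau t| <= 1) -> smooth setT kap ->
    0 < p -> p <= q -> q < 1 -> 0 < p + a -> q + a < 1 ->
    (forall y, ~~ (p <= y <= q) -> kap y = 0) ->
    (forall y, `|kap y| <= k0) -> (forall y, `|derive1 kap y| <= k1) ->
  nrm T (dphi_test W tau kap a) <= 2 * (k1 * nrm T (W 0%N 0%N 0%N) + k0 * nrm T (W 0%N 1%N 0%N)).
Proof.
move=> cW ctau tau1 skap p0 pq q1 pa qa kap0 kapb dkapb.
have [cW' _ _ _ _] := cW; have cW0 := cW' 0%N 0%N 0%N; have cW1 := cW' 0%N 1%N 0%N.
have ckap := smooth_continuous _ skap.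
have cdkap : continuous (derive1 kap) by apply: smooth_continuous; exact: smooth_derive1.
have k00 : 0 <= k0 by apply: le_trans (kapb 0).
have k10 : 0 <= k1 by apply: le_trans (dkapb 0).
set n0 := nrm T (W 0%N 0%N 0%N); set n1 := nrm T (W 0%N 1%N 0%N).
have n00 : 0 <= n0 by exact: nrm_ge0.
have n10 : 0 <= n1 by exact: nrm_ge0.
have t0 : 0 <= k1 * n0 by exact: mulr_ge0.
have t1 : 0 <= k0 * n1 by exact: mulr_ge0.
apply: nrm_le; first by rewrite mulr_ge0// addr_ge0.
have cK : continuous (fun y => 2 * kap y ^+ 2) by cont.
have cK' : continuous (fun y => 2 * derive1 kap y ^+ 2) by cont.
have cWW0 : continuous (fun z => W 0%N 0%N 0%N z ^+ 2) by cont.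
have cWW1 : continuous (fun z => W 0%N 1%N 0%N z ^+ 2) by cont.
have cS0 : continuous (fun z : R * R * R => (2 * derive1 kap z.1.2 ^+ 2) * W 0%N 0%N 0%N (z.1.1, z.1.2 + a, z.2) ^+ 2) by cont.
have cS1 : continuous (fun z : R * R * R => (2 * kap z.1.2 ^+ 2) * W 0%N 1%N 0%N (z.1.1, z.1.2 + a, z.2) ^+ 2) by cont.
have c2 (u k : R) : `|u| <= k -> 0 <= 2 * u ^+ 2 <= 2 * k ^+ 2.
  move=> uk; rewrite mulr_ge0 ?sqr_ge0//= ler_pM2l// -[u ^+ 2]real_normK ?num_real//.
  by rewrite ler_sqr ?nnegrE// (le_trans _ uk).
apply: (@le_trans _ _ (2 * k1 ^+ 2 * n0 ^+ 2 + 2 * k0 ^+ 2 * n1 ^+ 2)); last first.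
  set u := k1 * n0 in t0 *; set v := k0 * n1 in t1 *.
  have -> : 2 * k1 ^+ 2 * n0 ^+ 2 + 2 * k0 ^+ 2 * n1 ^+ 2 = 2 * u ^+ 2 + 2 * v ^+ 2.
    by rewrite /u /v; ring.
  have := mulr_ge0 t0 t1; have := sqr_ge0 u; have := sqr_ge0 v.
  have -> : (2 * (u + v)) ^+ 2 = 4 * u ^+ 2 + 8 * (u * v) + 4 * v ^+ 2 by ring.
  lra.
rewrite /n0 /n1 !sqr_nrm.
apply: (@le_trans _ _ (I3 T (fun z => (2 * derive1 kap z.1.2 ^+ 2) * W 0%N 0%N 0%N (z.1.1, z.1.2 + a, z.2) ^+ 2
   + (2 * kap z.1.2 ^+ 2) * W 0%N 1%N 0%N (z.1.1, z.1.2 + a, z.2) ^+ 2))).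
  apply: I3_le; [|by cont|].
    by apply: continuous_sqr; rewrite /dphi_test; cont.
  move=> x y t _ _ tT; rewrite /dphi_test /=.
  set u := derive1 kap y * _; set v := kap y * _.
  have -> : 2 * derive1 kap y ^+ 2 * W 0%N 0%N 0%N (x, y + a, t) ^+ 2 = 2 * u ^+ 2.
    by rewrite /u exprMn; ring.
  have -> : 2 * kap y ^+ 2 * W 0%N 1%N 0%N (x, y + a, t) ^+ 2 = 2 * v ^+ 2.
    by rewrite /v exprMn; ring.
  rewrite exprMn.
  have tt : tau t ^+ 2 <= 1.
    by rewrite -[tau t ^+ 2]real_normK ?num_real// expr_le1 ?tau1.
  apply: (@le_trans _ _ ((u + v) ^+ 2)).
    by rewrite -[leRHS]mul1r ler_wpM2r// sqr_ge0.
  have := sqr_ge0 (u - v).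
  have -> : (u - v) ^+ 2 = 2 * u ^+ 2 + 2 * v ^+ 2 - (u + v) ^+ 2 by ring.
  lra.
rewrite I3D//; apply: lerD.
  apply: (I3_weighted_shift_le (fun y => 2 * derive1 kap y ^+ 2) (fun z => W 0%N 0%N 0%N z ^+ 2) T a (2 * k1 ^+ 2) p q) => //; try lra.
  - by move=> y; exact: c2.
  - by move=> y _ /(derive1_kap0 kap p q kap0) ->; rewrite expr0n mulr0.
  - by move=> z; exact: sqr_ge0.
apply: (I3_weighted_shift_le (fun y => 2 * kap y ^+ 2) (fun z => W 0%N 1%N 0%N z ^+ 2) T a (2 * k0 ^+ 2) p q) => //; try lra.
- by move=> y; exact: c2.
- by move=> y _ /kap0 ->; rewrite expr0n mulr0.
- by move=> z; exact: sqr_ge0.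
Qed.

Lemma derive1N (u : R -> R) : smooth setT u -> derive1 (fun y => - u y) = (fun y => - derive1 u y).
Proof.
move=> su; apply/funext => y.
have h := is_deriveN (smooth_is_derive u y su).
by rewrite derive1E (@derive_val _ _ _ _ _ _ _ h).
Qed.

(** A supremum bounds the pairing from above only; the bound on the absolute value comes from using
    [- kap] as well. The factor 2 is that of [dphi_test_bound]. *)
Lemma pair_bound_of_dual T B (g0 g : R * R * R -> R) : 0 < T -> 0 <= B ->
  (forall z, OmegaT T z -> g0 z = g z) -> continuous g ->
  (forall phi dphi, in_L2H10 T phi dphi -> L2normOT T dphi = 1%E ->
    (\int[@leb3 R]_(z in OmegaT T) (g0 z * phi z)%:E <= B%:E)%E) ->
  pair_bound T g (2 * B).
Proof.
move=> T0 B0 g0g cg g0B W tau kap a p q k0 k1 cW ctau tau1 skap p0 pq q1 pa qa kap0 kapb dkapb.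
have [cW' _ _ _ _] := cW; have cW0 := cW' 0%N 0%N 0%N.
have ckap := smooth_continuous _ skap.
have up (kap' : R -> R) : smooth setT kap' -> (forall y, ~~ (p <= y <= q) -> kap' y = 0) ->
    (forall y, `|kap' y| <= k0) -> (forall y, `|derive1 kap' y| <= k1) ->
    I3 T (fun z => g z * (tau z.2 * (kap' z.1.2 * W 0%N 0%N 0%N (z.1.1, z.1.2 + a, z.2))))
      <= 2 * B * (k1 * nrm T (W 0%N 0%N 0%N) + k0 * nrm T (W 0%N 1%N 0%N)).
  move=> skap' kap0' kapb' dkapb'.
  have := pairing_le T B g0 g g0g cg g0B W tau kap' a p q cW ctau skap' p0 q1 pa qa kap0'.
  move=> /le_trans; apply; rewrite -mulrA mulrCA; apply: ler_wpM2l => //.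
  exact: (dphi_test_bound T W tau kap' a p q).
rewrite ler_norml up// andbT lerNl -I3N; last by cont.
have := up (fun y => - kap y).
have -> : (fun z : R * R * R => g z * (tau z.2 * (- kap z.1.2 * W 0%N 0%N 0%N (z.1.1, z.1.2 + a, z.2)))) =
  (fun z => - (g z * (tau z.2 * (kap z.1.2 * W 0%N 0%N 0%N (z.1.1, z.1.2 + a, z.2))))).
  by apply/funext => z; ring.
apply.
- have -> : (fun y => - kap y) = (fun y => (-1) * kap y) by apply/funext => y; rewrite mulN1r.
  by apply: smoothM => //; [exact: openT|move=> n; apply: nderivable_cst; exact: openT].
- by move=> y /kap0 ->; rewrite oppr0.
- by move=> y; rewrite normrN.
- by move=> y; rewrite derive1N// normrN.
Qed.

(** By periodicity the translation in [x] is moved from [g] onto the test function, where it changes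
    no norm; each of the two terms then costs [B]. *)
Lemma pair_bound_diffx T B (g : R * R * R -> R) h : continuous g ->
  (forall x y t, 0 < y < 1 -> 0 < t < T -> g (x + 1, y, t) = g (x, y, t)) ->
  pair_bound T g B ->
  pair_bound T (fun z => g (z.1.1 + h, z.1.2, z.2) - g z) (2 * B).
Proof.
move=> cg pg gB W tau kap a p q k0 k1 cW ctau tau1 skap p0 pq q1 pa qa kap0 kapb dkapb.
have [cW' pW _ _ _] := cW; have cW0 := cW' 0%N 0%N 0%N.
have ckap := smooth_continuous _ skap.
pose phi (W : nat -> nat -> nat -> R * R * R -> R) z := tau z.2 * (kap z.1.2 * W 0%N 0%N 0%N (z.1.1, z.1.2 + a, z.2)).
have cphi : continuous (phi W) by rewrite /phi; cont.
have cphi' : continuous (phi (shiftx (- h) W)) by rewrite /phi /shiftx /=; cont.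
have -> : I3 T (fun z => (g (z.1.1 + h, z.1.2, z.2) - g z) *
   (tau z.2 * (kap z.1.2 * W 0%N 0%N 0%N (z.1.1, z.1.2 + a, z.2)))) =
   I3 T (fun z => g z * phi (shiftx (- h) W) z) - I3 T (fun z => g z * phi W z).
  rewrite -(I3_shift_x (fun z => g z * phi (shiftx (- h) W) z) T h); last 2 first.
  - by cont.
  - move=> x y t y01 tT; rewrite pg//; congr (_ * _); rewrite /phi /shiftx /= addrAC.
    have [ya|ya] := boolP (0 < y + a < 1); first by rewrite pW.
    rewrite kap0 ?mul0r//; apply/negP => ypq; move/negP: ya; apply; lra.
  rewrite -I3B; [|by cont..]; congr I3; apply/funext => z.
  by rewrite /phi /shiftx /= addrK mulrBl.
rewrite (le_trans (ler_normB _ _))//.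
have b1 := gB W tau kap a p q k0 k1 cW ctau tau1 skap p0 pq q1 pa qa kap0 kapb dkapb.
have b2 := gB (shiftx (- h) W) tau kap a p q k0 k1 (cyl_shiftx _ _ _ cW) ctau tau1 skap p0 pq q1 pa qa kap0 kapb dkapb.
rewrite !nrm_shiftx// in b2.
rewrite -mulrA mulr_natl mulr2n; exact: lerD.
Qed.

End PairBound.

(** * Comparison of the transport at the heights [y] and [y + dl] *)

Section Core.
Context {R : realType}.
Implicit Types (x y t s : R).
Variables (T B dl k0 k1 z1 p q p' q' : R) (bb kap zeta : R -> R)
  (W : nat -> nat -> nat -> R * R * R -> R).

Definition X0W (z : R * R * R) : R := W 0%N 0%N 1%N z + bb z.1.2 * W 1%N 0%N 0%N z.

Hypotheses (T0 : 0 < T) (B0 : 0 <= B) (cW : cyl T W) (cbb : continuous bb).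
Hypothesis gB : pair_bound T X0W B.
Hypotheses (skap : smooth setT kap) (szeta : smooth setT zeta).
Hypotheses (dl0 : 0 < dl) (p0 : 0 < p) (pq : p <= q) (q1 : q + dl < 1).
Hypotheses (p'0 : dl < p') (pq' : p' <= q') (q'1 : q' < 1).
Hypothesis kap0 : forall y, ~~ (p <= y <= q) -> kap y = 0.
Hypothesis zeta0 : forall y, ~~ (p' <= y <= q') -> zeta y = 0.
Hypotheses (kapb : forall y, `|kap y| <= k0) (dkapb : forall y, `|derive1 kap y| <= k1).
Hypotheses (zetab : forall y, 0 <= zeta y <= 1) (dzetab : forall y, `|derive1 zeta y| <= z1).
Hypothesis zeta1 : forall y, kap y != 0 -> zeta y = 1 /\ zeta (y + dl) = 1.

Ltac slra := pose proof dl0; pose proof p0; pose proof pq; pose proof q1;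
  pose proof p'0; pose proof pq'; pose proof q'1; lra.

Local Notation n0 := (nrm T (W 0%N 0%N 0%N)).
Local Notation n1 := (nrm T (W 0%N 1%N 0%N)).

Let ckap : continuous kap. Proof. exact: smooth_continuous. Qed.
Let czeta : continuous zeta. Proof. exact: smooth_continuous. Qed.
Let c000 : continuous (W 0%N 0%N 0%N). Proof. by have [c _ _ _ _] := cW; exact: c. Qed.
Let c100 : continuous (W 1%N 0%N 0%N). Proof. by have [c _ _ _ _] := cW; exact: c. Qed.
Let c001 : continuous (W 0%N 0%N 1%N). Proof. by have [c _ _ _ _] := cW; exact: c. Qed.
Let cg : continuous X0W. Proof. by rewrite /X0W; cont. Qed.

Lemma X0W_periodic x y t : 0 < y < 1 -> 0 < t < T -> X0W (x + 1, y, t) = X0W (x, y, t).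
Proof. by have [_ pW _ _ _] := cW => y01 tT; rewrite /X0W /= !pW. Qed.

(* The odd time weight turns the two boundary terms into one energy integral. *)
Definition tauT (t : R) : R := 2 / T * t - 1.

Let ctau : continuous tauT. Proof. by rewrite /tauT; cont. Qed.

Lemma tauT_le1 t : 0 < t < T -> `|tauT t| <= 1.
Proof.
move=> /andP[t0 tT]; have h1 : 0 < t / T by rewrite divr_gt0.
have h2 : t / T < 1 by rewrite ltr_pdivrMr// mul1r.
have -> : tauT t = 2 * (t / T) - 1 by rewrite /tauT; ring.
by rewrite ler_norml; apply/andP; split; slra.
Qed.

Definition denergy (z : R * R * R) : R :=
  2 / T * (zeta z.1.2 * W 0%N 0%N 0%N z ^+ 2) +
  tauT z.2 * (zeta z.1.2 * (2 * W 0%N 0%N 0%N z * W 0%N 0%N 1%N z)).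

Let cden : continuous denergy. Proof. by rewrite /denergy; cont. Qed.

Lemma is_derive_sqr (u : R -> R) (x d : R) : is_derive x 1 u d ->
  is_derive x 1 (fun x => u x ^+ 2) (2 * u x * d).
Proof.
move=> du; have := is_deriveM du du; rewrite /GRing.scale /= => h.
rewrite (_ : (fun x => u x ^+ 2) = u \* u); last by apply/funext => s; rewrite expr2.
by apply: (is_derive_eq h); rewrite /GRing.scale /=; ring.
Qed.

Lemma denergy_derive x y t : 0 < t < T ->
  is_derive t 1 (fun t => tauT t * (zeta y * W 0%N 0%N 0%N (x, y, t) ^+ 2)) (denergy (x, y, t)).
Proof.
move=> tT; rewrite /denergy /=.
have [zy|zy] := eqVneq (zeta y) 0.
  rewrite zy !mul0r !mulr0 addr0.
  rewrite (_ : (fun t => _) = (fun=> 0)); first exact: is_derive_cst.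
  by apply/funext => s; rewrite mul0r mulr0.
have y01 : 0 < y < 1.
  by have /andP[? ?] := contra_neqT (zeta0 y) zy; apply/andP; split; slra.
have [_ _ _ _ dt] := cW.
have d1 := is_derive_sqr _ _ _ (dt 0%N 0%N 0%N x y t y01 tT).
have dtau : is_derive t 1 tauT (2 / T).
  by rewrite /tauT; apply: is_derive_eq; rewrite oppr0 addr0 /GRing.scale /= mulr1.
have := is_deriveM dtau (is_deriveZ (zeta y) d1); rewrite /GRing.scale /= => h.
by apply: (is_derive_eq h); rewrite /GRing.scale /=; ring.
Qed.

Lemma I3_zeta_sqr_le : I3 T (fun z => zeta z.1.2 * W 0%N 0%N 0%N z ^+ 2) <= n0 ^+ 2.
Proof.
rewrite sqr_nrm; apply: I3_le; [by cont..|move=> x y t _ _ _ /=].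
by rewrite -[leRHS]mul1r ler_wpM2r ?sqr_ge0//; have /andP[] := zetab y.
Qed.

(** Energy identity: [d_t W] is replaced by [X0W - bb d_x W]. The last term is an [x]-derivative
    after multiplication by [W] and integrates to 0, and the term in [X0W] is a pairing with weight
    [zeta] and no translation. The term with [2 / T] is the derivative of [tauT]. *)
Lemma energy_le : I3 T denergy <= 2 / T * n0 ^+ 2 + 2 * (B * (z1 * n0 + n1)).
Proof.
pose F z := tauT z.2 * (zeta z.1.2 * (bb z.1.2 * W 0%N 0%N 0%N z ^+ 2)).
pose dF z := tauT z.2 * (zeta z.1.2 * (bb z.1.2 * (2 * W 0%N 0%N 0%N z * W 1%N 0%N 0%N z))).
pose P z := X0W z * (tauT z.2 * (zeta z.1.2 * W 0%N 0%N 0%N (z.1.1, z.1.2 + 0, z.2))).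
pose Q z := zeta z.1.2 * W 0%N 0%N 0%N z ^+ 2.
have cF : continuous F by rewrite /F; cont.
have cdF : continuous dF by rewrite /dF; cont.
have cP : continuous P by rewrite /P; cont.
have cQ : continuous Q by rewrite /Q; cont.
have -> : I3 T denergy = I3 T (fun z => 2 / T * Q z + (2 * P z - dF z)).
  congr I3; apply/funext => -[[x y] t].
  by rewrite /denergy /P /Q /dF /X0W /= addr0; ring.
rewrite I3D; [|by cont..]; rewrite I3B; [|by cont..]; rewrite !I3Z//.
have -> : I3 T dF = 0.
  apply: (I3_dx F dF T cF cdF).
    by move=> x y t y01 tT; have [_ pW _ _ _] := cW; rewrite /F /= pW.
  move=> x y t y01 tT; have [_ _ dx _ _] := cW.
  have d1 := is_derive_sqr _ _ _ (dx 0%N 0%N 0%N x y t y01 tT).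
  have := is_deriveZ (tauT t) (is_deriveZ (zeta y) (is_deriveZ (bb y) d1)).
  by rewrite /GRing.scale.
rewrite subr0; apply: lerD.
  by apply: ler_wpM2l; [rewrite divr_ge0// ltW|exact: I3_zeta_sqr_le].
apply: ler_wpM2l => //; apply: le_trans (ler_norm _) _.
have := gB W tauT zeta 0 p' q' 1 z1 cW ctau tauT_le1 szeta.
rewrite mul1r; apply => //; [slra|rewrite addr0; slra|by rewrite addr0|].
by move=> y; have /andP[z0 zz] := zetab y; rewrite ger0_norm.
Qed.

Section Shifted.
Variable th : R.

Let wt i j k (z : R * R * R) := W i j k (z.1.1 + th, z.1.2 + dl, z.2).
Let k0_ge0 : 0 <= k0. Proof. exact: le_trans (kapb 0). Qed.

Lemma I3_denergy_shift :
  I3 T (fun z => denergy (z.1.1 + th, z.1.2 + dl, z.2)) = I3 T denergy.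
Proof.
rewrite -[RHS](I3_shift_x denergy T th) //; last first.
  by move=> x y t y01 tT; have [_ pW _ _ _] := cW; rewrite /denergy /= !pW.
apply: (I3_shift_y (fun z => denergy (z.1.1 + th, z.1.2, z.2)) T dl p' q'); [by cont|slra..|].
by move=> x y t /zeta0 zy; rewrite /denergy /= zy !mul0r !mulr0 addr0.
Qed.

(** The integrand is a [t]-derivative, so only the times 0 and [T] count. There the product is at
    most half the sum of the two squares, and [zeta] equals 1 at both heights wherever [kap] does
    not vanish. As [tauT] is [-1] at 0 and [1] at [T], the increment of [Z] is the sum of these
    bounds, which dominates either sign [s] of the increment of [X]. *)
Lemma boundary_le : `|I3 T (fun z => kap z.1.2 *
    (W 0%N 0%N 1%N z * wt 0%N 0%N 0%N z + W 0%N 0%N 0%N z * wt 0%N 0%N 1%N z))| <= k0 * I3 T denergy.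
Proof.
have [cW' pW dx dy dt] := cW.
pose X z := kap z.1.2 * (W 0%N 0%N 0%N z * wt 0%N 0%N 0%N z).
pose dX z := kap z.1.2 * (W 0%N 0%N 1%N z * wt 0%N 0%N 0%N z + W 0%N 0%N 0%N z * wt 0%N 0%N 1%N z).
have cX : continuous X by rewrite /X /wt; cont.
have cdX : continuous dX by rewrite /dX /wt; cont.
pose S z := tauT z.2 * (zeta z.1.2 * W 0%N 0%N 0%N z ^+ 2).
have cS : continuous S by rewrite /S; cont.
pose Z z := k0 / 2 * (S z + S (z.1.1 + th, z.1.2 + dl, z.2)).
pose dZ z := k0 / 2 * (denergy z + denergy (z.1.1 + th, z.1.2 + dl, z.2)).
have cZ : continuous Z by rewrite /Z; cont.
have cdZ : continuous dZ by rewrite /dZ; cont.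
have dZE : I3 T dZ = k0 * I3 T denergy.
  rewrite /dZ I3Z; last by cont.
  by rewrite I3D; [rewrite I3_denergy_shift; field|by cont..].
have Xd x y t : 0 < y < 1 -> 0 < t < T -> is_derive t 1 (fun t => X (x, y, t)) (dX (x, y, t)).
  move=> y01 tT; rewrite /X /dX /wt /=.
  have [ky|ky] := eqVneq (kap y) 0.
    rewrite ky mul0r (_ : (fun t => _) = (fun=> 0)); first exact: is_derive_cst.
    by apply/funext => s; rewrite mul0r.
  have /andP[yp yq] := contra_neqT (kap0 y) ky.
  have y01' : 0 < y + dl < 1 by slra.
  have := is_deriveZ (kap y) (is_deriveM (dt 0%N 0%N 0%N x y t y01 tT) (dt 0%N 0%N 0%N (x + th) (y + dl) t y01' tT)).
  by rewrite /GRing.scale /= => h; apply: (is_derive_eq h); rewrite /GRing.scale /=; ring.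
have Zd x y t : 0 < y < 1 -> 0 < t < T -> is_derive t 1 (fun t => Z (x, y, t)) (dZ (x, y, t)).
  move=> y01 tT; rewrite /Z /dZ.
  by have := is_deriveZ (k0 / 2) (is_deriveD (denergy_derive x y t tT) (denergy_derive (x + th) (y + dl) t tT)).
have tauT1 : tauT T = 1 by rewrite /tauT divfK ?gt_eqF//; slra.
have tauT0 : tauT 0 = -1 by rewrite /tauT mulr0 sub0r.
have XZ x y t : `|X (x, y, t)| <= k0 / 2 * (zeta y * W 0%N 0%N 0%N (x, y, t) ^+ 2 +
     zeta (y + dl) * W 0%N 0%N 0%N (x + th, y + dl, t) ^+ 2).
  rewrite /X /wt /=; set u := W _ _ _ (x, _, _); set v := W _ _ _ (x + th, _, _).
  have [ky|ky] := eqVneq (kap y) 0.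
    rewrite ky mul0r normr0 mulr_ge0 ?divr_ge0// addr_ge0// mulr_ge0 ?sqr_ge0//.
      by have /andP[] := zetab y.
    by have /andP[] := zetab (y + dl).
  have [-> ->] := zeta1 y ky; rewrite !mul1r normrM.
  apply: (@le_trans _ _ (k0 * `|u * v|)); first by apply: ler_wpM2r.
  rewrite -mulrA; apply: ler_wpM2l => //.
  have h1 := sqr_ge0 (u - v); have h2 := sqr_ge0 (u + v).
  rewrite sqrrB -mulr_natl in h1; rewrite sqrrD -mulr_natl in h2.
  by rewrite ler_norml; apply/andP; split; slra.
have bnd s : `|s| = 1 -> s * I3 T dX <= k0 * I3 T denergy.
  move=> s1; rewrite -I3Z// -dZE.
  apply: (I3_le_dt (fun z => s * X z) (fun z => s * dX z) Z dZ) => //; [by cont|by cont| |].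
    move=> x y t y01 tT; have := is_deriveZ s (Xd x y t y01 tT); by rewrite /GRing.scale.
  move=> x y y01.
  have e : s * X (x, y, T) - s * X (x, y, 0) <= `|X (x, y, T)| + `|X (x, y, 0)|.
    rewrite -mulrBr; apply: (le_trans (ler_norm _)); rewrite normrM s1 mul1r.
    exact: ler_normB.
  apply: (le_trans e); apply: (le_trans (lerD (XZ x y T) (XZ x y 0))).
  rewrite /Z /S /= tauT1 tauT0 le_eqVlt; apply/orP; left; apply/eqP; ring.
rewrite ler_norml; apply/andP; split.
  by have := bnd (-1) (normrN1 _); rewrite mulN1r lerNl.
by have := bnd 1 (normr1 _); rewrite mul1r.
Qed.

Definition coreL : R :=
  2 * (B * (k1 * n0 + k0 * n1)) + k0 * (2 / T * n0 ^+ 2 + 2 * (B * (z1 * n0 + n1))).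

(** Let [W~] denote [W] translated by [(th, dl)]. Then [X0W W~ + W (X0W)~] equals
    [d_t (W W~) + bb(y) d_x (W W~)] plus [(bb(y + dl) - bb(y)) W (d_x W)~]: the last term is the
    commutator of transport and vertical translation. Multiplied by [kap] and integrated, these are
    [P1], [P2], [P3], [P4] and the quantity to bound. *)
Lemma transport_le :
  `|I3 T (fun z => kap z.1.2 * (bb (z.1.2 + dl) - bb z.1.2) *
      (W 0%N 0%N 0%N z * wt 1%N 0%N 0%N z))| <= coreL.
Proof.
have [cW' pW dx dy dt] := cW.
pose P1 z := X0W z * (1 * (kap z.1.2 * (shiftx th W) 0%N 0%N 0%N (z.1.1, z.1.2 + dl, z.2))).
(* The pairing bound wants [X0W] untranslated, so the second product is written as a translate of
   [F2], whose weight is supported in [[p + dl, q + dl]]. *)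
pose F2 z := X0W z * (1 * (kap (z.1.2 - dl) * (shiftx (- th) W) 0%N 0%N 0%N (z.1.1, z.1.2 - dl, z.2))).
pose P2 z := F2 (z.1.1 + th, z.1.2 + dl, z.2).
pose P3 z := kap z.1.2 * (W 0%N 0%N 1%N z * wt 0%N 0%N 0%N z + W 0%N 0%N 0%N z * wt 0%N 0%N 1%N z).
pose F4 z := kap z.1.2 * bb z.1.2 * (W 0%N 0%N 0%N z * wt 0%N 0%N 0%N z).
pose P4 z := kap z.1.2 * bb z.1.2 * (W 1%N 0%N 0%N z * wt 0%N 0%N 0%N z + W 0%N 0%N 0%N z * wt 1%N 0%N 0%N z).
have c1 : continuous P1 by rewrite /P1 /shiftx /=; cont.
have c2 : continuous F2 by rewrite /F2 /shiftx /=; cont.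
have c2' : continuous P2 by rewrite /P2; cont.
have c3 : continuous P3 by rewrite /P3 /wt; cont.
have c4 : continuous F4 by rewrite /F4 /wt; cont.
have c4' : continuous P4 by rewrite /P4 /wt; cont.
have -> : I3 T (fun z => kap z.1.2 * (bb (z.1.2 + dl) - bb z.1.2) *
      (W 0%N 0%N 0%N z * wt 1%N 0%N 0%N z)) = I3 T (fun z => P1 z + P2 z - P3 z - P4 z).
  congr I3; apply/funext => -[[x y] t].
  by rewrite /P1 /P2 /F2 /P3 /P4 /shiftx /X0W /wt /= !addrK; ring.
rewrite I3B; [|by cont..]; rewrite I3B; [|by cont..]; rewrite I3D//.
have -> : I3 T P4 = 0.
  apply: (I3_dx F4 P4) => // x y t y01 tT.
    rewrite /F4 /wt /= pW//.
    have [ky|ky] := eqVneq (kap y) 0; first by rewrite ky !mul0r.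
    have /andP[yp yq] := contra_neqT (kap0 y) ky.
    by rewrite addrAC pW//; slra.
  rewrite /F4 /P4 /wt /=.
  have [ky|ky] := eqVneq (kap y) 0.
    rewrite ky !mul0r (_ : (fun t => _) = (fun=> 0)); first exact: is_derive_cst.
    by apply/funext => s; rewrite !mul0r.
  have /andP[yp yq] := contra_neqT (kap0 y) ky.
  have y01' : 0 < y + dl < 1 by slra.
  have d2 := is_derive_comp_shift (fun x => W 0%N 0%N 0%N (x, y + dl, t)) th x _ (dx 0%N 0%N 0%N (x + th) (y + dl) t y01' tT).
  have := is_deriveZ (kap y * bb y) (is_deriveM (dx 0%N 0%N 0%N x y t y01 tT) d2).
  by rewrite /GRing.scale /= => h; apply: (is_derive_eq h); rewrite /GRing.scale /=; ring.
have b1 : `|I3 T P1| <= B * (k1 * n0 + k0 * n1).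
  have := gB (shiftx th W) (fun=> 1) kap dl p q k0 k1 (cyl_shiftx _ _ _ cW).
  rewrite !nrm_shiftx//; apply => //; [by cont|by move=> *; rewrite normr1|slra|slra].
have b2 : `|I3 T P2| <= B * (k1 * n0 + k0 * n1).
  have -> : I3 T P2 = I3 T F2.
    rewrite -[RHS](I3_shift_x F2 T th) //; last first.
      move=> x y t y01 tT; rewrite /F2 X0W_periodic//; congr (_ * _).
      have [ky|ky] := eqVneq (kap (y - dl)) 0; first by rewrite /= ky !mul0r.
      have /andP[yp yq] := contra_neqT (kap0 _) ky.
      by rewrite /shiftx /= addrAC pW//; slra.
    apply: (I3_shift_y (fun z => F2 (z.1.1 + th, z.1.2, z.2)) T dl (p + dl) (q + dl)); [by cont|slra..|].
    move=> x y t hy; rewrite /F2 /= kap0 ?mul0r ?mulr0//.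
    by apply/negP => ?; move/negP: hy; apply; slra.
  have := gB (shiftx (- th) W) (fun=> 1) (fun y => kap (y - dl)) (- dl) (p + dl) (q + dl) k0 k1 (cyl_shiftx _ _ _ cW).
  have skap' : smooth setT (fun y => kap (y - dl)).
    move=> m; apply: (nderivable_comp m setT setT kap (fun y => y - dl)) => //; first exact: openT.
    rewrite (_ : (fun y => y - dl) = (fun y => 1 * y + - dl)); last by apply/funext => y; rewrite mul1r.
    by apply: smooth_affine; exact: openT.
  rewrite !nrm_shiftx//; apply => //; [by cont|by move=> *; rewrite normr1|slra|slra|slra|slra| |].
  - by move=> y hy; apply: kap0; apply/negP => ?; move/negP: hy; apply; slra.
  - move=> y; have := is_derive_comp_shift kap (- dl) y _ (smooth_is_derive kap (y - dl) skap).
    by move=> h; rewrite derive1E (@derive_val _ _ _ _ _ _ _ h).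
have b3 := boundary_le; have e := energy_le.
have e' : k0 * I3 T denergy <= k0 * (2 / T * n0 ^+ 2 + 2 * (B * (z1 * n0 + n1))) by exact: ler_wpM2l.
rewrite subr0; apply: (le_trans (ler_normB _ _)).
have := ler_normD (I3 T P1) (I3 T P2).
rewrite /coreL; move: b3; rewrite -/P3; slra.
Qed.

End Shifted.

End Core.

(** * Integration in the translation parameter *)

Section Integrate.
Context {R : realType}.
Implicit Types (x y t s : R).

(** [e] is the derivative of [E] in a quantitative sense. Over [m + 1] equal steps the quadratic
    remainders add up to [C h^2 / (m + 1)], which is arbitrarily small. This avoids both
    differentiation under the integral and an integral in the parameter. *)
Lemma telescope_lipschitz (E e : R -> R) (L C h : R) : 0 <= h -> 0 <= C ->
  (forall x y, 0 <= x <= h -> 0 <= y <= h -> `|E y - E x - (y - x) * e x| <= C * (y - x) ^+ 2) ->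
  (forall x, `|e x| <= L) -> `|E h - E 0| <= h * L.
Proof.
move=> h0 C0 EE eL; apply/ler_addgt0Pr => r r0.
have [m hm] : exists m : nat, C * h ^+ 2 / m.+1%:R <= r.
  exists (Num.truncn (C * h ^+ 2 / r)).
  rewrite ler_pdivrMr// -ler_pdivrMl// [_^-1 * _]mulrC.
  by apply/ltW; apply: truncnS_gt.
pose d := h / m.+1%:R.
have m0 : 0 < m.+1%:R :> R by [].
have d0 : 0 <= d by rewrite divr_ge0.
have dh : d * m.+1%:R = h by rewrite divfK// gt_eqF.
have key k : (k <= m.+1)%N -> `|E (k%:R * d) - E 0| <= k%:R * (d * L + C * d ^+ 2).
  elim: k => [|k IH] km; first by rewrite !mul0r subrr normr0.
  have le1 : k.+1%:R * d <= h by rewrite -dh mulrC ler_wpM2l// ler_nat.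
  have le0 : k%:R * d <= k.+1%:R * d by rewrite ler_wpM2r// ler_nat.
  have kd0 : 0 <= k%:R * d by rewrite mulr_ge0.
  have e1 : k.+1%:R * d - k%:R * d = d by rewrite -natr1; ring.
  have hx : 0 <= k%:R * d <= h by apply/andP; split => //; exact: le_trans le1.
  have hy : 0 <= k.+1%:R * d <= h by apply/andP; split => //; exact: le_trans le0.
  have b1 : `|E (k.+1%:R * d) - E (k%:R * d) - d * e (k%:R * d)| <= C * d ^+ 2.
    by have := EE _ _ hx hy; rewrite e1.
  have b2 : `|d * e (k%:R * d)| <= d * L by rewrite normrM (ger0_norm d0) ler_wpM2l.
  have b3 := IH (ltnW km).
  rewrite (_ : _ - E 0 = (E (k.+1%:R * d) - E (k%:R * d) - d * e (k%:R * d)) +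
    d * e (k%:R * d) + (E (k%:R * d) - E 0)); last by ring.
  apply: (le_trans (ler_normD _ _)); apply: (le_trans (lerD (ler_normD _ _) (lexx _))).
  have -> : k.+1%:R * (d * L + C * d ^+ 2) = C * d ^+ 2 + d * L + k%:R * (d * L + C * d ^+ 2).
    by rewrite -natr1; ring.
  by rewrite lerD// lerD.
have := key m.+1 (leqnn _); rewrite mulrC dh => /le_trans; apply.
have -> : m.+1%:R * (d * L + C * d ^+ 2) = (d * m.+1%:R) * L + C * h ^+ 2 / m.+1%:R.
  by rewrite /d; field; rewrite gt_eqF.
by rewrite dh lerD2l.
Qed.

Lemma taylor1_le (u u' u'' : R -> R) (M a b : R) :
  (forall x : R, is_derive x 1 u (u' x)) -> (forall x : R, is_derive x 1 u' (u'' x)) ->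
  (forall x, Num.min a b <= x <= Num.max a b -> `|u'' x| <= M) ->
  `|u b - u a - (b - a) * u' a| <= M * (b - a) ^+ 2.
Proof.
move=> du du' uM.
have [x [x1 x2 Ex]] := MVT_between u u' a b du.
have [z [z1 z2 Ez]] := MVT_between u' u'' a x du'.
have -> : u b - u a - (b - a) * u' a = (b - a) * (u' x - u' a) by rewrite Ex; ring.
have xa : `|x - a| <= `|b - a|.
  move: x1 x2; case: (leP a b) => ab x1 x2.
    by rewrite !ger0_norm; lra.
  by rewrite !ler0_norm; lra.
have zab : Num.min a b <= z <= Num.max a b.
  by move: z1 z2 x1 x2; case: (leP a b) => ab; case: (leP a x) => ax; move=> *; apply/andP; split; lra.
rewrite Ez normrM normrM -[(b - a) ^+ 2]real_normK ?num_real// mulrCA.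
rewrite ler_pM ?mulr_ge0// ?uM// expr2 ler_wpM2l//.
Qed.

Lemma I3_abs_le T (F G : R * R * R -> R) : continuous F -> continuous G ->
  (forall x y t, 0 <= x < 1 -> 0 < y < 1 -> 0 < t < T -> `|F (x, y, t)| <= G (x, y, t)) ->
  `|I3 T F| <= I3 T G.
Proof.
move=> cF cG FG; rewrite ler_norml; apply/andP; split.
  rewrite lerNl -I3N//; apply: I3_le; [by cont..|move=> x y t x1 y1 tT].
  by apply: le_trans (FG x y t x1 y1 tT); rewrite -normrN ler_norm.
apply: I3_le; [by cont..|move=> x y t x1 y1 tT].
by apply: le_trans (FG x y t x1 y1 tT); rewrite ler_norm.
Qed.

(** [x] runs up to 2 because increments of length at most 1 start from points of [[0, 1[]. *)
Lemma continuous_bounded_box (F : R * R * R -> R) T : continuous F ->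
  exists2 M : R, 0 <= M & forall x y t, 0 <= x <= 2 -> 0 <= y <= 1 -> 0 <= t <= T ->
    `|F (x, y, t)| <= M.
Proof.
move=> cF.
have : compact ((`[0, 2] `*` `[0, 1]) `*` `[0, T] : set (R * R * R)).
  by apply: compact_setX; [apply: compact_setX|]; exact: segment_compact.
move/(@continuous_compact _ _ F) => /(_ (continuous_subspaceT cF)) /compact_bounded.
move=> [M [Mr hM]]; exists (`|M| + 1); first by rewrite addr_ge0.
move=> x y t x2 y1 tT; apply: (hM (`|M| + 1)).
  by rewrite (le_lt_trans (ler_norm _))// ltrDl.
by exists (x, y, t) => //=; rewrite !in_itv.
Qed.

Variables (T dl d1 L p q h : R) (bb kap : R -> R)
  (W : nat -> nat -> nat -> R * R * R -> R).
Let D y := bb (y + dl) - bb y.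
Hypotheses (T0 : 0 < T) (cW : cyl T W) (cbb : continuous bb) (ckap : continuous kap).
Hypotheses (dl0 : 0 < dl) (p0 : 0 < p) (pq : p <= q) (q1 : q + dl < 1) (h01 : 0 <= h <= 1).
Hypothesis kap0 : forall y, ~~ (p <= y <= q) -> kap y = 0.
Hypothesis kapD : forall y, 0 <= kap y * D y <= d1.
Hypothesis tr : forall th, `|I3 T (fun z => kap z.1.2 * D z.1.2 *
      (W 0%N 0%N 0%N z * W 1%N 0%N 0%N (z.1.1 + th, z.1.2 + dl, z.2)))| <= L.

Local Notation w := (W 0%N 0%N 0%N).
Local Notation v := (diffx h W 0%N 0%N 0%N).

Let cw : continuous w. Proof. by have [c _ _ _ _] := cW; exact: c. Qed.
Let cwx : continuous (W 1%N 0%N 0%N). Proof. by have [c _ _ _ _] := cW; exact: c. Qed.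
Let cv : continuous v. Proof. by have [c _ _ _ _] := cyl_diffx T h W cW; exact: c. Qed.
Let cD : continuous D. Proof. by rewrite /D; cont. Qed.

(** With [E th] the correlation of [w] with its translate by [(th, dl)], the integral is
    [E h - E 0], and the derivative of [E] is the integral bounded by [L]. The remainder uses a
    bound [M] on the second [x]-derivative, which does not enter the result. *)
Lemma increment_le : `|I3 T (fun z => kap z.1.2 * D z.1.2 *
    (w z * v (z.1.1, z.1.2 + dl, z.2)))| <= h * L.
Proof.
pose E th := I3 T (fun z => kap z.1.2 * D z.1.2 * (w z * w (z.1.1 + th, z.1.2 + dl, z.2))).
pose e th := I3 T (fun z => kap z.1.2 * D z.1.2 *
      (w z * W 1%N 0%N 0%N (z.1.1 + th, z.1.2 + dl, z.2))).
have [cW' pW dx _ _] := cW.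
have [M M0 hM] := continuous_bounded_box (W 2%N 0%N 0%N) T (cW' 2%N 0%N 0%N).
pose G := I3 T (fun z => d1 * (w z ^+ 2 + 1)).
have cG : continuous (fun z => d1 * (w z ^+ 2 + 1)) by cont.
have d10 : 0 <= d1 by have /andP[] := kapD 0; exact: le_trans.
have G0 : 0 <= G.
  by apply: I3_ge0 => z; rewrite mulr_ge0// addr_ge0// sqr_ge0.
have -> : I3 T (fun z => kap z.1.2 * D z.1.2 * (w z * v (z.1.1, z.1.2 + dl, z.2))) = E h - E 0.
  rewrite /E -I3B; [|by cont..]; congr I3; apply/funext => z.
  by rewrite /diffx /= addr0; ring.
have /andP[h0 h1] := h01.
apply: (telescope_lipschitz E e L (G * M)) => //; first by rewrite mulr_ge0.
move=> x s /andP[x0 xh] /andP[s0 sh].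
have -> : E s - E x - (s - x) * e x = I3 T (fun z => kap z.1.2 * D z.1.2 * (w z *
    (w (z.1.1 + s, z.1.2 + dl, z.2) - w (z.1.1 + x, z.1.2 + dl, z.2) -
     (s - x) * W 1%N 0%N 0%N (z.1.1 + x, z.1.2 + dl, z.2)))).
  rewrite /E /e -I3Z; last by cont.
  rewrite -I3B; [|by cont..]; rewrite -I3B; [|by cont..]; congr I3; apply/funext => z.
  by ring.
have -> : G * M * (s - x) ^+ 2 = I3 T (fun z => M * (s - x) ^+ 2 * (d1 * (w z ^+ 2 + 1))).
  by rewrite I3Z// -/G; ring.
apply: I3_abs_le; [by cont|by cont|move=> u y t /andP[u0 u1] /andP[y0 y1] tT /=].
have [ky|ky] := eqVneq (kap y) 0.
  rewrite ky !mul0r normr0; apply: mulr_ge0; first by rewrite mulr_ge0// sqr_ge0.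
  by rewrite mulr_ge0// addr_ge0// sqr_ge0.
have /andP[py yq] := contra_neqT (kap0 y) ky.
have ydl : 0 < y + dl < 1 by apply/andP; pose proof p0; pose proof q1; pose proof dl0; split; lra.
have tay : `|w (u + s, y + dl, t) - w (u + x, y + dl, t) -
     (s - x) * W 1%N 0%N 0%N (u + x, y + dl, t)| <= M * (s - x) ^+ 2.
  have := taylor1_le (fun r => w (r, y + dl, t)) (fun r => W 1%N 0%N 0%N (r, y + dl, t))
    (fun r => W 2%N 0%N 0%N (r, y + dl, t)) M (u + x) (u + s).
  rewrite (_ : u + s - (u + x) = s - x); last by ring.
  apply.
  - by move=> r; exact: dx.
  - by move=> r; exact: dx.
  - move=> r; have /andP[y3 y4] := ydl; have /andP[t0 tT'] := tT.
    by case: (leP (u + x) (u + s)) => _ /andP[r1 r2]; apply: hM; apply/andP; split; lra.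
rewrite !normrM; have /andP[k1 k2] := kapD y.
rewrite -(normrM (kap y)) (ger0_norm k1).
have wle : `|w (u, y, t)| <= w (u, y, t) ^+ 2 + 1.
  have := sqr_ge0 (`|w (u, y, t)| - 1); rewrite sqrrB expr1n mulr1 real_normK ?num_real//.
  have := normr_ge0 (w (u, y, t)); rewrite -mulr_natl; lra.
rewrite mulrA [leRHS]mulrC; apply: ler_pM => //; first by rewrite mulr_ge0.
by apply: ler_pM.
Qed.

(** Since [v = w(x + h) - w], one has [v^2 = (w(x + h)^2 - w^2) - 2 w v]. The bracket integrates to
    0 by periodicity, and in [w v] the factor [v] is replaced by its translate by [dl] in [y], for
    [increment_le], the error [r] being an increment controlled by the [y]-derivative of [v]. *)
Lemma core_le : I3 T (fun z => kap z.1.2 * D z.1.2 * v z ^+ 2) <=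
  2 * (h * L) + 2 * (d1 * dl * nrm T w * nrm T (diffx h W 0%N 1%N 0%N)).
Proof.
have cyv := cyl_diffx T h W cW.
have [cv' _ _ dvy _] := cyv; have [cW' pW dx _ _] := cW.
have d10 : 0 <= d1 by have /andP[] := kapD 0; exact: le_trans.
pose K z : R := kap z.1.2 * D z.1.2.
have cK : continuous (fun z : R * R * R => kap z.1.2 * D z.1.2) by cont.
pose r z := kap z.1.2 * D z.1.2 * (v (z.1.1, z.1.2 + dl, z.2) - v (z.1.1, z.1.2, z.2)).
have cr : continuous r by rewrite /r; cont.
pose P z := kap z.1.2 * D z.1.2 * (w z * v (z.1.1, z.1.2 + dl, z.2)).
have cP : continuous P by rewrite /P; cont.
pose S z := kap z.1.2 * D z.1.2 * w z ^+ 2.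
have cS : continuous S by rewrite /S; cont.
have -> : I3 T (fun z => kap z.1.2 * D z.1.2 * v z ^+ 2) =
    2 * (- I3 T P) + 2 * I3 T (fun z => w z * r z) +
    (I3 T (fun z => S (z.1.1 + h, z.1.2, z.2)) - I3 T S).
  rewrite -I3N// -!I3Z; [|by cont..]; rewrite -I3D; [|by cont..].
  rewrite -I3B; [|by cont..]; rewrite -I3D; [|by cont..].
  by congr I3; apply/funext => -[[x y] t]; rewrite /P /r /S /diffx /=; ring.
rewrite I3_shift_x//; last first.
  by move=> x y t y01 tT; rewrite /S /= pW.
rewrite subrr addr0; apply: lerD.
  apply: ler_wpM2l => //; apply: le_trans increment_le.
  by rewrite -normrN ler_norm.
apply: ler_wpM2l => //; apply: (le_trans (I3_cauchy_schwarz T w r cw cr)).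
have -> : d1 * dl * nrm T w * nrm T (diffx h W 0%N 1%N 0%N) =
  nrm T w * (d1 * dl * nrm T (diffx h W 0%N 1%N 0%N)) by ring.
apply: ler_wpM2l; first exact: nrm_ge0.
apply: nrm_le; first by rewrite !mulr_ge0 ?nrm_ge0// ltW.
have cm : continuous (fun y => (kap y * D y) ^+ 2) by cont.
rewrite !exprMn sqr_nrm.
have -> : (fun z => r z ^+ 2) = (fun z => (kap z.1.2 * D z.1.2) ^+ 2 *
    (v (z.1.1, z.1.2 + dl, z.2) - v (z.1.1, z.1.2, z.2)) ^+ 2).
  by apply/funext => z; rewrite /r exprMn.
pose proof p0; pose proof pq; pose proof q1; pose proof dl0.
apply: (I3_increment_le (fun y => (kap y * D y) ^+ 2) v (diffx h W 0%N 1%N 0%N) T dl (d1 ^+ 2) p q) => //; try lra.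
- move=> y; rewrite sqr_ge0 /=; have /andP[k1 k2] := kapD y.
  by rewrite ler_sqr ?nnegrE.
- by move=> y _ /kap0 ->; rewrite mul0r expr0n.
Qed.

End Integrate.

(** * From a degenerate weight to the full [L^2] norm *)

Section Cover.
Context {R : realType}.
Implicit Types (x y t s : R).

(** Where [m0 y] is small, [m0 (y + s)] is not, and [V(y)^2] is at most
    [2 V(y + s)^2 + 2 (V(y + s) - V(y))^2]; the increment costs [s ^ 2] times the norm of the
    [y]-derivative. *)
Lemma cover_half T (V : nat -> nat -> nat -> R * R * R -> R) (m m0 : R -> R) (d0 s lo hi : R) :
  cyl T V -> continuous m -> continuous m0 -> 0 < d0 ->
  0 <= lo -> lo <= hi -> hi <= 1 -> 0 <= lo + s -> hi + s <= 1 ->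
  (forall y, 0 <= m y <= 1) -> (forall y, 0 <= y <= 1 -> ~~ (lo <= y <= hi) -> m y = 0) ->
  (forall y, 0 <= m0 y) ->
  (forall y, 0 < y < 1 -> lo <= y <= hi -> d0 <= m0 y \/ d0 <= m0 (y + s)) ->
  d0 * I3 T (fun z => m z.1.2 * V 0%N 0%N 0%N z ^+ 2) <=
  I3 T (fun z => m z.1.2 * (m0 z.1.2 * V 0%N 0%N 0%N z ^+ 2)) +
  2 * I3 T (fun z => m0 z.1.2 * V 0%N 0%N 0%N z ^+ 2) +
  2 * d0 * s ^+ 2 * nrm T (V 0%N 1%N 0%N) ^+ 2.
Proof.
move=> cV cm cm0 d00 lo0 lohi hi1 los his m01 mz m00 good.
have [cV' _ _ dy _] := cV; have cv := cV' 0%N 0%N 0%N; have cvy := cV' 0%N 1%N 0%N.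
pose H z := m0 z.1.2 * V 0%N 0%N 0%N z ^+ 2.
have cH : continuous H by rewrite /H; cont.
pose P1 z := m z.1.2 * H z.
pose P2 z := m z.1.2 * H (z.1.1, z.1.2 + s, z.2).
pose P3 z := m z.1.2 * (V 0%N 0%N 0%N (z.1.1, z.1.2 + s, z.2) - V 0%N 0%N 0%N (z.1.1, z.1.2, z.2)) ^+ 2.
have c1 : continuous P1 by rewrite /P1; cont.
have c2 : continuous P2 by rewrite /P2; cont.
have c3 : continuous P3 by rewrite /P3; cont.
have cl : continuous (fun z : R * R * R => m z.1.2 * V 0%N 0%N 0%N z ^+ 2) by cont.
have b2 : I3 T P2 <= 1 * I3 T H.
  apply: (I3_weighted_shift_le m H T s 1 lo hi) => //.
  by move=> z; rewrite mulr_ge0// sqr_ge0.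
have b3 : I3 T P3 <= 1 * s ^+ 2 * I3 T (fun z => V 0%N 1%N 0%N z ^+ 2).
  by apply: (I3_increment_le m (V 0%N 0%N 0%N) (V 0%N 1%N 0%N) T s 1 lo hi) => // x y t y01 tT; exact: dy.
have key : d0 * I3 T (fun z => m z.1.2 * V 0%N 0%N 0%N z ^+ 2) <=
    I3 T (fun z => P1 z + (2 * P2 z + 2 * d0 * P3 z)).
  rewrite -I3Z//; apply: I3_le; [by cont..|move=> x y t _ y01 tT].
  rewrite /P1 /P2 /P3 /H /=; set u := V _ _ _ (x, y, t); set u' := V _ _ _ (x, y + s, t).
  have [yl|yl] := boolP (lo <= y <= hi); last first.
    by rewrite mz// ?mul0r ?mulr0 ?addr0//; have /andP[? ?] := y01; apply/andP; split; exact: ltW.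
  have /andP[my _] := m01 y.
  have n1 := m00 y; have n2 := m00 (y + s).
  have -> : m y * (m0 y * u ^+ 2) + (2 * (m y * (m0 (y + s) * u' ^+ 2)) + 2 * d0 * (m y * (u' - u) ^+ 2)) =
     m y * (m0 y * u ^+ 2 + 2 * (m0 (y + s) * u' ^+ 2) + 2 * d0 * (u' - u) ^+ 2) by ring.
  rewrite mulrCA; apply: ler_wpM2l => //.
  have s1 := sqr_ge0 u; have s2 := sqr_ge0 u'; have s3 := sqr_ge0 (u' - u).
  have p1 := mulr_ge0 n1 s1; have p2 := mulr_ge0 n2 s2; have p3 := mulr_ge0 (ltW d00) s3.
  case: (good y y01 yl) => gd.
    have : d0 * u ^+ 2 <= m0 y * u ^+ 2 by rewrite ler_wpM2r.
    lra.
  have h1 : d0 * u' ^+ 2 <= m0 (y + s) * u' ^+ 2 by rewrite ler_wpM2r.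
  have h2 : d0 * u ^+ 2 <= 2 * (d0 * u' ^+ 2) + 2 * (d0 * (u' - u) ^+ 2).
    have -> : 2 * (d0 * u' ^+ 2) + 2 * (d0 * (u' - u) ^+ 2) =
      d0 * u ^+ 2 + d0 * (2 * u' - u) ^+ 2 by ring.
    by rewrite lerDl mulr_ge0 ?sqr_ge0// ltW.
  lra.
apply: (le_trans key).
rewrite I3D; [|by cont..]; rewrite I3D; [|by cont..]; rewrite !I3Z//.
rewrite sqr_nrm mul1r in b3 *; rewrite mul1r in b2.
have : d0 * I3 T P3 <= d0 * (s ^+ 2 * I3 T (fun z => V 0%N 1%N 0%N z ^+ 2)) by rewrite ler_pM2l.
have -> : 2 * d0 * s ^+ 2 * I3 T (fun z => V 0%N 1%N 0%N z ^+ 2) =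
  2 * (d0 * (s ^+ 2 * I3 T (fun z => V 0%N 1%N 0%N z ^+ 2))) by ring.
have -> : 2 * d0 * I3 T P3 = 2 * (d0 * I3 T P3) by ring.
rewrite -/P1 -/H; lra.
Qed.

Lemma cover_two_sided T (V : nat -> nat -> nat -> R * R * R -> R) (m0 : R -> R) (d0 a : R) :
  cyl T V -> continuous m0 -> 0 < d0 -> 0 <= a -> a <= 4^-1 ->
  (forall y, 0 <= m0 y) ->
  (forall y, 0 < y <= 3 / 4 -> d0 <= m0 y \/ d0 <= m0 (y + a)) ->
  (forall y, 4^-1 <= y < 1 -> d0 <= m0 y \/ d0 <= m0 (y - a)) ->
  d0 * nrm T (V 0%N 0%N 0%N) ^+ 2 <=
  5 * I3 T (fun z => m0 z.1.2 * V 0%N 0%N 0%N z ^+ 2) +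
  4 * d0 * a ^+ 2 * nrm T (V 0%N 1%N 0%N) ^+ 2.
Proof.
move=> cV cm0 d00 a0 a4 m00 gl gr.
have [cV' _ _ dy _] := cV; have cv := cV' 0%N 0%N 0%N.
(* A partition of unity: [m1] vanishes above 3/4 and [1 - m1] below 1/4. The lower part is
   translated upwards and the upper part downwards, which stays in [[0, 1]] because [a <= 1/4]. *)
pose m1 (y : R) : R := clamp 1 (3 / 2 - 2 * y).
pose m2 y : R := 1 - m1 y.
have cc := @continuous_clamp R 1.
have c1 : continuous m1 by rewrite /m1; cont.
have c2 : continuous m2 by rewrite /m2; cont.
have cl y : 0 <= m1 y <= 1 by apply: clamp_itv.
have h1 := cover_half T V m1 m0 d0 a 0 (3 / 4) cV c1 cm0 d00.
have h2 := cover_half T V m2 m0 d0 (- a) (4^-1) 1 cV c2 cm0 d00.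
have {}h1 : d0 * I3 T (fun z => m1 z.1.2 * V 0%N 0%N 0%N z ^+ 2) <=
  I3 T (fun z => m1 z.1.2 * (m0 z.1.2 * V 0%N 0%N 0%N z ^+ 2)) +
  2 * I3 T (fun z => m0 z.1.2 * V 0%N 0%N 0%N z ^+ 2) +
  2 * d0 * a ^+ 2 * nrm T (V 0%N 1%N 0%N) ^+ 2.
  apply: h1 => //; try lra.
  - move=> y /andP[y0 y1] hy; rewrite /m1.
    have y34 : 3 / 4 < y by move: hy; rewrite y0 /= -ltNge.
    rewrite /clamp; rewrite [`|3 / 2 - 2 * y|]ler0_norm; last by lra.
    by rewrite ler0_norm; lra.
  - by move=> y /andP[y0 _] /andP[_ y1]; apply: gl; rewrite y0.
have {}h2 : d0 * I3 T (fun z => m2 z.1.2 * V 0%N 0%N 0%N z ^+ 2) <=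
  I3 T (fun z => m2 z.1.2 * (m0 z.1.2 * V 0%N 0%N 0%N z ^+ 2)) +
  2 * I3 T (fun z => m0 z.1.2 * V 0%N 0%N 0%N z ^+ 2) +
  2 * d0 * a ^+ 2 * nrm T (V 0%N 1%N 0%N) ^+ 2.
  rewrite -[a ^+ 2]sqrrN; apply: h2 => //; try lra.
  - by move=> y; have /andP[? ?] := cl y; rewrite /m2; apply/andP; split; lra.
  - move=> y /andP[y0 y1] hy; rewrite /m2 /m1.
    have y14 : y < 4^-1 by move: hy; rewrite y1 andbT -ltNge.
    rewrite /clamp; rewrite [`|3 / 2 - 2 * y|]ger0_norm; last by lra.
    by rewrite ger0_norm; lra.
  - by move=> y /andP[_ y1] /andP[y0 _]; apply: gr; rewrite y0.
have e1 : nrm T (V 0%N 0%N 0%N) ^+ 2 = I3 T (fun z => m1 z.1.2 * V 0%N 0%N 0%N z ^+ 2) +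
    I3 T (fun z => m2 z.1.2 * V 0%N 0%N 0%N z ^+ 2).
  rewrite sqr_nrm -I3D; [|by cont..]; congr I3; apply/funext => z; rewrite /m2; ring.
have e2 : I3 T (fun z => m0 z.1.2 * V 0%N 0%N 0%N z ^+ 2) =
    I3 T (fun z => m1 z.1.2 * (m0 z.1.2 * V 0%N 0%N 0%N z ^+ 2)) +
    I3 T (fun z => m2 z.1.2 * (m0 z.1.2 * V 0%N 0%N 0%N z ^+ 2)).
  rewrite -I3D; [|by cont..]; congr I3; apply/funext => z; rewrite /m2; ring.
rewrite e1 mulrDr.
have -> : 4 * d0 * a ^+ 2 * nrm T (V 0%N 1%N 0%N) ^+ 2 =
  2 * d0 * a ^+ 2 * nrm T (V 0%N 1%N 0%N) ^+ 2 + 2 * d0 * a ^+ 2 * nrm T (V 0%N 1%N 0%N) ^+ 2 by ring.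
lra.
Qed.

End Cover.

(** * Quantitative nondegeneracy of the shear profile *)

Section Profile.
Context {R : realType}.
Implicit Types (x y z r c : R).

Definition smooth_family (u : nat -> R -> R) : Prop :=
  (forall k, {within `[0, 1], continuous (u k)}) /\
  (forall k y, 0 < y < 1 -> is_derive y 1 (u k) (u k.+1 y)).

Lemma smooth_family_continuous_on (u : nat -> R -> R) k (a b : R) :
  smooth_family u -> 0 <= a -> b <= 1 -> {within `[a, b], continuous (u k)}.
Proof.
move=> [cu _] a0 b1; apply: continuous_subspaceW (cu k) => z /=.
by rewrite !in_itv /= => /andP[? ?]; apply/andP; split; lra.
Qed.

Lemma smooth_family_near (u : nat -> R -> R) k c (e : R) : smooth_family u ->
  0 <= c <= 1 -> 0 < e ->
  exists2 rho : R, 0 < rho & forall y, 0 <= y <= 1 -> `|y - c| < rho -> `|u k y - u k c| < e.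
Proof.
move=> [cu _] c01 e0; have /subspace_continuousP/(_ c) := cu k.
rewrite /= in_itv /= => /(_ c01)/cvgrPdist_lt/(_ e e0).
move=> /nbhs_ballP[rho /= rho0 h]; exists rho => // y y01 yc.
rewrite distrC; apply: h; last by rewrite /= in_itv.
by rewrite /ball /= distrC.
Qed.

(* Cauchy's mean value theorem against [(y - c) ^+ m.+1] yields both bounds. *)
Lemma vanishing_order (m : nat) (u : nat -> R -> R) c : smooth_family u -> 0 <= c <= 1 ->
  (forall j, (j < m)%N -> u j c = 0) -> u m c != 0 ->
  exists rho lo hi : R, [/\ 0 < rho, 0 < lo & forall y, 0 <= y <= 1 -> `|y - c| < rho ->
    lo * `|y - c| ^+ m <= `|u 0%N y| <= hi * `|y - c| ^+ m].
Proof.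
elim: m u => [|m IH] u su c01 u0 um.
  have e0 : 0 < `|u 0%N c| / 2 by rewrite divr_gt0// normr_gt0.
  have [rho rho0 h] := smooth_family_near u 0%N c _ su c01 e0.
  exists rho, (`|u 0%N c| / 2), (`|u 0%N c| * 2); split => // y y01 yc.
  rewrite expr0 !mulr1; have hy := h y y01 yc.
  have h1 := ler_distD (u 0%N c) (u 0%N y) 0.
  have h2 := ler_distD (u 0%N y) (u 0%N c) 0.
  rewrite !subr0 in h1 h2; rewrite distrC in h2; apply/andP; split; lra.
have [||rho [lo [hi [rho0 lo0 h]]]] := IH (fun k => u k.+1) _ c01 _ um.
- by have [cu du] := su; split => k; [exact: cu|exact: (du k.+1)].
- by move=> j jm; exact: u0.
exists rho, (lo / m.+1%:R), (hi / m.+1%:R); split => //; first by rewrite divr_gt0.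
move=> y y01 yc.
have [cyE|yneqc] := eqVneq y c.
  by rewrite cyE subrr normr0 expr0n /= !mulr0 u0// normr0 lexx.
pose g x := (x - c) ^+ m.+1; pose dg x := m.+1%:R * (x - c) ^+ m.
have dgE x : is_derive x (1 : R) g (dg x).
  have h1 : is_derive x 1 (fun x => x - c) (1 : R).
    by apply: is_derive_eq; rewrite oppr0 addr0.
  have := @is_deriveX _ _ (fun x : R => x - c) m.+1 x 1 _ h1.
  by rewrite exprfctE /GRing.scale /= mulr1.
have cg (a b : R) : {within `[a, b], continuous g}.
  by apply: continuous_subspaceT => x; exact: is_derive_continuous (dgE x).
have gc : g c = 0 by rewrite /g subrr expr0n.
have key : exists2 z, (0 <= z <= 1 /\ `|z - c| < rho /\ z != c) & u 1%N z / dg z = u 0%N y / g y.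
  have /andP[y0 y1] := y01; have /andP[c0 c1] := c01.
  case: (ltP c y) => cy.
    have cu01 : {within `[c, y], continuous (u 0%N)} by apply: smooth_family_continuous_on.
    have duo x : x \in `]c, y[ -> is_derive x (1 : R) (u 0%N) (u 1%N x).
      by rewrite in_itv /= => /andP[? ?]; apply: su.2; lra.
    have dgn x : x \in `]c, y[ -> dg x != 0.
      rewrite in_itv /= => /andP[xc xy].
      by rewrite mulf_neq0// expf_neq0// subr_eq0 gt_eqF.
    have [z] := @cauchy_MVT R (u 0%N) (u 1%N) g dg c y cy cu01 (cg c y)
      (fun x hx => duo x hx) (fun x _ => dgE x) (fun x hx => dgn x hx).
    rewrite in_itv /= => /andP[zc zy]; rewrite gc u0// !subr0 => <-.
    exists z => //; split; [lra|split; [|by rewrite gt_eqF]].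
    by move: yc; rewrite !gtr0_norm ?subr_gt0//; lra.
  have {}cy : y < c by rewrite lt_neqAle yneqc.
  have cu01 : {within `[y, c], continuous (u 0%N)} by apply: smooth_family_continuous_on.
  have duo x : x \in `]y, c[ -> is_derive x (1 : R) (u 0%N) (u 1%N x).
    by rewrite in_itv /= => /andP[? ?]; apply: su.2; lra.
  have dgn x : x \in `]y, c[ -> dg x != 0.
    rewrite in_itv /= => /andP[xc xy].
    by rewrite mulf_neq0// expf_neq0// subr_eq0 lt_eqF.
    have [z] := @cauchy_MVT R (u 0%N) (u 1%N) g dg y c cy cu01 (cg y c)
      (fun x hx => duo x hx) (fun x _ => dgE x) (fun x hx => dgn x hx).
  rewrite in_itv /= => /andP[zc zy]; rewrite gc u0// !sub0r.
  rewrite invrN mulrNN => <-.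
  exists z => //; split; [lra|split; [|by rewrite lt_eqF]].
  by move: yc; rewrite !ltr0_norm ?subr_lt0//; lra.
have [z [z01 [zrho zc]] E] := key.
have /andP[hlo hhi] := h z z01 zrho.
have zc0 : 0 < `|z - c| ^+ m by rewrite exprn_gt0// normr_gt0 subr_eq0.
have yc0 : 0 < `|y - c| ^+ m.+1 by rewrite exprn_gt0// normr_gt0 subr_eq0.
have uE : `|u 0%N y| = (`|u 1%N z| / `|z - c| ^+ m) / m.+1%:R * `|y - c| ^+ m.+1.
  have -> : u 0%N y = u 1%N z / dg z * g y.
    by rewrite E divfK// /g expf_neq0// subr_eq0.
  rewrite !normrM normfV /dg /g !normrX !normrM !normrX normr_nat.
  have K0 : m.+1%:R != 0 :> R by rewrite pnatr_eq0.
  have A0 : `|z - c| ^+ m != 0 by rewrite gt_eqF.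
  move: (m.+1%:R) K0 (`|z - c| ^+ m) A0 => K K0 A A0.
  by field; rewrite K0 A0.
rewrite uE; apply/andP; split.
  rewrite ler_wpM2r ?(ltW yc0)// ler_wpM2r ?invr_ge0// ler_pdivlMr//.
by rewrite ler_wpM2r ?(ltW yc0)// ler_wpM2r ?invr_ge0// ler_pdivrMr//.
Qed.

Lemma smooth_profile_family (b : R -> R) (db : nat -> R -> R) k :
  smooth_profile b db -> smooth_family (fun j => db (k + j)%N).
Proof.
move=> [_ cdb ddb]; split => j; first exact: cdb.
by move=> y y01; rewrite addnS; exact: ddb.
Qed.

(** At distance at least [r] from the critical points, [b'' / b'] is at most [L / r] and [|b'|] at
    least [r^N / L]; products replace quotients, so nothing need be known about the zeros of
    [b']. *)
Definition profile_bound (db : nat -> R -> R) M (yc : 'I_M -> R) (N : nat) (L y : R) : Prop :=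
  forall r, 0 < r -> r <= 1 -> (forall i, r <= `|y - yc i|) ->
    r * `|db 2%N y| <= L * `|db 1%N y| /\ r ^+ N <= L * `|db 1%N y|.

(** Near a noncritical [c], [b'] is bounded below and [b''] above. Near a critical point, [b'] and
    [b''] are comparable to the powers [n i] and [n i - 1] of [|y - c|]; then [r <= |y - c|] gives
    the first bound, and [r <= 1] passes from [n i] to the maximal order in the second. *)
Lemma profile_bound_local (b : R -> R) (db : nat -> R -> R) M (yc : 'I_M -> R)
    (n : 'I_M -> nat) c : smooth_profile b db -> critical_points db yc n -> 0 <= c <= 1 ->
  exists rho L0 : R, 0 < rho /\ forall y L, 0 <= y <= 1 -> `|y - c| < rho -> L0 <= L ->
    profile_bound db M yc (max_order n) L y.
Proof.
move=> sb [_ hc hn] c01.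
have [c0|c0] := eqVneq (db 1%N c) 0; last first.
  have [//|//|rho1 [lo [hi [rho10 lo0 h1]]]] := vanishing_order 0 _ c (smooth_profile_family b db 1 sb) c01.
  have [rho2 rho20 h2] := smooth_family_near _ 2 c 1 (smooth_profile_family b db 0 sb) c01 ltr01.
  exists (Num.min rho1 rho2), ((`|db 2%N c| + 1) / lo); split; first by rewrite lt_min rho10.
  move=> y L y01; rewrite lt_min => /andP[yc1 yc2] L0L r r0 r1 _.
  have /andP[l1 _] := h1 y y01 yc1; have l2 := h2 y y01 yc2.
  rewrite expr0 mulr1 addn0 in l1; rewrite !add0n in l2.
  have d2 : `|db 2%N y| <= `|db 2%N c| + 1.
    have := ler_distD (db 2%N c) (db 2%N y) 0; rewrite !subr0; lra.
  have key : `|db 2%N c| + 1 <= L * `|db 1%N y|.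
    rewrite ler_pdivrMr// in L0L.
    have L0 : 0 <= L.
      by rewrite -(pmulr_lge0 _ lo0); apply: le_trans L0L; rewrite addr_ge0.
    by apply: (le_trans L0L); rewrite ler_wpM2l.
  split; apply: le_trans key.
    by apply: le_trans d2; rewrite -[leRHS]mul1r ler_wpM2r.
  by apply: (@le_trans _ _ 1); [rewrite exprn_ile1// ltW|rewrite lerDr].
have [i ci] : exists i, yc i = c by apply/hc.
have [ni1 niz ninz] := hn i; rewrite ci in niz ninz.
have [|//|rho1 [lo [hi1 [rho10 lo0 h1]]]] :=
  vanishing_order (n i) _ c (smooth_profile_family b db 1 sb) c01.
  by move=> j jn; apply: niz; rewrite add1n.
have [||rho2 [lo2 [hi [rho20 lo20 h2]]]] :=
  vanishing_order (n i).-1 _ c (smooth_profile_family b db 2 sb) c01.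
- move=> j jn; apply: niz; rewrite /= add2n; move: jn ni1; case: (n i) => //= k.
- by move: ninz ni1; case: (n i) => //= k; rewrite add2n.
exists (Num.min rho1 rho2), (Num.max (hi / lo) lo^-1); split; first by rewrite lt_min rho10.
move=> y L y01; rewrite lt_min => /andP[yc1 yc2]; rewrite ge_max => /andP[L1 L2] r r0 r1 rM.
have /andP[l1 _] := h1 y y01 yc1; have /andP[_ l2] := h2 y y01 yc2.
rewrite addn0 in l1; rewrite addn0 in l2.
have ry : r <= `|y - c| by rewrite -ci; exact: rM.
have L0 : 0 <= L by apply: le_trans L2; rewrite invr_ge0 ltW.
have d1 : `|y - c| ^+ n i <= lo^-1 * `|db 1%N y| by rewrite ler_pdivlMl.
split.
  apply: (@le_trans _ _ (hi * `|y - c| ^+ n i)).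
    apply: (@le_trans _ _ (`|y - c| * `|db 2%N y|)); first by rewrite ler_wpM2r.
    apply: (@le_trans _ _ (`|y - c| * (hi * `|y - c| ^+ (n i).-1))); first by rewrite ler_wpM2l.
    by rewrite mulrCA -exprS prednK.
  have hi0 : 0 <= hi.
    have : 0 <= hi * `|y - c| ^+ (n i).-1 by apply: le_trans l2.
    by rewrite pmulr_lge0// exprn_gt0// (lt_le_trans r0).
  apply: (@le_trans _ _ (hi * (lo^-1 * `|db 1%N y|))); first by rewrite ler_wpM2l.
  by rewrite mulrA ler_wpM2r.
apply: (@le_trans _ _ (r ^+ n i)).
  by apply: ler_wiXn2l; rewrite ?(ltW r0)// /max_order leq_bigmax.
apply: (@le_trans _ _ (`|y - c| ^+ n i)); first by apply: lerXn2r; rewrite ?nnegrE ?(ltW r0).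
by apply: (le_trans d1); rewrite ler_wpM2r.
Qed.

Lemma profile_bound_uniform (b : R -> R) (db : nat -> R -> R) M (yc : 'I_M -> R)
    (n : 'I_M -> nat) : smooth_profile b db -> critical_points db yc n ->
  exists2 L : R, 1 <= L & forall y, 0 <= y <= 1 -> profile_bound db M yc (max_order n) L y.
Proof.
move=> sb hc.
(* The local bounds hold for all large [L], so compactness is used in its near-covering form with
   [L] tending to infinity, which yields one [L] for the whole interval. *)
pose P (L y : R) := 0 <= y <= 1 -> profile_bound db M yc (max_order n) L y.
have /compact_near_coveringP cov : compact `[0, 1 : R] by exact: segment_compact.
have := cov R (pinfty_nbhs R) P _.
case.
  move=> c; rewrite /= in_itv /= => c01.
  have [rho [L0 [rho0 h]]] := profile_bound_local b db M yc n c sb hc c01.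
  exists ([set y | `|y - c| < rho], [set L | L0 < L]) => /=.
    split.
      by apply/nbhs_ballP; exists rho => //= y; rewrite /ball /= distrC.
    by exists L0; split; first exact: num_real.
  by move=> [y L] /= [ycr /ltW L0L] y01; exact: h.
move=> L1 [_ hL]; exists (Num.max 1 (L1 + 1)); first by rewrite le_max lexx.
move=> y y01; apply: (hL (Num.max 1 (L1 + 1))) => //.
by rewrite lt_max ltrDl ltr01 orbT.
Qed.

End Profile.

(** * Cut-off functions and the spacing of the critical points *)

Section Cutoffs.
Context {R : realType}.
Implicit Types (x y z r c dl : R).

Definition cutfun (u : R -> R) (C : R) : Prop :=
  [/\ smooth setT u, forall y, 0 <= u y <= 1 & forall y, `|derive1 u y| <= C].

Lemma derive1_is_derive (u : R -> R) y d : is_derive y (1 : R) u d -> derive1 u y = d.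
Proof. by move=> h; rewrite derive1E (@derive_val _ _ _ _ _ _ _ h). Qed.

Lemma cutfunM (u v : R -> R) (C D : R) : cutfun u C -> cutfun v D ->
  cutfun (fun y => u y * v y) (C + D).
Proof.
move=> [su u01 uC] [sv v01 vD]; split; first by apply: smoothM => //; exact: openT.
  move=> y; have /andP[u0 u1] := u01 y; have /andP[v0 v1] := v01 y.
  by rewrite mulr_ge0//= mulr_ile1.
move=> y; rewrite (derive1_is_derive _ _ _ (is_deriveM (smooth_is_derive u y su) (smooth_is_derive v y sv))).
have /andP[u0 u1] := u01 y; have /andP[v0 v1] := v01 y.
rewrite /GRing.scale /= (le_trans (ler_normD _ _))// addrC.
apply: lerD; rewrite normrM ger0_norm//.
  by apply: le_trans (uC y); rewrite -[leRHS]mul1r ler_wpM2r.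
by apply: le_trans (vD y); rewrite -[leRHS]mul1r ler_wpM2r.
Qed.

Lemma cutfun1 : cutfun (fun=> 1) 0.
Proof.
split; first by move=> n; apply: nderivable_cst; exact: openT.
  by move=> y; rewrite ler01 lexx.
by move=> y; rewrite (derive1_is_derive _ _ _ (is_derive_cst (1 : R) y 1)) normr0.
Qed.

Lemma cutfun_prod (I : Type) (s : seq I) (f : I -> R -> R) (C : R) :
  (forall i, cutfun (f i) C) -> cutfun (fun y => \prod_(i <- s) f i y) ((size s)%:R * C).
Proof.
move=> fC; elim: s => [|i s IH].
  rewrite mul0r (_ : (fun y => _) = (fun=> 1)); first exact: cutfun1.
  by apply/funext => y; rewrite big_nil.
rewrite /= -natr1 mulrDl mul1r addrC (_ : (fun y => _) = (fun y => f i y * \prod_(i <- s) f i y)).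
  exact: cutfunM.
by apply/funext => y; rewrite big_cons.
Qed.

Lemma cutfun_comp (u g : R -> R) (C : R) (g' : R -> R) : smooth setT u ->
  (forall y, 0 <= u y <= 1) -> smooth setT g -> (forall y : R, is_derive y 1 g (g' y)) ->
  (forall y, `|derive1 u (g y) * g' y| <= C) -> cutfun (fun y => u (g y)) C.
Proof.
move=> su u01 sg dg uC; split.
- by move=> n; apply: (nderivable_comp n setT setT u g) => //; exact: openT.
- by move=> y; exact: u01.
move=> y; rewrite (derive1_is_derive _ _ _ (@is_derive1_comp R u g y _ _ (smooth_is_derive u (g y) su) (dg y))).
exact: uC.
Qed.

Lemma is_derive_affine (a c y : R) : is_derive y (1 : R) (fun y => a * y + c) a.
Proof. by apply: is_derive_eq; rewrite addr0 /GRing.scale /= mulr1. Qed.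

Lemma step_cutfuns : exists2 C : R, 0 < C & forall e, 0 < e ->
  [/\ cutfun (fun y => step (y / e)) (C / e),
      cutfun (fun y => step ((1 - y) / e)) (C / e) &
      forall c, cutfun (fun y => step (((y - c) / e) ^+ 2)) (C / e)].
Proof.
have [C C0 hC] := @step_derive_bound R.
exists (4 * C); first by lra.
move=> e e0; have e'0 : 0 <= e^-1 by rewrite invr_ge0 ltW.
have aff a c : `|a| <= e^-1 -> cutfun (fun y => step (a * y + c)) (4 * C / e).
  move=> ae; apply: (cutfun_comp step _ _ (fun=> a)).
  - exact: smooth_step.
  - exact: step_itv.
  - by apply: smooth_affine; exact: openT.
  - by move=> y; exact: is_derive_affine.
  move=> y; have [h _] := hC (a * y + c); rewrite normrM.
  apply: (@le_trans _ _ (C * e^-1)); first by apply: ler_pM.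
  by rewrite ler_wpM2r//; lra.
split.
- rewrite (_ : (fun y => _) = (fun y => step (e^-1 * y + 0))).
    by apply: aff; rewrite ger0_norm.
  by apply/funext => y; rewrite addr0 mulrC.
- rewrite (_ : (fun y => _) = (fun y => step (- e^-1 * y + e^-1))).
    by apply: aff; rewrite normrN ger0_norm.
  by apply/funext => y; congr step; ring.
move=> c; apply: (cutfun_comp step _ _ (fun y => 2 * ((y - c) / e) * e^-1)).
- exact: smooth_step.
- exact: step_itv.
- rewrite (_ : (fun y => _) = (fun y => (e^-1 * y + - (c / e)) * (e^-1 * y + - (c / e)))).
    by apply: smoothM; [exact: openT|apply: smooth_affine; exact: openT..].
  by apply/funext => y; rewrite expr2; congr (_ * _); ring.
- move=> y; rewrite (_ : (fun y => _) = (fun y => (e^-1 * y + - (c / e)) ^+ 2)).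
    have := is_derive_sqr _ _ _ (is_derive_affine e^-1 (- (c / e)) y).
    by rewrite (_ : e^-1 * y + - (c / e) = (y - c) / e)//; ring.
  by apply/funext => s; congr (_ ^+ 2); ring.
move=> y; set r := (y - c) / e.
have [h1 h2] := hC (r ^+ 2); rewrite mulrA normrM (ger0_norm e'0) ler_wpM2r//.
rewrite mulrCA normrM ger0_norm// mulrC.
(* This splits the chain-rule factor [r] between the two bounds of [step_derive_bound], on [step']
   and on its argument times [step']; together with the 2 from the square they give [4 * C]. *)
have rb : `|r| <= 1 + r ^+ 2.
  have := sqr_ge0 (`|r| - 1); rewrite sqrrB expr1n mulr1 real_normK ?num_real//.
  have := normr_ge0 r; rewrite -mulr_natl; lra.
have : `|derive1 step (r ^+ 2) * r| <= 2 * C.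
  rewrite normrM; apply: (@le_trans _ _ (`|derive1 step (r ^+ 2)| * (1 + r ^+ 2))).
    by rewrite ler_wpM2l.
  rewrite mulrDr mulr1; move: h2; rewrite normrM (ger0_norm (sqr_ge0 r)) mulrC; lra.
lra.
Qed.

Lemma finite_gap (I : finType) (f : I -> R) :
  exists2 rho : R, 0 < rho & forall i, f i = 0 \/ rho <= `|f i|.
Proof.
have [rho rho0 h] : exists2 rho : R, 0 < rho & forall i, i \in enum I -> f i = 0 \/ rho <= `|f i|.
  elim: (enum I) => [|i s [rho rho0 IH]]; first by exists 1.
  have [fi|fi] := eqVneq (f i) 0.
    exists rho => // j; rewrite inE => /predU1P[->|/IH//]; by left.
  exists (Num.min rho `|f i|); first by rewrite lt_min rho0 normr_gt0.
  move=> j; rewrite inE => /predU1P[->|/IH[?|?]]; first by right; rewrite ge_min lexx orbT.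
    by left.
  by right; rewrite ge_min; apply/orP; left.
by exists rho => // i; apply: h; rewrite mem_enum.
Qed.

(** A critical point may sit on the boundary, hence the alternatives for 0 and 1. *)
Lemma critical_gap M (yc : 'I_M -> R) : injective yc -> (forall i, 0 <= yc i <= 1) ->
  exists2 rho : R, 0 < rho & [/\ forall i j, i != j -> rho <= `|yc i - yc j|,
    forall i, yc i = 0 \/ rho <= yc i & forall i, yc i = 1 \/ rho <= 1 - yc i].
Proof.
move=> yinj y01.
have [r1 r10 h1] := finite_gap ('I_M * 'I_M)%type (fun p => yc p.1 - yc p.2).
have [r2 r20 h2] := finite_gap 'I_M yc.
have [r3 r30 h3] := finite_gap 'I_M (fun i => 1 - yc i).
exists (Num.min r1 (Num.min r2 r3)); first by rewrite !lt_min r10 r20.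
split.
- move=> i j ij; case: (h1 (i, j)) => /= [/eqP|h].
    by rewrite subr_eq0 => /eqP/yinj/eqP; rewrite (negbTE ij).
  by rewrite ge_min h.
- move=> i; case: (h2 i) => [->|h]; [by left|right].
  have /andP[y0 _] := y01 i; rewrite ger0_norm// in h.
  by rewrite !ge_min h !orbT.
- move=> i; case: (h3 i) => [/eqP|h].
    by rewrite subr_eq0 => /eqP <-; left.
  right; have /andP[_ y1] := y01 i; rewrite ger0_norm ?subr_ge0// in h.
  by rewrite !ge_min h !orbT.
Qed.

End Cutoffs.

(** * Construction of the weights [kap] and [zeta] *)

Section ProfileCutoffs.
Context {R : realType}.
Implicit Types (x y z r c dl : R).

(* The witness is [kap = chi / b'], with [chi] vanishing within [O(dl)] of the
   critical points and of the boundary, so that [kap y * (bb (y + dl) - bb y)] is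
   comparable to [dl * chi y]; where [chi] vanishes, it is large after a shift by
   [A * dl]. *)
Definition adapted_cutoffs (bb : R -> R) (N : nat) (C A dl : R) : Prop :=
  exists (kap zeta : R -> R) (p q p' q' : R),
  [/\ [/\ smooth setT kap, forall y, ~~ (p <= y <= q) -> kap y = 0,
        forall y, `|kap y| <= C / dl ^+ N & forall y, `|derive1 kap y| <= C / dl ^+ N.+1],
      [/\ cutfun zeta (C / dl), forall y, ~~ (p' <= y <= q') -> zeta y = 0 &
        forall y, kap y != 0 -> zeta y = 1 /\ zeta (y + dl) = 1],
      [/\ 0 < p, p <= q & q + dl < 1], [/\ dl < p', p' <= q' & q' < 1] &
      [/\ forall y, 0 <= kap y * (bb (y + dl) - bb y) <= 2 * dl,
        forall y, 0 < y <= 3 / 4 -> dl / 2 <= kap y * (bb (y + dl) - bb y) \/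
           dl / 2 <= kap (y + A * dl) * (bb (y + A * dl + dl) - bb (y + A * dl)) &
        forall y, 4^-1 <= y < 1 -> dl / 2 <= kap y * (bb (y + dl) - bb y) \/
           dl / 2 <= kap (y - A * dl) * (bb (y - A * dl + dl) - bb (y - A * dl))]].

(* On [[y, y + dl]] the logarithmic derivative of [b'] is at most [1 / (4 dl)],
   so [b'] does not leave [[2/3, 4/3] b'(y)]. *)
Lemma increment_ratio (b : R -> R) (db : nat -> R -> R) M (yc : 'I_M -> R) (N : nat) (L y dl : R) :
  smooth_profile b db -> 1 <= L -> (forall y, 0 <= y <= 1 -> profile_bound db M yc N L y) ->
  0 < dl -> 8 * L * dl <= 1 -> 0 < y -> y + dl < 1 -> (forall i, 8 * L * dl <= `|y - yc i|) ->
  db 1%N y != 0 ->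
  exists2 rho : R, 2 / 3 <= rho <= 4 / 3 & b (y + dl) - b y = dl * rho * db 1%N y.
Proof.
move=> sb L1 hL dl0 Kdl y0 y1 far dn0; have [b0 cdb ddb] := sb.
have sf k := smooth_family_continuous_on _ k y (y + dl) (smooth_profile_family b db 0 sb) (ltW y0) (ltW y1).
have ydl : y <= y + dl by rewrite lerDl ltW.
have ydl' : y < y + dl by rewrite ltrDl.
have Ldl : 8 * dl <= 8 * L * dl by rewrite ler_wpM2r ?(ltW dl0)//; lra.
have d2 z : y <= z <= y + dl -> `|db 2%N z| <= (4 * dl)^-1 * `|db 1%N z|.
  move=> /andP[yz zy].
  have z01 : 0 <= z <= 1 by apply/andP; split; lra.
  have [||i|h _] := hL z z01 (4 * L * dl).
  - by rewrite !mulr_gt0//; lra.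
  - by lra.
  - have := far i; have := ler_distD z y (yc i).
    have : `|y - z| <= dl by rewrite distrC ger0_norm; lra.
    lra.
  rewrite mulrC ler_pdivlMr; last by lra.
  rewrite -(@ler_pM2l _ L); last by lra.
  by rewrite (_ : L * (`|db 2%N z| * (4 * dl)) = 4 * L * dl * `|db 2%N z|) //; ring.
pose h z := `|db 1%N z|.
have ch : {within `[y, y + dl], continuous h}.
  by move=> z; apply: continuous_comp; [exact: (sf 1%N)|exact: norm_continuous].
(* The bound on [b''] is relative to [b'] itself. Measuring against the maximum of [|b'|] closes the
   argument without Gronwall: the oscillation is at most a quarter of the maximum, so the maximum is
   at most [4/3 |b'(y)|]. *)
have [zm zm_in hm] := EVT_max ydl ch.
have near1 z : y <= z <= y + dl -> `|db 1%N z - db 1%N y| <= 4^-1 * h zm.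
  move=> /andP[yz zy].
  have [||x xyz E] := @MVT_segment R (db 1%N) (db 2%N) y z yz.
  - by move=> x; rewrite in_itv /= => /andP[? ?]; apply: ddb; lra.
  - by apply: (smooth_family_continuous_on _ 1 _ _ (smooth_profile_family b db 0 sb)); lra.
  move: xyz; rewrite in_itv /= => /andP[yx xz].
  have xdl : y <= x <= y + dl by apply/andP; split; lra.
  rewrite E normrM (ger0_norm (_ : 0 <= z - y)) ?subr_ge0//.
  have hx : h x <= h zm by apply: hm; rewrite in_itv.
  apply: (@le_trans _ _ ((4 * dl)^-1 * h zm * dl)).
    apply: ler_pM => //; [by rewrite subr_ge0| |lra].
    apply: (le_trans (d2 x xdl)); rewrite ler_wpM2l// invr_ge0; lra.
  by rewrite le_eqVlt; apply/orP; left; apply/eqP; field; rewrite gt_eqF.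
have hzm : h zm <= 4 / 3 * `|db 1%N y|.
  move: zm_in; rewrite in_itv /= => /near1 n1.
  have := ler_distD (db 1%N y) (db 1%N zm) 0; rewrite !subr0 -/(h zm); lra.
have [||x xyz E] := @MVT_segment R (db 0%N) (db 1%N) y (y + dl) ydl.
- by move=> x; rewrite in_itv /= => /andP[? ?]; apply: ddb; lra.
- exact: (sf 0%N).
have xdl : y <= x <= y + dl by move: xyz; rewrite in_itv.
have n1 : `|db 1%N x - db 1%N y| <= 3^-1 * `|db 1%N y| by have := near1 x xdl; lra.
exists (db 1%N x / db 1%N y).
  have : `|db 1%N x / db 1%N y - 1| <= 3^-1.
    have -> : db 1%N x / db 1%N y - 1 = (db 1%N x - db 1%N y) / db 1%N y by field.
    by rewrite normrM normfV ler_pdivrMr ?normr_gt0.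
  by rewrite ler_norml => /andP[? ?]; apply/andP; split; lra.
rewrite -b0 E; field; exact: dn0.
Qed.

(** A point within [2 e] of 0 or of a critical point moves by [4 e]: it ends between [2 e] and [6 e]
    beyond that point, while every other critical point is at least [8 e] away from it. So one
    translation suffices to leave all the neighbourhoods. *)
Lemma shift_avoids M (yc : 'I_M -> R) (gap e y : R) :
  (forall i j, i != j -> gap <= `|yc i - yc j|) -> (forall i, yc i = 0 \/ gap <= yc i) ->
  0 < e -> 8 * e <= gap -> 0 < y ->
  (2 * e <= y /\ forall i, 2 * e <= `|y - yc i|) \/ forall i, 2 * e <= `|y + 4 * e - yc i|.
Proof.
move=> g1 g2 e0 e8 y0.
have [good|bad] := pselect (2 * e <= y /\ forall i, 2 * e <= `|y - yc i|); first by left.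
right => i; have [y2|y2] := ltP y (2 * e).
  have [->|h] := g2 i; first by rewrite subr0 ger0_norm; lra.
  by rewrite distrC ger0_norm; lra.
have [j yj] : exists j, `|y - yc j| < 2 * e.
  apply: contrapT => h; apply: bad; split => // j; rewrite leNgt; apply/negP => hj.
  by apply: h; exists j.
move: yj; rewrite ltr_norml => /andP[j1 j2].
have [ij|ij] := eqVneq i j; first by rewrite ij ger0_norm; lra.
have := g1 i j ij; have := ler_distD (y + 4 * e) (yc i) (yc j).
rewrite (distrC (yc i) (y + 4 * e)) [`|y + 4 * e - yc j|]ger0_norm; lra.
Qed.

Lemma profile_cutoffs (b : R -> R) (db : nat -> R -> R) M (yc : 'I_M -> R) (n : 'I_M -> nat) :
  smooth_profile b db -> critical_points db yc n ->
  exists C A d0 : R, [/\ 0 < C, 0 < A, 0 < d0 & forall dl, 0 < dl -> dl <= d0 ->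
    A * dl <= 4^-1 /\ adapted_cutoffs (fun y => b (clamp 1 y)) (max_order n) C A dl].
Proof.
move=> sb hcr; have [b0 cdb ddb] := sb; have [yinj ycr yord] := hcr.
set N := max_order n.
have yc01 i : 0 <= yc i <= 1 by have [] : 0 <= yc i <= 1 /\ db 1%N (yc i) = 0 by apply/ycr; exists i.
have [L L1 hL] := profile_bound_uniform b db M yc n sb hcr.
have [Cs Cs0 hCs] := @step_cutfuns R.
have [gap gap0 [g1 g2 g3]] := critical_gap M yc yinj yc01.
(* With [e = K dl] as the width of the cut-offs, [8 * L * dl <= e] is what [increment_ratio] asks
   for. The translation of [shift_avoids] is [4 * e], hence [A = 4 * K], and [d0] encodes
   [32 * e <= 1] and [8 * e <= gap]. *)
pose K := 8 * L; pose m : R := (size (index_enum 'I_M))%:R.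
have m0 : 0 <= m by rewrite ler0n.
have L0 : 0 < L by lra.
have K8 : 8 <= K by rewrite /K; lra.
have K0 : 0 < K by lra.
(* The two terms of the derivative of [chi / b']: [chi] has one factor per critical point and two
   for the boundary, and [b'' / b'^2] is the product of the bounds [L] for [1 / b'] and for
   [b'' / b']. *)
pose C1 := (m + 2) * Cs * L + L ^+ 2.
have C10 : 0 <= C1 by rewrite addr_ge0 ?sqr_ge0// !mulr_ge0//; lra.
pose C := L + C1 + 8 * Cs.
exists C, (4 * K), (Num.min (32 * K)^-1 (gap / (8 * K))); split.
- by rewrite /C; lra.
- by lra.
- by rewrite lt_min invr_gt0 divr_gt0; lra.
move=> dl dl0; rewrite le_min => /andP[dle1 dle2].
pose e := K * dl.
have e32 : 32 * e <= 1.
  by rewrite /e mulrA -ler_pdivlMl ?mulr1//; lra.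
have e8 : 8 * e <= gap.
  by rewrite /e mulrA mulrC -ler_pdivlMr//; lra.
have edl : 8 * dl <= e by rewrite /e ler_pM2r.
have e0 : 0 < e by lra.
have Ae : 4 * K * dl = 4 * e by rewrite /e mulrA.
split; first by rewrite Ae; lra.
have [cf0 cf1 cfi] := hCs e e0.
pose chi y := step (y / e) * (step ((1 - y) / e) * \prod_(i < M) step (((y - yc i) / e) ^+ 2)).
have cchi : cutfun chi (Cs / e + (Cs / e + m * (Cs / e))).
  have cfp := cutfun_prod _ (index_enum 'I_M) (fun i y => step (((y - yc i) / e) ^+ 2)) _
    (fun i => cfi (yc i)).
  exact (cutfunM _ _ _ _ cf0 (cutfunM _ _ _ _ cf1 cfp)).
have [schi chi01 dchi] := cchi.
have chi_eq0 y : y <= e \/ 1 - e <= y \/ (exists i, `|y - yc i| <= e) -> chi y = 0.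
  rewrite /chi => -[h|[h|[i h]]].
  - by rewrite step_eq0 ?mul0r// ler_pdivrMr ?mul1r.
  - by rewrite [step ((1 - y) / e)]step_eq0 ?mul0r ?mulr0// ler_pdivrMr ?mul1r//; lra.
  - rewrite (bigD1 i)//= [step (((y - yc i) / e) ^+ 2)]step_eq0 ?mul0r ?mulr0//.
    rewrite -real_normK ?num_real// expr_le1// normrM normfV (gtr0_norm e0).
    by rewrite ler_pdivrMr// mul1r.
have chi_eq1 y : 2 * e <= y -> y <= 1 - 2 * e -> (forall i, 2 * e <= `|y - yc i|) -> chi y = 1.
  move=> h1 h2 h3; rewrite /chi.
  rewrite step_eq1 ?mul1r; last by rewrite ler_pdivlMr.
  rewrite step_eq1 ?mul1r; last by rewrite ler_pdivlMr//; lra.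
  rewrite big1// => i _; rewrite step_eq1//.
  have h : 2 <= `|(y - yc i) / e|.
    by rewrite normrM normfV (gtr0_norm e0) ler_pdivlMr.
  rewrite -real_normK ?num_real//; apply: (@le_trans _ _ (2 ^+ 2)); first by rewrite expr2; lra.
  by rewrite ler_sqr ?nnegrE.
have chi_neq0 y : chi y != 0 -> [/\ e < y, y < 1 - e & forall i, e < `|y - yc i|].
  move=> h; split.
  - by rewrite ltNge; apply: contra h => h; apply/eqP/chi_eq0; left.
  - by rewrite ltNge; apply: contra h => h; apply/eqP/chi_eq0; right; left.
  - by move=> i; rewrite ltNge; apply: contra h => h; apply/eqP/chi_eq0; right; right; exists i.
have far y : e <= y -> y <= 1 - e -> (forall i, e <= `|y - yc i|) ->
    [/\ db 1%N y != 0, `|db 1%N y|^-1 <= L / e ^+ N & `|db 2%N y| / `|db 1%N y| <= L / e].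
  move=> ye ye1 hy; have y01 : 0 <= y <= 1 by apply/andP; split; lra.
  have [//||//|h1 h2] := hL y y01 e; first by lra.
  have eN : 0 < e ^+ N by rewrite exprn_gt0.
  have dn0 : 0 < `|db 1%N y|.
    have : 0 < L * `|db 1%N y| by apply: lt_le_trans h2.
    by rewrite pmulr_rgt0.
  split; first by rewrite -normr_gt0.
    by rewrite -[leLHS]mul1r ler_pdivrMr// mulrAC ler_pdivlMr// mul1r.
  by rewrite ler_pdivrMr// mulrAC ler_pdivlMr// mulrC.
pose kap y := chi y / db 1%N y.
have kap_neq0 y : kap y != 0 -> chi y != 0.
  by apply: contra_neq => h; rewrite /kap h mul0r.
(* [kap] is a smooth quotient on [O1] and vanishes on [O2]; [far] shows that the two open sets cover
   the line. *)
pose O1 : set R := [set y | 0 < y < 1 /\ db 1%N y != 0].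
pose O2 : set R := [set y | y < e] `|` ([set y | 1 - e < y] `|` \bigcup_i [set y | `|y - yc i| < e]).
have oO1 : open O1.
  rewrite openE => y [y01 dy0]; have c1 := is_derive_continuous _ _ _ (ddb 1%N y y01).
  have [y0 y1] := andP y01.
  near=> s; split; first by apply/andP; split; near: s; [exact: lt_nbhsr|exact: lt_nbhsl].
  by near: s; apply: (c1 [set z | z != 0]); apply: open_nbhs_nbhs; split => //; exact: open_neq.
have oO2 : open O2.
  apply: openU; first exact: open_lt.
  apply: openU; first exact: open_gt.
  apply: bigcup_open => i _.
  rewrite (_ : [set y | _] = ball (yc i) e); first exact: ball_open.
  by apply/seteqP; split => y; rewrite /ball /= distrC.
have OT : setT = O1 `|` O2.
  apply/seteqP; split => // y _.
  have [h|h] := pselect (O2 y); first by right.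
  left.
  have ye : e <= y by rewrite leNgt; apply/negP => ?; apply: h; left.
  have ye1 : y <= 1 - e by rewrite leNgt; apply/negP => ?; apply: h; right; left.
  have hy i : e <= `|y - yc i|.
    by rewrite leNgt; apply/negP => ?; apply: h; right; right; exists i.
  have [dn0 _ _] := far y ye ye1 hy; split => //; apply/andP; split; lra.
have O2kap y : O2 y -> kap y = 0.
  move=> h; rewrite /kap chi_eq0 ?mul0r//.
  case: h => [/ltW h|[/ltW h|[i _ /ltW h]]]; [by left|by right; left|by right; right; exists i].
have sdb : smooth O1 (db 1%N).
  by move=> k; apply: nderivable_chain => // j y [y01 _]; exact: ddb.
have skap : smooth setT kap.
  move=> k; rewrite OT; apply: nderivableU.
    apply: (smoothM O1 chi (fun y => (db 1%N y)^-1)) => //.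
      by move=> j; apply: (nderivable_subset _ _ setT) => //; exact: schi.
    by apply: smoothV => // y [].
  apply: (eq_nderivable _ _ (fun=> 0)) => //; last exact: nderivable_cst.
  by move=> y Oy; rewrite O2kap.
have kapb y : `|kap y| <= L / e ^+ N.
  have [->|ky] := eqVneq (kap y) 0.
    by rewrite normr0 divr_ge0 ?exprn_ge0// ltW.
  have [h1 h2 h3] := chi_neq0 y (kap_neq0 y ky).
  have [dn0 hd _] := far y (ltW h1) (ltW h2) (fun i => ltW (h3 i)).
  rewrite /kap normrM normfV; apply: le_trans hd.
  have /andP[c0 c1] := chi01 y; rewrite (ger0_norm c0) -[leRHS]mul1r ler_wpM2r//.
have dkapb y : `|derive1 kap y| <= C1 / e * (e ^+ N)^-1.
  have rhs0 : 0 <= C1 / e * (e ^+ N)^-1.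
    by rewrite !mulr_ge0 ?invr_ge0 ?exprn_ge0// ltW.
  have [Oy|Oy] := pselect (O2 y).
    rewrite (@derive1_locally_cst _ kap 0 y) ?normr0//.
    by apply: filterS (open_nbhs_nbhs (conj oO2 Oy)) => s Os; exact: O2kap.
  have O1y : O1 y.
    have : (O1 `|` O2) y by rewrite -OT.
    by case.
  have ye : e <= y by rewrite leNgt; apply/negP => ?; apply: Oy; left.
  have ye1 : y <= 1 - e by rewrite leNgt; apply/negP => ?; apply: Oy; right; left.
  have hy i : e <= `|y - yc i|.
    by rewrite leNgt; apply/negP => ?; apply: Oy; right; right; exists i.
  have [dn0 hd hdd] := far y ye ye1 hy.
  have [y01 _] := O1y.
  have dk := is_deriveM (smooth_is_derive chi y schi) (is_deriveV dn0 (ddb 1%N y y01)).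
  rewrite (derive1_is_derive _ _ _ dk) /GRing.scale /=.
  rewrite (le_trans (ler_normD _ _))//.
  have t2 : `|(db 1%N y)^-1 * derive1 chi y| <= (m + 2) * Cs * L / e * (e ^+ N)^-1.
    rewrite normrM normfV.
    apply: (@le_trans _ _ ((L / e ^+ N) * ((m + 2) * Cs / e))).
      apply: ler_pM => //.
      apply: (le_trans (dchi y)); rewrite le_eqVlt; apply/orP; left; apply/eqP; ring.
    rewrite le_eqVlt; apply/orP; left; apply/eqP; ring.
  have t1 : `|chi y * (- db 1%N y ^- 2 * db 2%N y)| <= L ^+ 2 / e * (e ^+ N)^-1.
    have /andP[c0 c1] := chi01 y.
    rewrite normrM (ger0_norm c0) -[leRHS]mul1r; apply: ler_pM => //.
    rewrite normrM normrN normfV normrX.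
    have -> : (`|db 1%N y| ^+ 2)^-1 * `|db 2%N y| = `|db 1%N y|^-1 * (`|db 2%N y| / `|db 1%N y|).
      by rewrite expr2 invfM; ring.
    apply: (@le_trans _ _ ((L / e ^+ N) * (L / e))).
      by apply: ler_pM.
    rewrite le_eqVlt; apply/orP; left; apply/eqP; ring.
  apply: (le_trans (lerD t1 t2)); rewrite /C1 le_eqVlt; apply/orP; left; apply/eqP; ring.
have e'0 : 0 < e / 4 by lra.
have [cz0 cz1 _] := hCs (e / 4) e'0.
(* With width [e / 4], [zeta] equals 1 on [[e / 2, 1 - e / 2]], which contains the support
   [[e, 1 - e]] of [kap] and its translate by [dl <= e / 8], and its own support starts at
   [e / 4 > dl]. *)
pose zeta y := step (y / (e / 4)) * step ((1 - y) / (e / 4)).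
have czeta : cutfun zeta (Cs / (e / 4) + Cs / (e / 4)) := cutfunM _ _ _ _ cz0 cz1.
have zeta_eq1 y : e / 2 <= y -> y <= 1 - e / 2 -> zeta y = 1.
  move=> h1 h2; rewrite /zeta !step_eq1 ?mulr1//; rewrite ler_pdivlMr//; lra.
have einv k : (e ^+ k)^-1 <= (dl ^+ k)^-1.
  rewrite lef_pV2 ?posrE ?exprn_gt0//; apply: lerXn2r; rewrite ?nnegrE ?ltW//; lra.
have LC : L <= C by rewrite /C; lra.
have C1C : C1 <= C by rewrite /C; lra.
pose D y := b (clamp 1 (y + dl)) - b (clamp 1 y).
have kapD y : exists2 rho : R, 2 / 3 <= rho <= 4 / 3 & kap y * D y = chi y * (dl * rho).
  have [c0|c0] := eqVneq (chi y) 0.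
    by exists 1; [apply/andP; split; lra|rewrite /kap c0 !mul0r].
  have [h1 h2 h3] := chi_neq0 y c0.
  have [dn0 _ _] := far y (ltW h1) (ltW h2) (fun i => ltW (h3 i)).
  have k1 : 8 * L * dl <= 1 by rewrite -/K -/e; lra.
  have k2 : 0 < y by exact: lt_trans h1.
  have k3 : y + dl < 1 by clear -h2 edl dl0; lra.
  have k4 i : 8 * L * dl <= `|y - yc i| by rewrite -/K -/e; exact/ltW/h3.
  have [rho rho1 E] := increment_ratio b db M yc N L y dl sb L1 hL dl0 k1 k2 k3 k4 dn0.
  exists rho => //; rewrite /D !clamp_id; last 2 first.
  - by clear -k2 k3 dl0; apply/andP; split; lra.
  - by clear -k2 k3 dl0; apply/andP; split; lra.
  by rewrite E /kap; field; exact: dn0.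
have kapD1 y : chi y = 1 -> dl / 2 <= kap y * D y.
  move=> c1; have [rho /andP[r1 r2] ->] := kapD y; rewrite c1 mul1r ler_wpM2l ?(ltW dl0)//; lra.
exists kap, zeta, e, (1 - e), (e / 4), (1 - e / 4); split.
- split => //.
  + move=> y hy; rewrite /kap chi_eq0 ?mul0r//.
    by move: hy; rewrite negb_and -!ltNge => /orP[/ltW h|/ltW h]; [left|right; left].
  + move=> y; apply: (le_trans (kapb y)); apply: ler_pM => //; first by rewrite ltW.
    by rewrite invr_ge0 exprn_ge0// ltW.
  + move=> y; apply: (le_trans (dkapb y)); rewrite -mulrA -invfM -exprS.
    by apply: ler_pM => //; rewrite invr_ge0 exprn_ge0// ltW.
- split.
  + have [s1 s2 s3] := czeta; split => // y; apply: (le_trans (s3 y)).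
    have -> : Cs / (e / 4) + Cs / (e / 4) = 8 * Cs / e by field; rewrite gt_eqF.
    apply: ler_pM; [lra|by rewrite invr_ge0 ltW|rewrite /C; lra|].
    by rewrite lef_pV2 ?posrE//; lra.
  + move=> y hy; rewrite /zeta.
    move: hy; rewrite negb_and -!ltNge => /orP[h|h].
      by rewrite step_eq0 ?mul0r// ler_pdivrMr// mul1r ltW.
    by rewrite [step ((1 - y) / _)]step_eq0 ?mulr0// ler_pdivrMr// mul1r; lra.
  + move=> y /kap_neq0/chi_neq0[h1 h2 _]; split; apply: zeta_eq1; clear -h1 h2 edl dl0; lra.
- by clear -e32 edl dl0; split; lra.
- by clear -e32 edl dl0; split; lra.
rewrite !Ae; split.
- move=> y; have [rho /andP[r1 r2]] := kapD y; rewrite -/(D y) => ->.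
  have /andP[c0 c1] := chi01 y.
  have dr : 0 <= dl * rho by rewrite mulr_ge0 ?(ltW dl0)//; lra.
  rewrite mulr_ge0//=; apply: (@le_trans _ _ (1 * (dl * rho))); first by rewrite ler_wpM2r.
  by rewrite mul1r mulrC ler_wpM2r ?(ltW dl0)//; lra.
- move=> y /andP[y0 y34]; rewrite -/(D y) -/(D (y + 4 * e)).
  have [[h1 h2]|h] := shift_avoids M yc gap e y g1 g2 e0 e8 y0.
    by left; apply/kapD1/chi_eq1 => //; clear -y34 e32; lra.
  by right; apply/kapD1/chi_eq1 => //; clear -y34 e32 y0 e0; lra.
(* Downward translation is the upward one after the reflection of [y] and of the critical points to
   [1 - y] and [1 - yc i]. *)
- move=> y /andP[y14 y1]; rewrite -/(D y) -/(D (y - 4 * e)).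
  have y1' : 0 < 1 - y by rewrite subr_gt0.
  have g1' i j : i != j -> gap <= `|(1 - yc i) - (1 - yc j)|.
    by move=> ij; rewrite opprB addrC addrA subrK distrC; exact: g1.
  have g3' i : 1 - yc i = 0 \/ gap <= 1 - yc i.
    by case: (g3 i) => [->|]; [left; rewrite subrr|right].
  have n1 i : `|1 - y - (1 - yc i)| = `|y - yc i|.
    by rewrite distrC; congr (`| _ |); ring.
  have n2 i : `|1 - y + 4 * e - (1 - yc i)| = `|y - 4 * e - yc i|.
    by rewrite distrC; congr (`| _ |); ring.
  have [[h1 h2]|h] := shift_avoids M (fun i => 1 - yc i) gap e (1 - y) g1' g3' e0 e8 y1'.
    left; apply/kapD1/chi_eq1; [clear -y14 e32; lra|clear -h1; lra|].
    by move=> i; rewrite -n1.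
  right; apply/kapD1/chi_eq1; [clear -y14 e32; lra|clear -y1 e0; lra|].
  by move=> i; rewrite -n2.
Unshelve. all: by end_near. Qed.

End ProfileCutoffs.

(** * The difference estimate at a fixed scale *)

Section Interpolation.
Context {R : realType}.
Implicit Types (x y t h dl T B : R).

(** The weights contribute [dl^-N] to [coreL], with one more power for each derivative of a cut-off.
    The lower bound [dl / 2] in the covering argument then divides by [dl], which gives the factor
    [h / dl^(N + 1)] and leaves the terms with the [y]-derivative free of negative powers. *)
Lemma interpolation (bb : R -> R) (N : nat) (C A dl T B h : R)
    (W : nat -> nat -> nat -> R * R * R -> R) : continuous bb ->
  0 < C -> 0 < A -> 0 < dl -> A * dl <= 4^-1 -> adapted_cutoffs bb N C A dl ->
  0 < T -> 0 <= B -> 0 <= h <= 1 -> cyl T W -> pair_bound T (X0W bb W) B ->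
  nrm T (diffx h W 0%N 0%N 0%N) ^+ 2 <= (40 * C ^+ 2 + 80 * C + 40 + 4 * A ^+ 2) *
    (h / dl ^+ N.+1 * (B * (nrm T (W 0%N 0%N 0%N) / dl + nrm T (W 0%N 1%N 0%N)) +
       nrm T (W 0%N 0%N 0%N) ^+ 2 / T) +
     dl * nrm T (W 0%N 0%N 0%N) * nrm T (diffx h W 0%N 1%N 0%N) +
     dl ^+ 2 * nrm T (diffx h W 0%N 1%N 0%N) ^+ 2).
Proof.
move=> cbb C0 A0 dl0 Adl [kap [zeta [p [q [p' [q' [[skap kap0 kapb dkapb]
  [[szeta zeta01 dzeta] zeta0 zeta1] [p0 pq q1] [p'0 pq' q'1] [kD gl gr]]]]]]]].
move=> T0 B0 h01 cW gB.
have ckap := smooth_continuous _ skap.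
have tr := transport_le T B dl (C / dl ^+ N) (C / dl ^+ N.+1) (C / dl) p q p' q' bb kap zeta W
  T0 cW cbb gB skap szeta dl0 p0 pq q1 p'0 pq' q'1 kap0 zeta0 kapb dkapb zeta01 dzeta zeta1.
have core := core_le T dl (2 * dl) _ p q h bb kap W cW cbb ckap dl0 p0 pq q1 h01 kap0 kD tr.
have cm : continuous (fun y => kap y * (bb (y + dl) - bb y)) by cont.
have cov := cover_two_sided T (diffx h W) (fun y => kap y * (bb (y + dl) - bb y)) (dl / 2) (A * dl)
  (cyl_diffx _ _ _ cW) cm.
have {}cov : dl / 2 * nrm T (diffx h W 0%N 0%N 0%N) ^+ 2 <=
  5 * I3 T (fun z => kap z.1.2 * (bb (z.1.2 + dl) - bb z.1.2) * diffx h W 0%N 0%N 0%N z ^+ 2) +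
  4 * (dl / 2) * (A * dl) ^+ 2 * nrm T (diffx h W 0%N 1%N 0%N) ^+ 2.
  apply: cov => //.
  - by rewrite divr_gt0.
  - by rewrite mulr_ge0// ltW.
  - by move=> y; have /andP[] := kD y.
move: core cov; set a := nrm T (W 0%N 0%N 0%N); set n1 := nrm T (W 0%N 1%N 0%N).
set v1 := nrm T (diffx h W 0%N 1%N 0%N); set J := I3 T _; set v := nrm T _.
have a0 : 0 <= a by exact: nrm_ge0.
have n10 : 0 <= n1 by exact: nrm_ge0.
have v10 : 0 <= v1 by exact: nrm_ge0.
move=> core cov; have /andP[h0 h1] := h01.
pose s := h / dl ^+ N.+1.
have s0 : 0 <= s by rewrite divr_ge0// exprn_ge0// ltW.
have dln0 : dl != 0 by rewrite gt_eqF.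
pose E := B * (a / dl + n1); pose G := a ^+ 2 / T.
have ad0 : 0 <= a / dl by rewrite divr_ge0// ltW.
have E0 : 0 <= E by rewrite mulr_ge0// addr_ge0.
have G0 : 0 <= G by rewrite divr_ge0 ?sqr_ge0// ltW.
have sE0 : 0 <= s * E by exact: mulr_ge0.
have sG0 : 0 <= s * G by exact: mulr_ge0.
have X0 : 0 <= dl * a * v1 by rewrite !mulr_ge0// ltW.
have Y0 : 0 <= dl ^+ 2 * v1 ^+ 2 by rewrite mulr_ge0// sqr_ge0.
have hL : h * coreL T B (C / dl ^+ N) (C / dl ^+ N.+1) (C / dl) W <=
    dl * ((2 * C ^+ 2 + 4 * C) * (s * E + s * G)).
  have -> : h * coreL T B (C / dl ^+ N) (C / dl ^+ N.+1) (C / dl) W =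
    dl * (2 * C * (s * E) + 2 * C * (s * G) + 2 * C * (s * (B * (C * (a / dl) + n1)))).
    rewrite /coreL -/a -/n1 /s /E /G exprS.
    have : dl ^+ N != 0 by rewrite expf_neq0.
    move: (dl ^+ N) => D D0; field; rewrite dln0 D0 /=; exact: lt0r_neq0.
  rewrite ler_pM2l//.
  have e1 : s * (B * (C * (a / dl) + n1)) <= (C + 1) * (s * E).
    have -> : (C + 1) * (s * E) = s * (B * ((C + 1) * (a / dl + n1))) by rewrite /E; ring.
    apply: ler_wpM2l => //; apply: ler_wpM2l => //.
    have := mulr_ge0 (ltW C0) n10.
    have -> : (C + 1) * (a / dl + n1) = C * (a / dl) + a / dl + C * n1 + n1 by ring.
    lra.
  have e2 : 2 * C * (s * (B * (C * (a / dl) + n1))) <= 2 * C * ((C + 1) * (s * E)).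
    by apply: ler_wpM2l => //; lra.
  have e3 : 0 <= (2 * C ^+ 2 + 2 * C) * (s * G).
    by apply: mulr_ge0 => //; apply: addr_ge0; [rewrite mulr_ge0// sqr_ge0|lra].
  apply: le_trans (lerD (lexx _) e2) _.
  rewrite -subr_ge0; apply: (le_trans e3); rewrite le_eqVlt; apply/orP; left; apply/eqP; ring.
have key : v ^+ 2 <= 20 * ((2 * C ^+ 2 + 4 * C) * (s * E + s * G)) + 40 * (dl * a * v1) +
    4 * A ^+ 2 * (dl ^+ 2 * v1 ^+ 2).
  rewrite -(@ler_pM2l _ (dl / 2)); last by rewrite divr_gt0.
  apply: (le_trans cov).
  have -> : dl / 2 * (20 * ((2 * C ^+ 2 + 4 * C) * (s * E + s * G)) + 40 * (dl * a * v1) +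
    4 * A ^+ 2 * (dl ^+ 2 * v1 ^+ 2)) =
    5 * (2 * (dl * ((2 * C ^+ 2 + 4 * C) * (s * E + s * G))) + 2 * (2 * dl * dl * a * v1)) +
    4 * (dl / 2) * (A * dl) ^+ 2 * v1 ^+ 2 by field.
  rewrite lerD2r; apply: ler_wpM2l => //; apply: (le_trans core).
  by rewrite lerD2r; apply: ler_wpM2l.
apply: (le_trans key); rewrite -/s -/E -/G.
have c1 : 0 <= 40 * C ^+ 2 by rewrite mulr_ge0// sqr_ge0.
have c2 : 0 <= 4 * A ^+ 2 by rewrite mulr_ge0// sqr_ge0.
have q1' : 0 <= (40 + 4 * A ^+ 2) * (s * E + s * G).
  by rewrite mulr_ge0 ?addr_ge0.
have q2' : 0 <= (40 * C ^+ 2 + 80 * C + 4 * A ^+ 2) * (dl * a * v1).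
  by rewrite mulr_ge0// !addr_ge0//; lra.
have q3' : 0 <= (40 * C ^+ 2 + 80 * C + 40) * (dl ^+ 2 * v1 ^+ 2).
  by rewrite mulr_ge0// !addr_ge0//; lra.
rewrite -subr_ge0.
have -> : (40 * C ^+ 2 + 80 * C + 40 + 4 * A ^+ 2) *
    (s * (E + G) + dl * a * v1 + dl ^+ 2 * v1 ^+ 2) -
    (20 * ((2 * C ^+ 2 + 4 * C) * (s * E + s * G)) + 40 * (dl * a * v1) +
    4 * A ^+ 2 * (dl ^+ 2 * v1 ^+ 2)) =
  (40 + 4 * A ^+ 2) * (s * E + s * G) + (40 * C ^+ 2 + 80 * C + 4 * A ^+ 2) * (dl * a * v1) +
  (40 * C ^+ 2 + 80 * C + 40) * (dl ^+ 2 * v1 ^+ 2) by ring.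
by rewrite !addr_ge0.
Qed.

Lemma nrm_diffx_le T W h i j k : cyl T W ->
  nrm T (diffx h W i j k) <= 2 * nrm T (W i j k).
Proof.
move=> cW; have [c _ _ _ _] := cW; have [c' _ _ _ _] := cyl_shiftx T h W cW.
apply: (le_trans (nrmB_le T _ _ (c' i j k) (c i j k))).
by rewrite nrm_shiftx// mulr_natl mulr2n.
Qed.

Lemma X0W_diffx (bb : R -> R) W h : X0W bb (diffx h W) =
  (fun z => X0W bb W (z.1.1 + h, z.1.2, z.2) - X0W bb W z).
Proof. by apply/funext => z; rewrite /X0W /diffx /=; ring. Qed.

(* In the scaling [X = mu A], [Y = B / mu ^ (N + 2)] all powers of [mu] disappear. *)
Lemma second_difference (bb : R -> R) (N : nat) (C A mu sg T0 B M : R)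
    (W : nat -> nat -> nat -> R * R * R -> R) : continuous bb ->
  0 < C -> 0 < A -> 0 < mu -> 0 < sg -> sg <= 1 -> A * (mu * sg) <= 4^-1 ->
  adapted_cutoffs bb N C A (mu * sg) ->
  0 < T0 -> 0 <= B -> cyl (T0 / mu ^+ N.+1) W -> pair_bound (T0 / mu ^+ N.+1) (X0W bb W) B ->
  let T := T0 / mu ^+ N.+1 in
  let K := mu * nrm T (W 0%N 1%N 0%N) + B / mu ^+ N.+2 in
  nrm T (diffx (sg ^+ N.+3) W 0%N 0%N 0%N) <= sg * M ->
  nrm T (diffx (sg ^+ N.+3) (diffx (sg ^+ N.+3) W) 0%N 0%N 0%N) ^+ 2 <=
  (40 * C ^+ 2 + 80 * C + 40 + 4 * A ^+ 2) * sg ^+ 2 *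
    (6 * K * M + 20 * K ^+ 2 + M ^+ 2 / T0).
Proof.
move=> cbb C0 A0 mu0 sg0 sg1 Adl adapt T00 B0 cW gB T K hM.
have T0' : 0 < T by rewrite divr_gt0// exprn_gt0.
set h := sg ^+ N.+3.
have h01 : 0 <= h <= 1 by rewrite exprn_ge0 ?(ltW sg0)//= exprn_ile1// ltW.
have [cW' pW _ _ _] := cW.
have cg : continuous (X0W bb W).
  by rewrite /X0W; have c1 := cW' 0%N 0%N 1%N; have c2 := cW' 1%N 0%N 0%N; cont.
have gB' : pair_bound T (X0W bb (diffx h W)) (2 * B).
  rewrite X0W_diffx; apply: pair_bound_diffx => //.
  by move=> x y t y01 tT; rewrite /X0W /= !pW.
have B0' : 0 <= 2 * B by rewrite mulr_ge0.
have cdW := cyl_diffx T h W cW.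
have := interpolation bb N C A (mu * sg) T (2 * B) h (diffx h W) cbb C0 A0
  (mulr_gt0 mu0 sg0) Adl adapt T0' B0' h01 cdW gB'.
move/le_trans; apply; rewrite -[leRHS]mulrA; apply: ler_wpM2l.
  by rewrite !addr_ge0 ?mulr_ge0 ?sqr_ge0// ltW.
have n1le : nrm T (diffx h W 0%N 1%N 0%N) <= 2 * nrm T (W 0%N 1%N 0%N) by exact: nrm_diffx_le.
have v1le : nrm T (diffx h (diffx h W) 0%N 1%N 0%N) <= 4 * nrm T (W 0%N 1%N 0%N).
  have := nrm_diffx_le T (diffx h W) h 0%N 1%N 0%N cdW; lra.
have v10 := nrm_ge0 T (diffx h (diffx h W) 0%N 1%N 0%N).
have n10 := nrm_ge0 T (diffx h W 0%N 1%N 0%N).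
have a0 := nrm_ge0 T (diffx h W 0%N 0%N 0%N).
have A10 := nrm_ge0 T (W 0%N 1%N 0%N).
move: hM n1le v1le v10 n10 a0 A10; rewrite /K -/h.
set a := nrm T (diffx h W _ _ _); set A1 := nrm T (W _ _ _).
set n1 := nrm T (diffx h W _ _ _); set v1 := nrm T _ => hM n1le v1le v10 n10 a0 A10.
have M0 : 0 <= M by rewrite -(pmulr_rge0 _ sg0); exact: le_trans hM.
pose X := mu * A1; pose Y := B / mu ^+ N.+2.
have X0 : 0 <= X by rewrite mulr_ge0// ltW.
have Y0 : 0 <= Y by rewrite divr_ge0// exprn_ge0// ltW.
have e1 : h / (mu * sg) ^+ N.+1 * (2 * B * (a / (mu * sg) + n1) + a ^+ 2 / T) =
    2 * Y * (sg * a) + 2 * (sg ^+ 2 * (Y * (mu * n1))) + sg ^+ 2 * (a ^+ 2 / T0).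
  rewrite /h /Y /T exprMn !exprS.
  have : mu ^+ N != 0 by rewrite expf_neq0// gt_eqF.
  have : sg ^+ N != 0 by rewrite expf_neq0// gt_eqF.
  move: (mu ^+ N) (sg ^+ N) => U S S0 U0; field.
  by rewrite S0 U0 !gt_eqF.
rewrite e1 -/X -/Y.
(* The Hoelder bound on the first difference supplies the second factor [sg]. *)
have sa : sg * a <= sg ^+ 2 * M by rewrite expr2 -mulrA ler_wpM2l// ltW.
have t1 : 2 * Y * (sg * a) <= 2 * Y * (sg ^+ 2 * M) by apply: ler_wpM2l => //; rewrite mulr_ge0.
have t2 : sg ^+ 2 * (Y * (mu * n1)) <= sg ^+ 2 * (Y * (2 * X)).
  apply: ler_wpM2l; first exact: sqr_ge0.
  apply: ler_wpM2l => //; rewrite /X mulrCA; apply: ler_wpM2l => //; exact: ltW.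
have aM : a ^+ 2 <= M ^+ 2.
  rewrite ler_sqr ?nnegrE//; apply: (le_trans hM); rewrite -[leRHS]mul1r; exact: ler_wpM2r.
have t3 : sg ^+ 2 * (a ^+ 2 / T0) <= sg ^+ 2 * (M ^+ 2 / T0).
  by apply: ler_wpM2l; [exact: sqr_ge0|rewrite ler_wpM2r// invr_ge0 ltW].
have t4 : mu * sg * a * v1 <= 4 * X * (sg ^+ 2 * M).
  apply: (@le_trans _ _ ((sg ^+ 2 * M) * (mu * (4 * A1)))).
    have -> : mu * sg * a * v1 = (sg * a) * (mu * v1) by ring.
    apply: ler_pM => //; [by rewrite mulr_ge0// ltW|by rewrite mulr_ge0// ltW|].
    by apply: ler_wpM2l => //; exact: ltW.
  by rewrite /X le_eqVlt; apply/orP; left; apply/eqP; ring.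
have t5 : (mu * sg) ^+ 2 * v1 ^+ 2 <= sg ^+ 2 * (16 * X ^+ 2).
  have -> : sg ^+ 2 * (16 * X ^+ 2) = (mu * sg) ^+ 2 * (4 * A1) ^+ 2 by rewrite /X; ring.
  by apply: ler_wpM2l; [exact: sqr_ge0|rewrite ler_sqr ?nnegrE// mulr_ge0].
have -> : sg ^+ 2 * (6 * (X + Y) * M + 20 * (X + Y) ^+ 2 + M ^+ 2 / T0) =
  2 * Y * (sg ^+ 2 * M) + 2 * (sg ^+ 2 * (Y * (2 * X))) + sg ^+ 2 * (M ^+ 2 / T0) +
  4 * X * (sg ^+ 2 * M) + sg ^+ 2 * (16 * X ^+ 2) +
  sg ^+ 2 * (2 * (X * M) + 4 * (Y * M) + 36 * (X * Y) + 4 * X ^+ 2 + 20 * Y ^+ 2) by ring.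
have rest : 0 <= sg ^+ 2 * (2 * (X * M) + 4 * (Y * M) + 36 * (X * Y) + 4 * X ^+ 2 + 20 * Y ^+ 2).
  have := mulr_ge0 X0 M0; have := mulr_ge0 Y0 M0; have := mulr_ge0 X0 Y0.
  have := sqr_ge0 X; have := sqr_ge0 Y; have := sqr_ge0 sg => s2 Y2 X2 XY YM XM.
  by apply: mulr_ge0 => //; lra.
lra.
Qed.

End Interpolation.

(** * Differences in [x]: doubling, periodicity and zero mean *)

Section Holder.
Context {R : realType}.
Implicit Types (x y t h T : R) (W : nat -> nat -> nat -> R * R * R -> R).

Lemma eq_nrm T (F G : R * R * R -> R) :
  (forall x y t, 0 <= x < 1 -> 0 < y < 1 -> 0 < t < T -> F (x, y, t) = G (x, y, t)) ->
  nrm T F = nrm T G.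
Proof.
by move=> FG; rewrite /nrm; congr Num.sqrt; apply: I3_eq => x y t *; rewrite FG.
Qed.

Lemma nrmZ T (c : R) (F : R * R * R -> R) : continuous F -> 0 <= c ->
  nrm T (fun z => c * F z) = c * nrm T F.
Proof.
move=> cF c0; have cF2 : continuous (fun z => F z ^+ 2) by exact: continuous_sqr.
rewrite /nrm (_ : (fun z => (c * F z) ^+ 2) = (fun z => c ^+ 2 * F z ^+ 2)); last first.
  by apply/funext => z; rewrite exprMn.
by rewrite I3Z// sqrtrM ?sqr_ge0// sqrtr_sqr ger0_norm.
Qed.

Lemma nrm_diffx_periodic T W h (n : nat) : cyl T W ->
  nrm T (diffx (h + n%:R) W 0%N 0%N 0%N) = nrm T (diffx h W 0%N 0%N 0%N).
Proof.
move=> [cW pW _ _ _]; elim: n => [|n IH]; first by rewrite addr0.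
rewrite -IH; apply: eq_nrm => x y t _ y01 tT; rewrite /diffx /=.
by rewrite -natr1 !addrA pW.
Qed.

Lemma nrm_diffx0 T W : nrm T (diffx 0 W 0%N 0%N 0%N) = 0.
Proof.
rewrite /nrm (_ : (fun z => _) = (fun=> 0)); last first.
  by apply/funext => -[[x y] t]; rewrite /diffx /= addr0 subrr expr0n.
by rewrite /I3 Rintegral_cst ?mul0r ?sqrtr0//; exact: measurable_OmegaT.
Qed.

(** Twice the first difference is the difference of step [2 h] minus the second difference of step
    [h]. *)
Lemma nrm_diffx_double T W h : cyl T W ->
  2 * nrm T (diffx h W 0%N 0%N 0%N) <=
  nrm T (diffx (2 * h) W 0%N 0%N 0%N) + nrm T (diffx h (diffx h W) 0%N 0%N 0%N).
Proof.
move=> cW; have [c1 _ _ _ _] := cyl_diffx T h W cW.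
have [c2 _ _ _ _] := cyl_diffx T (2 * h) W cW.
have [c3 _ _ _ _] := cyl_diffx T h _ (cyl_diffx T h W cW).
rewrite -nrmZ//; apply: le_trans (nrmB_le _ _ _ (c2 0%N 0%N 0%N) (c3 0%N 0%N 0%N)).
rewrite le_eqVlt; apply/orP; left; apply/eqP; congr nrm; apply/funext => z.
rewrite /diffx /= (_ : z.1.1 + 2 * h = z.1.1 + h + h); first by ring.
by ring.
Qed.

(** A qualitative bound, its constant depending on the function: it makes the Hoelder seminorm
    finite, which absorption requires, and does not reach the final constant. *)
Lemma nrm_diffx_lipschitz T W : cyl T W -> exists2 C : R, 0 <= C &
  forall h, 0 <= h <= 1 -> nrm T (diffx h W 0%N 0%N 0%N) <= C * h.
Proof.
move=> cW; have [c pW dx _ _] := cW.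
have [M M0 hM] := continuous_bounded_box (W 1%N 0%N 0%N) T (c 1%N 0%N 0%N).
have I0 : 0 <= I3 T (fun=> 1) by apply: I3_ge0.
exists (M * Num.sqrt (I3 T (fun=> 1))); first by rewrite mulr_ge0// sqrtr_ge0.
move=> h /andP[h0 h1]; apply: nrm_le; first by rewrite !mulr_ge0// sqrtr_ge0.
have -> : (M * Num.sqrt (I3 T (fun=> 1)) * h) ^+ 2 = (M * h) ^+ 2 * I3 T (fun=> 1).
  by rewrite !exprMn sqr_sqrtr//; ring.
have c1 : continuous (fun _ : R * R * R => 1 : R) by cont.
have [c0 _ _ _ _] := cyl_diffx T h W cW.
rewrite -I3Z//; apply: I3_le; [by apply: continuous_sqr; exact: c0|by cont|].
move=> x y t /andP[x0 x1] y01 tT; rewrite mulr1 /diffx /=.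
have [r [r1 r2 ->]] := MVT_between (fun x => W 0%N 0%N 0%N (x, y, t)) (fun x => W 1%N 0%N 0%N (x, y, t))
  x (x + h) (fun x => dx _ _ _ x _ _ y01 tT).
rewrite (_ : x + h - x = h); last by ring.
rewrite -[leLHS]real_normK ?num_real// ler_sqr ?nnegrE ?mulr_ge0//.
rewrite normrM (ger0_norm h0) ler_wpM2r//; move: r1 r2.
have [y0 y1] := andP y01; have [t0 t1] := andP tT.
have -> : Num.min x (x + h) = x by apply/min_idPl; rewrite lerDl.
have -> : Num.max x (x + h) = x + h by apply/max_idPr; rewrite lerDl.
by move=> r1 r2; apply: hM; apply/andP; split; lra.
Qed.

Lemma root_exists (N : nat) (h : R) : 0 < h -> exists2 s : R, 0 < s & s ^+ N.+1 = h.
Proof.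
move=> h0; exists (h `^ (N.+1%:R^-1)); first exact: powR_gt0.
by rewrite -powR_mulrn ?powR_ge0// -powRrM mulVf ?pnatr_eq0// powRr1// ltW.
Qed.

(** Doubling leads from [s <= 1] to parameters above 1, and [norm_Q] takes all of them. By
    periodicity the increment is reduced modulo 1, and its root [r <= 1] is then smaller than
    [s]. *)
Lemma nrm_diffx_extend T W (N : nat) (M : R) : cyl T W -> 0 <= M ->
  (forall s, 0 < s <= 1 -> nrm T (diffx (s ^+ N.+1) W 0%N 0%N 0%N) <= s * M) ->
  forall s, 0 < s -> nrm T (diffx (s ^+ N.+1) W 0%N 0%N 0%N) <= s * M.
Proof.
move=> cW M0 hM s s0; have [s1|s1] := leP s 1; first by apply: hM; rewrite s0.
pose n := Num.truncn (s ^+ N.+1).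
have sN : 0 <= s ^+ N.+1 by rewrite exprn_ge0// ltW.
have /andP[n1 n2] : n%:R <= s ^+ N.+1 < n.+1%:R by exact: truncn_itv.
pose h := s ^+ N.+1 - n%:R.
have h0 : 0 <= h by rewrite subr_ge0.
have h1 : h < 1 by rewrite ltrBlDr addrC natr1.
rewrite (_ : s ^+ N.+1 = h + n%:R); last by rewrite subrK.
rewrite nrm_diffx_periodic//.
have [->|hn0] := eqVneq h 0; first by rewrite nrm_diffx0 mulr_ge0// ltW.
have hpos : 0 < h by rewrite lt_neqAle eq_sym hn0.
have [r r0 rh] := root_exists N h hpos.
rewrite -rh; have r1 : r <= 1 by rewrite -(@expr_le1 _ N.+1) ?ltW// rh.
apply: (@le_trans _ _ (r * M)); first by apply: hM; rewrite r0.
by rewrite ler_wpM2r//; exact: le_trans (ltW s1).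
Qed.

(* Riemann sums of a zero-mean function are small, hence the average over [h] of
   [||W(x + h) - W||^2] is [2 ||W||^2]. *)
Lemma nrm_le_of_mean0 T W (M : R) : cyl T W -> 0 <= M ->
  (forall y t, 0 < y < 1 -> 0 < t < T ->
    \int[lebesgue_measure]_(x in `[0, 1]) W 0%N 0%N 0%N (x, y, t) = 0) ->
  (forall h, 0 <= h <= 1 -> nrm T (diffx h W 0%N 0%N 0%N) <= M) ->
  nrm T (W 0%N 0%N 0%N) <= M.
Proof.
move=> cW M0 mean0 hM; have [c pW dx _ _] := cW.
have cw := c 0%N 0%N 0%N.
have [M1 M10 hM1] := continuous_bounded_box (W 1%N 0%N 0%N) T (c 1%N 0%N 0%N).
set w := W 0%N 0%N 0%N in cw *.
pose S (n k : nat) z := \sum_(j < k) w (z.1.1 + j%:R / n%:R, z.1.2, z.2).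
have cw2 : continuous (fun z => w z ^+ 2) by exact: continuous_sqr.
(* For each [j], expanding the squared difference of step [j / (n + 1)] gives [2 ||w||^2 <= M^2 + 2
   <w, w(x + j / (n + 1))>]; these are added for [j < k]. *)
have step1 n k : (k <= n.+1)%N -> continuous (S n.+1 k) /\
    2 * k%:R * I3 T (fun z => w z ^+ 2) <= k%:R * M ^+ 2 + 2 * I3 T (fun z => w z * S n.+1 k z).
  elim: k => [|k IH] kn.
    have -> : S n.+1 0%N = (fun=> 0) by apply/funext => z; rewrite /S big_ord0.
    split; first by cont.
    rewrite mulr0 !mul0r add0r mulr_ge0//; apply: le_trans (_ : I3 T (fun=> 0) <= _).
      exact: I3_ge0.
    by apply: I3_le; [by cont..|move=> *; rewrite mulr0].
  have [cS IHk] := IH (ltnW kn).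
  pose h : R := k%:R / n.+1%:R.
  have h01 : 0 <= h <= 1.
    by rewrite divr_ge0//= ler_pdivrMr// mul1r ler_nat ltnW.
  have SE : S n.+1 k.+1 = (fun z => S n.+1 k z + w (z.1.1 + h, z.1.2, z.2)).
    by apply/funext => z; rewrite /S big_ord_recr.
  have cwh : continuous (fun z : R * R * R => w (z.1.1 + h, z.1.2, z.2)) by cont.
  split; first by rewrite SE; cont.
  have dE : nrm T (diffx h W 0%N 0%N 0%N) ^+ 2 =
      2 * I3 T (fun z => w z ^+ 2) - 2 * I3 T (fun z => w z * w (z.1.1 + h, z.1.2, z.2)).
    rewrite sqr_nrm.
    have -> : I3 T (fun z => w z ^+ 2) = (I3 T (fun z => w (z.1.1 + h, z.1.2, z.2) ^+ 2) + I3 T (fun z => w z ^+ 2)) / 2.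
      rewrite (I3_shift_x (fun z => w z ^+ 2))//; first by field.
      by move=> x y t y01 tT; rewrite /w pW.
    rewrite mulrC divfK ?pnatr_eq0//.
    rewrite -I3Z; last by cont.
    rewrite -I3D; [|by cont..]; rewrite -I3B; [|by cont..].
    by congr I3; apply/funext => z; rewrite /diffx -/w; ring.
  have hb : nrm T (diffx h W 0%N 0%N 0%N) ^+ 2 <= M ^+ 2.
    by rewrite ler_sqr ?nnegrE ?nrm_ge0//; exact: hM.
  have -> : I3 T (fun z => w z * S n.+1 k.+1 z) =
      I3 T (fun z => w z * S n.+1 k z) + I3 T (fun z => w z * w (z.1.1 + h, z.1.2, z.2)).
    rewrite -I3D; [|by cont..]; congr I3; apply/funext => z; rewrite SE; ring.
  rewrite -[k.+1%:R]natr1.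
  have -> : 2 * (k%:R + 1) * I3 T (fun z => w z ^+ 2) =
    2 * k%:R * I3 T (fun z => w z ^+ 2) + 2 * I3 T (fun z => w z ^+ 2) by ring.
  have -> : (k%:R + 1) * M ^+ 2 = k%:R * M ^+ 2 + M ^+ 2 by ring.
  move: hb; rewrite dE; lra.
(* The sum is not divided by its number of terms: a Riemann sum is within [M1 / (n + 1)] of the mean
   0, so [S] stays bounded by [M1] for every [n]. *)
have Sb n x y t : 0 <= x < 1 -> 0 < y < 1 -> 0 < t < T -> `|S n.+1 n.+1 (x, y, t)| <= M1.
  move=> /andP[x0 x1] y01 tT.
  have [y0 y1] := andP y01; have [t0 t1] := andP tT.
  pose u r := w (r, y, t).
  have cu : continuous u by exact: slice_continuous1.
  have [U dU] := antiderivative u cu.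
  have U1 : U (x + 1) = U x.
    have e0 : U 1 - U 0 = 0 by rewrite -(Rint_antiderivative u U 0 1)//; exact: mean0.
    have [|z [_ _]] := MVT_between (fun z => U (z + 1) - U z) (cst 0) 0 x.
      move=> z; have := is_deriveB (is_derive_comp_shift U 1 z _ (dU (z + 1))) (dU z).
      by rewrite /u /w pW// subrr.
    by rewrite mul0r add0r => e1; lra.
  pose d : R := n.+1%:R^-1.
  have d0 : 0 < d by rewrite invr_gt0.
  have n1 : n.+1%:R * d = 1 by rewrite divff// pnatr_eq0.
  have part k : (k <= n.+1)%N ->
      `|U (x + k%:R * d) - U x - d * S n.+1 k (x, y, t)| <= k%:R * (M1 * d ^+ 2).
    elim: k => [|k IH] kn.
      by rewrite /S big_ord0 !mul0r mulr0 addr0 subrr subr0 normr0.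
    have tay := taylor1_le U u (fun r => W 1%N 0%N 0%N (r, y, t)) M1 (x + k%:R * d) (x + k.+1%:R * d) dU
      (fun r => dx _ _ _ r _ _ y01 tT).
    have kd1 : k.+1%:R * d <= 1 by rewrite -[leRHS]n1 ler_wpM2r ?(ltW d0)// ler_nat.
    have kd0 : 0 <= k%:R * d by rewrite mulr_ge0// ltW.
    have kk : k.+1%:R * d = k%:R * d + d by rewrite -natr1 mulrDl mul1r.
    have {}tay : `|U (x + k.+1%:R * d) - U (x + k%:R * d) - d * u (x + k%:R * d)| <= M1 * d ^+ 2.
      move: tay; rewrite (_ : x + k.+1%:R * d - (x + k%:R * d) = d); last by rewrite kk; ring.
      apply=> r; have -> : Num.min (x + k%:R * d) (x + k.+1%:R * d) = x + k%:R * d.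
        by apply/min_idPl; rewrite kk; lra.
      have -> : Num.max (x + k%:R * d) (x + k.+1%:R * d) = x + k.+1%:R * d.
        by apply/max_idPr; rewrite kk; lra.
      by move=> /andP[r1 r2]; apply: hM1; apply/andP; split; lra.
    have -> : S n.+1 k.+1 (x, y, t) = S n.+1 k (x, y, t) + u (x + k%:R * d).
      by rewrite /S big_ord_recr.
    have -> : U (x + k.+1%:R * d) - U x - d * (S n.+1 k (x, y, t) + u (x + k%:R * d)) =
      (U (x + k.+1%:R * d) - U (x + k%:R * d) - d * u (x + k%:R * d)) +
      (U (x + k%:R * d) - U x - d * S n.+1 k (x, y, t)) by ring.
    have -> : k.+1%:R * (M1 * d ^+ 2) = M1 * d ^+ 2 + k%:R * (M1 * d ^+ 2).
      by rewrite -[k.+1%:R]natr1; ring.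
    apply: (le_trans (ler_normD _ _)).
    by apply: lerD; [exact: tay|exact: IH (ltnW kn)].
  have := part n.+1 (leqnn _); rewrite n1 U1 subrr sub0r normrN normrM (gtr0_norm d0).
  have -> : n.+1%:R * (M1 * d ^+ 2) = d * M1.
    rewrite (_ : _ * _ = n.+1%:R * d * (d * M1)); first by rewrite n1 mul1r.
    by ring.
  by rewrite ler_pM2l.
apply: nrm_le => //.
suff key : 2 * I3 T (fun z => w z ^+ 2) <= M ^+ 2.
  have : 0 <= I3 T (fun z => w z ^+ 2) by apply: I3_ge0 => z; exact: sqr_ge0.
  lra.
pose G := I3 T (fun z => M1 * (w z ^+ 2 + 1)).
have G0 : 0 <= G by apply: I3_ge0 => z; rewrite mulr_ge0// addr_ge0// sqr_ge0.
apply/ler_addgt0Pr => e e0.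
have [n hn] : exists n : nat, 2 * G / n.+1%:R <= e.
  exists (Num.truncn (2 * G / e)).
  rewrite ler_pdivrMr// -ler_pdivrMl// [_^-1 * _]mulrC.
  by apply/ltW; apply: truncnS_gt.
have [cS h1] := step1 n n.+1 (leqnn _).
have h2 : I3 T (fun z => w z * S n.+1 n.+1 z) <= G.
  apply: I3_le; [by cont..|move=> x y t x01 y01 tT].
  apply: (le_trans (ler_norm _)); rewrite normrM mulrC; apply: ler_pM => //; first exact: Sb.
  have := sqr_ge0 (`|w (x, y, t)| - 1); rewrite sqrrB expr1n mulr1 real_normK ?num_real//.
  have := normr_ge0 (w (x, y, t)); rewrite -mulr_natl; lra.
have n0 : 0 < n.+1%:R :> R by [].
rewrite -(@ler_pM2l _ n.+1%:R)// mulrDr.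
rewrite ler_pdivrMr// [e * _]mulrC in hn.
rewrite mulrA [n.+1%:R * 2]mulrC; lra.
Qed.

End Holder.

(** * Absorption of the Hoelder seminorm *)

Section Main.
Context {R : realType}.
Implicit Types (T : R) (W : nat -> nat -> nat -> R * R * R -> R).

(** [T0] is chosen so that the boundary contribution [c M^2 / T0] is half of [d^2 M^2]. Young's
    inequality spends another quarter on the mixed term [6 c K M], and the last quarter is left to
    bound [M] by [K]. *)
Lemma self_improvement (q d c K M T0 : R) : 0 < d -> 0 < c -> T0 = 2 * c / d ^+ 2 ->
  0 <= q -> q ^+ 2 = c * (6 * K * M + 20 * K ^+ 2 + M ^+ 2 / T0) -> 0 <= M ->
  d * M <= q ->
  M ^+ 2 <= 4 / d ^+ 2 * (36 * c ^+ 2 / d ^+ 2 + 20 * c) * K ^+ 2.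
Proof.
move=> d0 c0 T0E q0 qE M0 dM.
have d2 : 0 < d ^+ 2 by rewrite exprn_gt0.
have h1 : (d * M) ^+ 2 <= q ^+ 2 by rewrite ler_sqr ?nnegrE// mulr_ge0// ltW.
have h2 : c * (M ^+ 2 / T0) = d ^+ 2 / 2 * M ^+ 2.
  by rewrite T0E; field; rewrite !lt0r_neq0.
have h3 : 6 * c * K * M <= d ^+ 2 / 4 * M ^+ 2 + 36 * c ^+ 2 / d ^+ 2 * K ^+ 2.
  have := sqr_ge0 (d / 2 * M - 6 * c * K / d).
  suff -> : (d / 2 * M - 6 * c * K / d) ^+ 2 =
      d ^+ 2 / 4 * M ^+ 2 + 36 * c ^+ 2 / d ^+ 2 * K ^+ 2 - 6 * c * K * M by lra.
  by field; rewrite lt0r_neq0.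
rewrite -mulrA -[4 / _]invf_div ler_pdivlMl ?divr_gt0//.
move: h1; rewrite qE exprMn !mulrDr h2; move: h3; rewrite mulrDl.
have -> : c * (6 * K * M) = 6 * c * K * M by ring.
have -> : c * (20 * K ^+ 2) = 20 * c * K ^+ 2 by ring.
clear; lra.
Qed.

Lemma holder_bound (bb : R -> R) (N : nat) (C A : R) : continuous bb -> 0 < C -> 0 < A ->
  exists T0 L : R, [/\ 0 < T0, 0 < L & forall (mu B : R) W, 0 < mu ->
    (forall sg : R, 0 < sg <= 1 -> A * (mu * sg) <= 4^-1 /\ adapted_cutoffs bb N C A (mu * sg)) ->
    0 <= B -> let T := T0 / mu ^+ N.+1 in
    cyl T W -> pair_bound T (X0W bb W) B ->
    (forall y t : R, 0 < y < 1 -> 0 < t < T ->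
      \int[lebesgue_measure]_(x in `[0, 1]) W 0%N 0%N 0%N (x, y, t) = 0) ->
    exists2 M : R, 0 <= M & [/\
      M ^+ 2 <= L * (mu * nrm T (W 0%N 1%N 0%N) + B / mu ^+ N.+2) ^+ 2,
      nrm T (W 0%N 0%N 0%N) <= M &
      forall sg : R, 0 < sg -> nrm T (diffx (sg ^+ N.+3) W 0%N 0%N 0%N) <= sg * M]].
Proof.
move=> cbb C0 A0.
(* As in Marchaud's inequality: doubling the increment [s ^+ N.+3] multiplies [s]
   only by [c < 2], so the first difference is absorbed by itself. *)
have [c c0 cN] := root_exists N.+2 (2 : R) (ltr0Sn R 1).
have c2 : c < 2.
  rewrite ltNge; apply/negP => c2.
  have : 2 ^+ N.+3 <= c ^+ N.+3 :> R by rewrite lerXn2r ?nnegrE// ltW.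
  rewrite cN exprS; have : 2 <= 2 ^+ N.+2 :> R; last lra.
  rewrite exprS ler_pMr// exprn_ege1//; lra.
pose c' : R := 40 * C ^+ 2 + 80 * C + 40 + 4 * A ^+ 2.
have c'0 : 0 < c'.
  have := sqr_ge0 C; have := sqr_ge0 A; rewrite /c'; lra.
pose d := 2 - c; have d0 : 0 < d by rewrite subr_gt0.
exists (2 * c' / d ^+ 2), (4 / d ^+ 2 * (36 * c' ^+ 2 / d ^+ 2 + 20 * c')).
split.
- by rewrite divr_gt0 ?exprn_gt0 ?mulr_gt0.
- have c'2 : 0 < 36 * c' ^+ 2 / d ^+ 2 by rewrite divr_gt0 ?mulr_gt0 ?exprn_gt0.
  by rewrite mulr_gt0 ?divr_gt0 ?exprn_gt0// addr_gt0// mulr_gt0.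
move=> mu B W mu0 hcut B0 T cW gB mean0.
set T0 := 2 * c' / d ^+ 2 in T cW gB mean0 *.
have T00 : 0 < T0 by rewrite divr_gt0 ?exprn_gt0 ?mulr_gt0.
pose a s := nrm T (diffx (s ^+ N.+3) W 0%N 0%N 0%N).
have a0 s : 0 <= a s by exact: nrm_ge0.
have [L L0 aL] := nrm_diffx_lipschitz T W cW.
have powle (s : R) : 0 < s <= 1 -> 0 <= s ^+ N.+3 <= 1 /\ s ^+ N.+3 <= s.
  move=> /andP[s0 s1]; rewrite exprn_ge0 ?exprn_ile1 ?(ltW s0)//; split=> //.
  by rewrite exprS ler_piMr ?exprn_ile1// ltW.
(* The Hoelder quotients are bounded by the Lipschitz constant, because [s ^+ N.+3 <= s] on this
   range. *)
pose E := [set a s / s | s in [set s : R | 0 < s <= 1]].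
have supE : has_sup E.
  split; first by exists (a 1 / 1); exists 1 => //=; rewrite ltr01 lexx.
  exists L => _ [s /= s01 <-]; have [s1 s2] := powle s s01.
  have /andP[s0 _] := s01; rewrite ler_pdivrMr//.
  by apply: (le_trans (aL _ s1)); rewrite ler_wpM2l.
pose M := sup E.
have aM1 s : 0 < s <= 1 -> a s <= s * M.
  move=> s01; have /andP[s0 _] := s01; rewrite mulrC -ler_pdivrMr//.
  by apply: ub_le_sup; [exact: supE.2|exists s].
have M0 : 0 <= M.
  by apply: le_trans (a0 1) _; rewrite -[leRHS]mul1r; apply: aM1; rewrite ltr01 lexx.
have aM s : 0 < s -> a s <= s * M by apply: nrm_diffx_extend.
pose K := mu * nrm T (W 0%N 1%N 0%N) + B / mu ^+ N.+2.
have K0 : 0 <= K.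
  by rewrite addr_ge0 ?mulr_ge0 ?nrm_ge0 ?invr_ge0 ?exprn_ge0 ?(ltW mu0).
pose Z := c' * (6 * K * M + 20 * K ^+ 2 + M ^+ 2 / T0).
have Z0 : 0 <= Z.
  have KM : 0 <= K * M by rewrite mulr_ge0.
  have M2 : 0 <= M ^+ 2 / T0 by rewrite divr_ge0 ?sqr_ge0// ltW.
  rewrite mulr_ge0 ?(ltW c'0)// -mulrA; have := sqr_ge0 K.
  by clear -KM M2; lra.
exists M => //; split=> //.
  apply: (self_improvement (Num.sqrt Z) d c' K M T0) => //; rewrite ?sqrtr_ge0 ?sqr_sqrtr//.
  (* Doubling the increment replaces [s] by [c * s], so the first difference of double step
     contributes [c * s * M], and the second difference [s * Num.sqrt Z] by [second_difference]. *)
  have aq s : 0 < s <= 1 -> 2 * a s <= s * (c * M + Num.sqrt Z).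
    move=> s01; have /andP[s0 s1] := s01; have [h1 h2] := hcut _ s01.
    have := nrm_diffx_double T W (s ^+ N.+3) cW; rewrite -/(a s) -cN -exprMn -/(a (c * s)).
    move=> /le_trans -> //; rewrite mulrDr; apply: lerD.
      by apply: (le_trans (aM _ (mulr_gt0 c0 s0))); rewrite mulrCA mulrA.
    rewrite -[leRHS]ger0_norm ?mulr_ge0 ?sqrtr_ge0 ?(ltW s0)//.
    rewrite -[leLHS]ger0_norm ?nrm_ge0// -ler_sqr ?nnegrE ?normr_ge0// !real_normK ?num_real//.
    rewrite exprMn (sqr_sqrtr Z0).
    have := second_difference bb N C A mu s T0 B M W cbb C0 A0 mu0 s0 s1 h1 h2 T00 B0 cW gB (aM _ s0).
    move=> h; apply: (le_trans h); rewrite /Z -/K -/c' le_eqVlt; apply/orP; left; apply/eqP.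
    by rewrite [s ^+ 2 * _]mulrCA mulrA.
  (* Taking the supremum over [s] closes the inequality on [M] itself, namely
     [(2 - c) * M <= Num.sqrt Z]. *)
  have : M <= (c * M + Num.sqrt Z) / 2.
    apply: ge_sup; first exact: supE.1.
    move=> _ [s /= s01 <-]; have h := aq s s01; have /andP[s0 _] := s01.
    move: h; rewrite ler_pdivrMr//; clear; lra.
  by rewrite /d; lra.
apply: nrm_le_of_mean0 => // h /andP[h0 h1].
have [->|hn0] := eqVneq h 0; first by rewrite nrm_diffx0.
have hpos : 0 < h by rewrite lt_neqAle eq_sym hn0.
have [r r0 rh] := root_exists N.+2 h hpos.
rewrite -rh; have r1 : r <= 1 by rewrite -(@expr_le1 _ N.+3) ?(ltW r0)// rh.
by apply: (le_trans (aM _ r0)); rewrite ler_piMl.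
Qed.

End Main.

(** * Return to the norms and parameters of the statement *)

Section Final.
Context {R : realType}.

Lemma continuous_clamped_profile (u : R -> R) : {within `[0, 1], continuous u} ->
  continuous (fun y => u (clamp 1 y)).
Proof.
move=> /subspace_continuousP cu y A nA.
have c01 r : `[0, 1]%classic (clamp 1 r) by rewrite /= in_itv /= clamp_itv.
have hA : nbhs (clamp 1 y) (fun r => `[0, 1]%classic r -> A (u r)) by exact: cu nA.
have hy : nbhs y (fun r => `[0, 1]%classic (clamp 1 r) -> A (u (clamp 1 r))).
  exact: (continuous_clamp 1 y _ hA).
by apply: (@filterS _ (nbhs y) _ _ _ _ hy) => r; apply.
Qed.

(** The factor [mu^(N+1)] turns [mu^2] into [nu = mu^(N+3)] and [mu^-(2N+4)] into [1 / nu]. The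
    constant is [2 * 8]: 2 from [A0 <= M], and 8 from splitting the square around [2 * B]. *)
Lemma final_estimate (N : nat) (mu A0 A1 B L M : R) : 0 < mu -> 0 <= A0 -> 0 < L ->
  A0 <= M -> M ^+ 2 <= L * (mu * A1 + 2 * B / mu ^+ N.+2) ^+ 2 ->
  mu ^+ N.+1 * A0 ^+ 2 + mu ^+ N.+1 * M ^+ 2 <=
  16 * L * (mu ^+ N.+3 * A1 ^+ 2 + (mu ^+ N.+3)^-1 * B ^+ 2).
Proof.
move=> mu0 A00 L0 A0M hM.
have m0 : 0 < mu ^+ N.+1 by rewrite exprn_gt0.
have A2 : A0 ^+ 2 <= M ^+ 2 by rewrite ler_sqr ?nnegrE//; exact: le_trans A0M.
have sq : (mu * A1 + 2 * B / mu ^+ N.+2) ^+ 2 <=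
    2 * (mu * A1) ^+ 2 + 2 * (2 * B / mu ^+ N.+2) ^+ 2.
  by have := sqr_ge0 (mu * A1 - 2 * B / mu ^+ N.+2); rewrite sqrrB sqrrD; clear; lra.
have E : mu ^+ N.+1 * (2 * (mu * A1) ^+ 2 + 2 * (2 * B / mu ^+ N.+2) ^+ 2) =
    2 * (mu ^+ N.+3 * A1 ^+ 2) + 8 * ((mu ^+ N.+3)^-1 * B ^+ 2).
  rewrite [mu ^+ N.+3]exprS [mu ^+ N.+2]exprS; field.
  by rewrite !lt0r_neq0.
have h1 : mu ^+ N.+1 * A0 ^+ 2 + mu ^+ N.+1 * M ^+ 2 <= mu ^+ N.+1 * (2 * M ^+ 2).
  by rewrite -mulrDr ler_pM2l//; move: A2; clear; lra.
apply: (le_trans h1).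
have h2 : mu ^+ N.+1 * (2 * M ^+ 2) <= 2 * L * (mu ^+ N.+1 * (2 * (mu * A1) ^+ 2 + 2 * (2 * B / mu ^+ N.+2) ^+ 2)).
  rewrite [leLHS]mulrCA [leRHS](_ : _ = 2 * (mu ^+ N.+1 * (L * (2 * (mu * A1) ^+ 2 + 2 * (2 * B / mu ^+ N.+2) ^+ 2)))); last by ring.
  rewrite ler_pM2l// ler_pM2l//.
  by apply: (le_trans hM); rewrite ler_pM2l.
apply: (le_trans h2); rewrite E.
have x0 : 0 <= mu ^+ N.+3 * A1 ^+ 2 by rewrite mulr_ge0 ?sqr_ge0 ?exprn_ge0// ltW.
rewrite [16 * L]mulrC [2 * L]mulrC -[leLHS]mulrA -[leRHS]mulrA ler_pM2l//.
by move: x0; clear; lra.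
Qed.

End Final.

Theorem proposition1p5 (R : realType) (b : R -> R) (db : nat -> R -> R)
  (M : nat) (yc : 'I_M -> R) (n : 'I_M -> nat)
  (hb : smooth_profile b db) (hcrit : critical_points db yc n) :
  let N := max_order n in
  let alpha : R := N.+1%:R / N.+3%:R in
  exists nu0 T0 C : R, [/\ 0 < nu0, 0 < T0, 0 < C &
    forall nu : R, 0 < nu -> nu <= nu0 ->
    let T := T0 * nu `^ (- alpha) in
    forall f : R * R * R -> R,
      smooth_closedCyl T f -> periodic_x T f ->
      (forall x t : R, 0 <= t <= T -> f (x, 0, t) = 0 /\ f (x, 1, t) = 0) ->
      (forall y t : R, 0 <= y <= 1 -> 0 <= t <= T ->
        \int[lebesgue_measure]_(x in `[0, 1[) f (x, y, t) = 0) ->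
      ((nu `^ alpha)%:E * L2normOT T f ^+ 2
         + (nu `^ alpha)%:E * norm_Q (N.+3%:R)^-1 T f ^+ 2
       <= C%:E * (nu%:E * norm_L2H10 T f ^+ 2
                  + (nu^-1)%:E * norm_L2Hm1 T (X0 b f) ^+ 2))%E].
Proof.
move=> N alpha.
have [C [A [d0 [C0 A0 d00 hcut]]]] := profile_cutoffs b db M yc n hb hcrit.
rewrite -/N in hcut.
pose bb y := b (clamp 1 y).
have cbb : continuous bb.
  by have [b0 cdb _] := hb; apply: continuous_clamped_profile; rewrite -b0.
have [T0 [L [T00 L0 hold]]] := holder_bound bb N C A cbb C0 A0.
(* The bound on [nu] amounts to [mu <= d0], so that every width [mu * sg] with [sg <= 1] admits
   cut-offs. *)
exists (d0 ^+ N.+3), T0, (16 * L); split; rewrite ?exprn_gt0 ?mulr_gt0//.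
move=> nu nu_gt0 nu_le T f sf pf _ mean0.
have [mu mu0 muE] := root_exists N.+2 nu nu_gt0.
have mud0 : mu <= d0.
  by rewrite -(@ler_pXn2r _ N.+3) ?nnegrE ?(ltW mu0) ?(ltW d00)// muE.
have alphaE : nu `^ alpha = mu ^+ N.+1.
  rewrite -muE -(powR_mulrn N.+3 (ltW mu0)) -powRrM /alpha mulrCA divff ?pnatr_eq0//.
  by rewrite mulr1 powR_mulrn// ltW.
have TE : T = T0 / mu ^+ N.+1 by rewrite /T powRN alphaE.
have Tpos : 0 < T by rewrite TE divr_gt0// exprn_gt0.
have [W [cW Wf dW]] := cyl_of_smooth T f Tpos sf pf.
have [c _ _ _ _] := cW.
have sub1 z : OmegaT T z -> openCyl T z by case.
have sub2 z : OmegaT T z -> closedCyl T z.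
  by move=> [_ /andP[y0 y1] /andP[t0 t1]]; rewrite /closedCyl /= !ltW.
have nE : L2normOT T f = (nrm T (W 0%N 0%N 0%N))%:E.
  by rewrite -L2normOT_I3//; apply: eq_L2normOT => z /sub2 /Wf.
have dE : norm_L2H10 T f = (nrm T (W 0%N 1%N 0%N))%:E.
  rewrite -L2normOT_I3//; apply: eq_L2normOT => z /sub1 /dW.
  by case.
have QE s : 0 < s -> L2normOT T (fun z => f (z.1.1 + s `^ ((N.+3%:R)^-1)^-1, z.1.2, z.2) - f z) =
    (nrm T (diffx (s ^+ N.+3) W 0%N 0%N 0%N))%:E.
  move=> s0; have [cd _ _ _ _] := cyl_diffx T (s ^+ N.+3) W cW.
  rewrite -L2normOT_I3//; apply: eq_L2normOT => -[[x y] t] /sub2 zT.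
  by rewrite invrK powR_mulrn ?(ltW s0)// /diffx !Wf.
have X0E z : OmegaT T z -> X0 b f z = X0W bb W z.
  move=> zT; have [e1 _ e2] := dW z (sub1 z zT); rewrite /X0 /X0W e1 e2 /bb clamp_id//.
  by have [/andP[? ?] _] := sub2 z zT; apply/andP.
have cX : continuous (X0W bb W) by rewrite /X0W; cont.
have Q0 : (0 <= norm_Q (N.+3%:R)^-1 T f)%E.
  apply: (@le_trans _ _ ((1^-1)%:E * L2normOT T (fun z => (f (z.1.1 + 1 `^ ((N.+3%:R)^-1)^-1, z.1.2, z.2) - f z)%R)))%E.
    by rewrite QE// -EFinM lee_fin mulr_ge0// nrm_ge0.
  by apply: ereal_sup_ubound; exists 1.
(* If the dual norm is infinite, its square is [+oo] whatever its sign, and so is the right-hand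
   side. *)
have [Bn|] := boolP (norm_L2Hm1 T (X0 b f) \is a fin_num); last first.
  move=> Binf.
  have -> : (norm_L2Hm1 T (X0 b f) ^+ 2 = +oo)%E.
    by move: Binf; case: (norm_L2Hm1 T (X0 b f)) => //= _; rewrite expe2 ?mulyy ?mulNyNy.
  rewrite dE -EFin_expe -EFinM gt0_muley ?lte_fin ?invr_gt0// addey//.
  by rewrite gt0_muley ?lte_fin ?mulr_gt0// leey.
pose Br := fine (norm_L2Hm1 T (X0 b f)).
have BE : norm_L2Hm1 T (X0 b f) = Br%:E by rewrite fineK.
(* The pairing bound asks for a nonnegative constant; truncating at 0 spares a proof that the
   supremum is nonnegative and does not increase the square. *)
pose B := Num.max Br 0.
have B0 : 0 <= B by rewrite le_max lexx orbT.
have B2 : B ^+ 2 <= Br ^+ 2.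
  by rewrite /B; case: (leP Br 0) => _; rewrite ?expr0n ?sqr_ge0.
have gB : pair_bound T (X0W bb W) (2 * B).
  apply: (pair_bound_of_dual T B (X0 b f)) => // phi dphi h1 h2.
  apply: (@le_trans _ _ Br%:E); last by rewrite lee_fin le_max lexx.
  by rewrite -BE; apply: ereal_sup_ubound; exists phi, dphi.
have [M' M'0 [M'1 M'2 M'3]] : exists2 M' : R, 0 <= M' & [/\
      M' ^+ 2 <= L * (mu * nrm T (W 0%N 1%N 0%N) + 2 * B / mu ^+ N.+2) ^+ 2,
      nrm T (W 0%N 0%N 0%N) <= M' &
      forall sg, 0 < sg -> nrm T (diffx (sg ^+ N.+3) W 0%N 0%N 0%N) <= sg * M'].
  rewrite TE; rewrite TE in cW gB; apply: hold => //.
  - move=> sg /andP[s0 s1]; apply: hcut; first exact: mulr_gt0.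
    by apply: le_trans mud0; rewrite ler_piMr// ltW.
  - by rewrite mulr_ge0.
  - move=> y t y01 tT; rewrite -TE in tT.
    have [/ltW y0 /ltW y1] := andP y01; have [/ltW t0 /ltW t1] := andP tT.
    rewrite -Rint_co; last exact: slice_continuous1.
    rewrite -[RHS](mean0 y t); [|by rewrite y0|by rewrite t0].
    apply: eq_Rintegral => x _; apply: Wf; split => /=; first by rewrite y0.
    by rewrite t0.
have QM : (norm_Q (N.+3%:R)^-1 T f <= M'%:E)%E.
  apply: ge_ereal_sup => _ [s s0 ->]; rewrite QE// -EFinM lee_fin.
  by rewrite ler_pdivrMl// M'3.
have QM2 : (norm_Q (N.+3%:R)^-1 T f ^+ 2 <= (M' ^+ 2)%:E)%E.
  have Qf : norm_Q (N.+3%:R)^-1 T f \is a fin_num.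
    by rewrite ge0_fin_numE//; apply: (le_lt_trans QM); rewrite ltry.
  move: QM Q0; rewrite -(fineK Qf) -EFin_expe !lee_fin => QM Q0.
  by rewrite ler_sqr ?nnegrE.
rewrite nE dE BE -!EFin_expe -!EFinM alphaE.
apply: (@le_trans _ _ ((mu ^+ N.+1 * nrm T (W 0%N 0%N 0%N) ^+ 2)%:E + (mu ^+ N.+1 * M' ^+ 2)%:E)%E).
  by apply: leeD => //; rewrite EFinM lee_wpmul2l// lee_fin exprn_ge0// ltW.
rewrite -EFinD lee_fin -muE.
apply: (le_trans (final_estimate N mu (nrm T (W 0%N 0%N 0%N)) (nrm T (W 0%N 1%N 0%N)) B L M' mu0 (nrm_ge0 _ _) L0 M'2 M'1)).
rewrite ler_pM2l ?mulr_gt0// lerD2l ler_wpM2l//.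
by rewrite invr_ge0 exprn_ge0// ltW.
Qed.
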